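(* Let $\Sigma=\mathbb{C}\setminus\{0,1\}$ and let $|W|:|\mathbb{C}\pi_1(\Sigma)|\to|TH_1|$ be the holonomy map. Let $F=F_{\Phi_{\rm KZ}}$ be the solution of the Kashiwara-Vergne problem corresponding to the Knizhnik-Zamolodchikov associator $\Phi_{\rm KZ}(x,y)$, and let $\rho_F:\mathbb{C}\pi_1\to TH_1$ be the algebra homomorphism with $\rho_F(\gamma_0)=\exp(F(x))$, $\rho_F(\gamma_1)=\exp(F(y))$. Then $|W|$ coincides with the map $|\mathbb{C}\pi_1|\to|TH_1|$ induced by $\rho_F$.
   Context: **Setting.** $TH_1$ is the degree-completed free associative algebra over $\mathbb{C}$ on $x,y$, where $x=a_1$, $y=a_2$ are the classes in $H_1(\Sigma;\mathbb{C})$ of counterclockwise loops around $0$ and $1$; $|TH_1|=TH_1/[TH_1,TH_1]$ (closed span of commutators). Fix a base point $p\in(0,1)$ and $\pi_1=\pi_1(\Sigma,p)$; the product $\gamma\gamma'$ means first $\gamma'$, then $\gamma$. $\pi_1$ is free on $\gamma_0$ (the counterclockwise circle through $p$ centered at $0$) and $\gamma_1$ (the counterclockwise circle through $p$ centered at $1$). $|\mathbb{C}\pi_1|=\mathbb{C}\pi_1/[\mathbb{C}\pi_1,\mathbb{C}\pi_1]$ is the span of conjugacy classes. **Holonomy map.** Let $A(z)=\frac{1}{2\pi i}\big(x\,d\log z+y\,d\log(z-1)\big)$. For a path $\gamma$ parametrized by $z:[0,1]\to\Sigma$, $\mathrm{Hol}_\gamma=\sum_{k\ge0}\int_{1\ge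 t_1\ge\dots\ge t_k\ge0}A(z(t_1))\cdots A(z(t_k))\in TH_1$. $W(\gamma)=\mathrm{Hol}_\gamma$ is a homomorphism from $\pi_1$ to the group-like elements of $TH_1$, and $|W|$ is the induced map $|\mathbb{C}\pi_1|\to|TH_1|$. **KZ associator.** On $(0,1)$ consider the equation $\frac{d\Psi}{dz}=\frac{1}{2\pi i}\Big(\frac{x}{z}+\frac{y}{z-1}\Big)\Psi$ with values in $TH_1$. Let $\Psi_0,\Psi_1$ be the solutions with $\Psi_0(z)=(1+O(z))\,z^{x/2\pi i}$ as $z\to0^+$ and $\Psi_1(z)=(1+O(1-z))\,(1-z)^{y/2\pi i}$ as $z\to1^-$, where the factors $1+O(\cdot)$ are analytic near the respective point and real logarithms are used on $(0,1)$. Then $\Phi_{\rm KZ}(x,y)$ is the group-like element defined by $\Psi_0=\Psi_1\,\Phi_{\rm KZ}(x,y)$; it is a Drinfeld associator. **The corresponding Kashiwara-Vergne solution.** For a Drinfeld associator $\Phi$, $F_\Phi$ is the automorphism of the degree-completed free Lie algebra on $x,y$ given by $$x\mapsto\Phi(x,-x-y)\,x\,\Phi(x,-x-y)^{-1},\qquad y\mapsto e^{-(x+y)/2}\,\Phi(y,-x-y)\,y\,\Phi(y,-x-y)^{-1}\,e^{(x+y)/2}.$$ It is a known theorem (Alekseev-Enriquez-Torossian/Meinrenken) that $F_\Phi$ solves the Kashiwara-Vergne problem; ''the solution corresponding to $\Phi_{\rm KZ}$'' means $F_{\Phi_{\rm KZ}}$. *)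

(* Defs.v *)
From HB Require Import structures.
From mathcomp Require Import all_boot all_order all_algebra all_fingroup.
From mathcomp Require Import finmap generic_quotient ring_quotient lra.
From mathcomp Require Import all_classical all_reals all_analysis.
From mathcomp Require Import complex.

Set Implicit Arguments.
Unset Strict Implicit.
Unset Printing Implicit Defensive.

Import Order.TTheory GRing.Theory Num.Theory.
Import numFieldNormedType.Exports.
Import Quotient.

Local Open Scope complex_scope.
Local Open Scope ring_scope.

(* The degree-completed free associative K-algebra on the alphabet A: a series
   is the family of its coefficients, indexed by words, and the product is
   obtained by cutting words (concatenation of words extended bilinearly). *)
Definition ncseries (K : Type) (A : Type) := seq A -> K.

Section NCSeries.
Variables (K : comNzRingType) (A : finType).
Local Notation S := (ncseries K A).
HB.instance Definition _ := GRing.Lmodule.copy S (seq A -> K^o).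

Definition ncone : S := fun w => (nilp w)%:R.
Definition ncmul (f g : S) : S :=
  fun w => \sum_(i < (size w).+1) f (take i w) * g (drop i w).

Let dl (a : A) (f : S) : S := fun w => f (a :: w).

Let ncmul_nil f g : ncmul f g [::] = f [::] * g [::].
Proof. by rewrite /ncmul big_ord_recl big_ord0 addr0. Qed.

Let ncmul_cons f g a w :
  ncmul f g (a :: w) = f [::] * g (a :: w) + ncmul (dl a f) g w.
Proof. by rewrite /ncmul big_ord_recl. Qed.

Lemma ncmulDl : left_distributive ncmul +%R.
Proof.
move=> f g h; apply/funext => w; rewrite -[RHS]/(ncmul f h w + ncmul g h w).
by rewrite /ncmul -big_split /=; apply: eq_bigr => i _; rewrite -mulrDl.
Qed.

Lemma ncmulDr : right_distributive ncmul +%R.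
Proof.
move=> f g h; apply/funext => w; rewrite -[RHS]/(ncmul f g w + ncmul f h w).
by rewrite /ncmul -big_split /=; apply: eq_bigr => i _; rewrite -mulrDr.
Qed.

Lemma ncscaleAl c f g : c *: ncmul f g = ncmul (c *: f) g.
Proof.
apply/funext => w; rewrite -[LHS]/(c * ncmul f g w) /ncmul mulr_sumr.
by apply: eq_bigr => i _; rewrite mulrA.
Qed.

Lemma ncscaleAr c f g : c *: ncmul f g = ncmul f (c *: g).
Proof.
apply/funext => w; rewrite -[LHS]/(c * ncmul f g w) /ncmul mulr_sumr.
by apply: eq_bigr => i _; rewrite mulrCA.
Qed.

Lemma ncmulA : associative ncmul.
Proof.
move=> f g h; apply/funext => w; elim: w f => [|a w IH] f.
  by rewrite !ncmul_nil mulrA.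
rewrite !ncmul_cons ncmul_nil.
have -> : dl a (ncmul f g) = f [::] *: dl a g + ncmul (dl a f) g.
  by apply/funext => v; rewrite /dl ncmul_cons.
rewrite ncmulDl -ncscaleAl IH mulrDr -addrA mulrA.
by [].
Qed.

Lemma ncmul1s : left_id ncone ncmul.
Proof.
move=> f; apply/funext => w; rewrite /ncmul big_ord_recl take0 drop0 mul1r.
rewrite big1 ?addr0 // => i _; case: w i => [[]//|a w i].
by rewrite mul0r.
Qed.

Lemma ncmuls1 : right_id ncone ncmul.
Proof.
move=> f; apply/funext => w; rewrite /ncmul big_ord_recr /= take_size drop_size.
rewrite mulr1 big1 ?add0r // => i _.
by rewrite /ncone /nilp size_drop subn_eq0 leqNgt ltn_ord mulr0.
Qed.

Lemma ncone_neq0 : ncone != 0.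
Proof. by apply/eqP => /(congr1 (@^~ [::])) /eqP; rewrite oner_eq0. Qed.

HB.instance Definition _ := GRing.Zmodule_isNzRing.Build S
  ncmulA ncmul1s ncmuls1 ncmulDl ncmulDr ncone_neq0.
HB.instance Definition _ := GRing.Lmodule_isLalgebra.Build K S ncscaleAl.
HB.instance Definition _ := GRing.Lalgebra_isAlgebra.Build K S ncscaleAr.

Definition ncunit : pred S := fun f => `[< exists g, g * f = 1 /\ f * g = 1 >].
Definition ncinv (f : S) : S := xget f [set g | g * f = 1 /\ f * g = 1]%classic.

Lemma ncmulVs : {in ncunit, left_inverse 1 ncinv *%R}.
Proof. by move=> f /asboolP h; have := xgetPex f h; case. Qed.
Lemma ncdivss : {in ncunit, right_inverse 1 ncinv *%R}.
Proof. by move=> f /asboolP h; have := xgetPex f h; case. Qed.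
Lemma ncunitP f g : g * f = 1 /\ f * g = 1 -> ncunit f.
Proof. by move=> h; apply/asboolP; exists g. Qed.
Lemma ncinv_out : {in [predC ncunit], ncinv =1 id}.
Proof.
move=> f; rewrite inE => h; apply: xgetPN => g gf.
by move/negP: h; apply; apply/asboolP; exists g.
Qed.
HB.instance Definition _ := GRing.NzRing_hasMulInverse.Build S
  ncmulVs ncdivss ncunitP ncinv_out.

Definition ncvar (a : A) : S := fun w => (w == [:: a])%:R.

End NCSeries.

(* The group algebra K[G]: finitely supported functions with convolution;
   gbase c k is the element c.k of K[G]. *)
Definition galg (K : nmodType) (G : choiceType) := {fsfun G -> K with 0}.

Section GroupAlgebra.
Local Open Scope fset_scope.
Local Open Scope ring_scope.
Variables (K : comNzRingType) (G : groupType).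
Local Notation A := (galg K G).
HB.instance Definition _ := Choice.on A.
Implicit Types (f g h : A) (k l : G).

Definition gbase (c : K) (k : G) : A := [fsfun x in [fset k] => c].
Definition gzero : A := [fsfun].
Definition gopp f : A := [fsfun k in finsupp f => - f k].
Definition gadd f g : A := [fsfun k in finsupp f `|` finsupp g => f k + g k].
Definition gscale c f : A := [fsfun k in finsupp f => c * f k].
Definition gmul f g : A :=
  \big[gadd/gzero]_(k <- finsupp f) \big[gadd/gzero]_(l <- finsupp g)
    gbase (f k * g l) (k * l)%g.

Let goppE f k : gopp f k = - f k.
Proof. by rewrite fsfun_fun; case: finsuppP; rewrite ?oppr0. Qed.
Let gaddE f g k : gadd f g k = f k + g k.
Proof.
by rewrite fsfun_fun in_fsetE; case: (finsuppP f); case: (finsuppP g);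
  rewrite ?addr0.
Qed.
Let gzeroE k : gzero k = 0. Proof. by rewrite fsfun0E. Qed.
Let gscaleE c f k : gscale c f k = c * f k.
Proof. by rewrite fsfun_fun; case: finsuppP; rewrite ?mulr0. Qed.

Lemma gaddA : associative gadd.
Proof. by move=> f g h; apply/fsfunP => k; rewrite !gaddE addrA. Qed.
Lemma gaddC : commutative gadd.
Proof. by move=> f g; apply/fsfunP => k; rewrite !gaddE addrC. Qed.
Lemma gadd0 : left_id gzero gadd.
Proof. by move=> f; apply/fsfunP => k; rewrite gaddE gzeroE add0r. Qed.
Lemma gaddN : left_inverse gzero gopp gadd.
Proof. by move=> f; apply/fsfunP => k; rewrite gaddE goppE gzeroE addNr. Qed.
HB.instance Definition _ := GRing.isZmodule.Build A gaddA gaddC gadd0 gaddN.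

Lemma gscaleA a b f : gscale a (gscale b f) = gscale (a * b) f.
Proof. by apply/fsfunP => k; rewrite !gscaleE mulrA. Qed.
Lemma gscale1 : left_id 1 gscale.
Proof. by move=> f; apply/fsfunP => k; rewrite !gscaleE mul1r. Qed.
Lemma gscaleDr : right_distributive gscale +%R.
Proof. by move=> c f g; apply/fsfunP => k; rewrite !(gscaleE,gaddE) mulrDr. Qed.
Lemma gscaleDl f : {morph gscale^~ f : a b / a + b}.
Proof. by move=> a b; apply/fsfunP => k; rewrite !(gscaleE,gaddE) mulrDl. Qed.
HB.instance Definition _ :=
  GRing.Zmodule_isLmodule.Build K A gscaleA gscale1 gscaleDr gscaleDl.

Lemma galgDE f g k : (f + g) k = f k + g k. Proof. exact: gaddE. Qed.
Lemma galg0E k : (0 : A) k = 0. Proof. exact: gzeroE. Qed.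
Lemma galgZE c f k : (c *: f) k = c * f k. Proof. exact: gscaleE. Qed.
Lemma galg_sumE I (r : seq I) (P : pred I) (F : I -> A) k :
  (\sum_(i <- r | P i) F i) k = \sum_(i <- r | P i) F i k.
Proof.
by apply: (big_morph (fun f : A => f k)) => [f g|]; rewrite ?galgDE ?galg0E.
Qed.

Lemma gbaseE c k l : gbase c k l = if l == k then c else 0.
Proof. by rewrite fsfun_fun in_fset1. Qed.
Lemma gbase0 k : gbase 0 k = 0.
Proof. by apply/fsfunP => l; rewrite gbaseE galg0E if_same. Qed.
Lemma gbaseD a b k : gbase (a + b) k = gbase a k + gbase b k.
Proof.
by apply/fsfunP => l; rewrite galgDE !gbaseE; case: ifP; rewrite ?addr0.
Qed.
Lemma gbaseZ a b k : gbase (a * b) k = a *: gbase b k.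
Proof.
by apply/fsfunP => l; rewrite galgZE !gbaseE; case: ifP; rewrite ?mulr0.
Qed.

Lemma galgEw (d : {fset G}) f : finsupp f `<=` d ->
  f = \sum_(k <- d) gbase (f k) k.
Proof.
move=> fd; apply/fsfunP => l; rewrite galg_sumE.
case: (boolP (l \in d)) => ld.
  rewrite (big_fsetD1 l) //= gbaseE eqxx big1_fset ?addr0 // => k.
  by rewrite in_fsetD1 gbaseE eq_sym => /andP[/negPf ->].
rewrite big1_fset => [|k kd _].
  by apply: fsfun_dflt; apply: contra ld; apply: (fsubsetP fd).
by rewrite gbaseE; case: eqP => // lk; rewrite -lk (negPf ld) in kd.
Qed.

Lemma gmulw (d e : {fset G}) f g : finsupp f `<=` d -> finsupp g `<=` e ->
  gmul f g = \sum_(k <- d) \sum_(l <- e) gbase (f k * g l) (k * l)%g.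
Proof.
move=> fd ge; rewrite /gmul -[LHS]/(\sum_(k <- finsupp f)
  \sum_(l <- finsupp g) gbase (f k * g l) (k * l)%g).
rewrite (big_fset_incl _ fd) /=; last first.
  move=> k _ /fsfun_dflt fk; rewrite big1 // => l _.
  by rewrite fk mul0r gbase0.
apply/eq_bigr => k _; apply/big_fset_incl => // l _ /fsfun_dflt ->.
by rewrite mulr0 gbase0.
Qed.

Lemma finsupp_gbase c k : finsupp (gbase c k) `<=` [fset k].
Proof.
apply/fsubsetP => l; rewrite mem_finsupp gbaseE in_fset1.
by case: ifP => //; rewrite eqxx.
Qed.

Lemma gmulDl : left_distributive gmul +%R.
Proof.
move=> f g h; pose d := finsupp f `|` finsupp g.
rewrite !(@gmulw (d `|` finsupp (f + g)) (finsupp h)) ?fsubset_refl //; try by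
  apply/fsubsetP => x; rewrite /d !in_fsetU => ->; rewrite ?orbT.
rewrite -big_split /=; apply/eq_bigr => k _.
rewrite -big_split /=; apply/eq_bigr => l _.
by rewrite galgDE mulrDl gbaseD.
Qed.

Lemma gmulDr : right_distributive gmul +%R.
Proof.
move=> h f g; pose d := finsupp f `|` finsupp g.
rewrite !(@gmulw (finsupp h) (d `|` finsupp (f + g))) ?fsubset_refl //; try by
  apply/fsubsetP => x; rewrite /d !in_fsetU => ->; rewrite ?orbT.
rewrite -big_split /=; apply/eq_bigr => k _.
rewrite -big_split /=; apply/eq_bigr => l _.
by rewrite galgDE mulrDr gbaseD.
Qed.

Lemma gmulUU a b k l : gmul (gbase a k) (gbase b l) = gbase (a * b) (k * l)%g.
Proof.
by rewrite (gmulw (finsupp_gbase a k) (finsupp_gbase b l)) !big_seq_fset1 !gbaseE !eqxx.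
Qed.

Lemma gmul_suml I (r : seq I) (F : I -> A) g :
  gmul (\sum_(i <- r) F i) g = \sum_(i <- r) gmul (F i) g.
Proof.
apply: (big_morph (gmul^~ g)) => [f h|]; first exact: gmulDl.
by apply: (@addrI _ (gmul 0 g)); rewrite -gmulDl !addr0.
Qed.

Lemma gmul_sumr I (r : seq I) (F : I -> A) g :
  gmul g (\sum_(i <- r) F i) = \sum_(i <- r) gmul g (F i).
Proof.
apply: (big_morph (gmul g)) => [f h|]; first exact: gmulDr.
by apply: (@addrI _ (gmul g 0)); rewrite -gmulDr !addr0.
Qed.

Lemma galgE f : f = \sum_(k <- finsupp f) gbase (f k) k.
Proof. exact/galgEw. Qed.

Lemma gmulA : associative gmul.
Proof.
move=> f g h; rewrite (galgE f) (galgE g) (galgE h).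
rewrite !gmul_suml; apply/eq_bigr => k _.
rewrite gmul_sumr [in RHS](gmul_sumr (finsupp g)) gmul_suml.
apply/eq_bigr => l _.
rewrite !gmul_sumr; apply/eq_bigr => m _.
by rewrite !gmulUU mulrA mulgA.
Qed.

Lemma gmul1 : left_id (gbase 1 1%g) gmul.
Proof.
move=> f; rewrite {1}(galgE f) gmul_sumr [RHS]galgE.
by apply/eq_bigr => k _; rewrite gmulUU mul1r mul1g.
Qed.
Lemma gmulr1 : right_id (gbase 1 1%g) gmul.
Proof.
move=> f; rewrite {1}(galgE f) gmul_suml [RHS]galgE.
by apply/eq_bigr => k _; rewrite gmulUU mulr1 mulg1.
Qed.
Lemma gone_neq0 : gbase 1 1%g != 0.
Proof.
apply/eqP => /(congr1 (fun f : A => f 1%g)) /eqP.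
by rewrite gbaseE eqxx galg0E oner_eq0.
Qed.
HB.instance Definition _ := GRing.Zmodule_isNzRing.Build A
  gmulA gmul1 gmulr1 gmulDl gmulDr gone_neq0.

Lemma gscaleAl c f g : c *: (f * g) = (c *: f) * g.
Proof.
change (c *: gmul f g = gmul (c *: f) g).
rewrite (galgE f) (galgE g).
rewrite gmul_suml !scaler_sumr gmul_suml; apply/eq_bigr => k _.
rewrite !gmul_sumr scaler_sumr; apply/eq_bigr => l _.
by rewrite -gbaseZ !gmulUU -gbaseZ mulrA.
Qed.
HB.instance Definition _ := GRing.Lmodule_isLalgebra.Build K A gscaleAl.
Lemma gscaleAr c f g : c *: (f * g) = f * (c *: g).
Proof.
change (c *: gmul f g = gmul f (c *: g)).
rewrite (galgE f) (galgE g).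
rewrite gmul_suml !scaler_sumr gmul_suml; apply/eq_bigr => k _.
rewrite !gmul_sumr scaler_sumr; apply/eq_bigr => l _.
by rewrite -gbaseZ !gmulUU -gbaseZ mulrCA.
Qed.
HB.instance Definition _ := GRing.Lalgebra_isAlgebra.Build K A gscaleAr.

End GroupAlgebra.

Local Open Scope classical_set_scope.
Local Open Scope quotient_scope.
Local Open Scope ring_scope.

Lemma within_comp (U V W : topologicalType) (A : set U) (B : set V)
    (phi : U -> V) (f : V -> W) :
  {within A, continuous phi} -> (forall x, A x -> B (phi x)) ->
  {within B, continuous f} -> {within A, continuous (f \o phi)}.
Proof.
move=> /subspace_continuousP cphi AB /subspace_continuousP cf.
apply/subspace_continuousP => x Ax.
apply: cvg_comp (cf _ (AB _ Ax)) => P; rewrite /within /= => nP.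
have := cphi x Ax _ nP; rewrite /nbhs /= /within /=.
by apply: filterS => y + Ay; apply => //; exact: AB.
Qed.

Lemma within_comp_cont (U V W : topologicalType) (A : set U) (B : set V)
    (phi : U -> V) (f : V -> W) :
  continuous phi -> (forall x, A x -> B (phi x)) ->
  {within B, continuous f} -> {within A, continuous (f \o phi)}.
Proof. by move=> cphi; apply: within_comp; exact: continuous_subspaceT. Qed.

Lemma continuous_pair (U V W : topologicalType) (f : U -> V) (g : U -> W) :
  continuous f -> continuous g -> continuous (fun u => (f u, g u)).
Proof. by move=> cf cg u; exact: (cvg_pair (cf u) (cg u)). Qed.

Lemma closed_setX (U V : topologicalType) (A : set U) (B : set V) :
  closed A -> closed B -> closed (A `*` B).
Proof.
move=> cA cB; have -> : A `*` B = (@fst U V) @^-1` A `&` (@snd U V) @^-1` B by [].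
apply: closedI; apply: preimage_closed => // x _; [exact: cvg_fst|exact: cvg_snd].
Qed.

Section Loops.
Variables (R : realType) (T : topologicalType) (x : T).
Local Notation I := (`[0%R, 1%R]%classic : set R).

(* Only the restriction of a loop to [0, 1] is meaningful. *)
Record loop := Loop {
  loop_fun :> R -> T;
  loop_cont : {within I, continuous loop_fun};
  loop_start : loop_fun 0 = x;
  loop_end : loop_fun 1 = x }.

HB.instance Definition _ := gen_eqMixin loop.
HB.instance Definition _ := gen_choiceMixin loop.

Definition homotopic (f g : loop) := exists H : R * R -> T,
  [/\ {within I `*` I, continuous H},
      forall t, I t -> H (0, t) = f t,
      forall t, I t -> H (1, t) = g t &
      forall s, I s -> H (s, 0) = x /\ H (s, 1) = x].

Let half : R := 2^-1.

Lemma cat_within (U : topologicalType) (B : set U) (F G : U * R -> T) :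
  closed B ->
  {within B `*` I, continuous F} -> {within B `*` I, continuous G} ->
  (forall u, B u -> F (u, 1) = G (u, 0)) ->
  {within B `*` I, continuous (fun p : U * R =>
    if p.2 <= half then F (p.1, 2 * p.2) else G (p.1, 2 * p.2 - 1))}.
Proof.
move=> cB cF cG FG.
have c1 : closed (B `*` (`[0, half]%classic : set R)).
  by apply: closed_setX => //; exact: interval_closed.
have c2 : closed (B `*` (`[half, 1]%classic : set R)).
  by apply: closed_setX => //; exact: interval_closed.
have -> : B `*` I = (B `*` (`[0, half]%classic : set R)) `|`
    (B `*` (`[half, 1]%classic : set R)).
  apply/seteqP; split => [[u t] [/= Bu]|[u t] [] [/= Bu]];
    rewrite /= !in_itv /= /half.
  - move=> /andP[t0 t1]; case: (leP t (2^-1)) => h; [left|right];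
      split => //=; lra.
  - by move=> h; split => //=; lra.
  - by move=> h; split => //=; lra.
have cm (a b : R) : continuous (fun p : U * R => (p.1, a * p.2 + b) : U * R).
  apply: continuous_pair => p; first exact: cvg_fst.
  by apply: cvgD; [apply: cvgM; [exact: cvg_cst|exact: cvg_snd]|exact: cvg_cst].
apply: withinU_continuous => //.
- apply: (@subspace_eq_continuous _ _ _ (F \o (fun p => (p.1, 2 * p.2 + 0)))).
    move=> [u t]; rewrite inE => -[/= _]; rewrite in_itv /= => /andP[_ h].
    by rewrite /from_subspace /= h addr0.
  apply: within_comp_cont cF => // -[u t] [/= Bu].
  rewrite in_itv /= /half => h; split => //=; rewrite in_itv /=; lra.
- apply: (@subspace_eq_continuous _ _ _ (G \o (fun p => (p.1, 2 * p.2 - 1)))).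
    move=> [u t]; rewrite inE => -[/= Bu]; rewrite in_itv /= => /andP[h1 h2].
    rewrite /from_subspace /=; case: (leP t half) => h //.
    have -> : t = half by apply/eqP; rewrite eq_le h h1.
    by rewrite /half mulfV ?pnatr_eq0 // subrr FG.
  apply: within_comp_cont cG => // -[u t] [/= Bu].
  rewrite in_itv /= /half => h; split => //=; rewrite in_itv /=; lra.
Qed.

Let I0 : I 0. Proof. by rewrite /= in_itv /= lexx ler01. Qed.
Let I1 : I 1. Proof. by rewrite /= in_itv /= lexx ler01. Qed.
Let II : closed I. Proof. exact: interval_closed. Qed.

(* First f, then g. *)
Definition cat_fun (f g : R -> T) (t : R) :=
  if t <= half then f (2 * t) else g (2 * t - 1).

Lemma cat_cont (f g : loop) : {within I, continuous (cat_fun f g)}.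
Proof.
have c (h : loop) : {within setT `*` I, continuous (fun p : R * R => h p.2)}.
  apply: within_comp_cont (@loop_cont h).
    by move=> p; exact: cvg_snd.
  by move=> p [].
have H := cat_within closedT (c f) (c g)
  (fun u _ => etrans (loop_end f) (esym (loop_start g))).
apply: (within_comp_cont (phi := fun t => (0 : R, t))) H => //.
by apply: continuous_pair => t; [exact: cvg_cst|exact: cvg_id].
Qed.

Lemma cat_start (f g : loop) : cat_fun f g 0 = x.
Proof. by rewrite /cat_fun ifT ?mulr0 ?loop_start // /half; lra. Qed.

Lemma cat_end (f g : loop) : cat_fun f g 1 = x.
Proof.
rewrite /cat_fun ifF; last by apply/negP; rewrite /half => h; lra.
have -> : (2 * 1 - 1 : R) = 1 by lra.
exact: loop_end.
Qed.

Definition cat_loop (f g : loop) := 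
  @Loop (cat_fun f g) (@cat_cont f g) (cat_start f g) (cat_end f g).

Definition cst_loop : loop :=
  @Loop (fun=> x) (continuous_subspaceT (fun y => @cvg_cst _ _ _ _ _)) erefl erefl.

Lemma rev_cont (f : loop) : {within I, continuous (fun t => f (1 - t))}.
Proof.
apply: (@within_comp_cont R R T I I (fun t => 1 - t) f); last exact: loop_cont.
  by move=> t; apply: cvgB; [exact: cvg_cst|exact: cvg_id].
by move=> t; rewrite /= !in_itv /= => h; lra.
Qed.

Lemma rev_start (f : loop) : f (1 - 0) = x.
Proof. by rewrite subr0 loop_end. Qed.

Lemma rev_end (f : loop) : f (1 - 1) = x.
Proof. by rewrite subrr loop_start. Qed.

Definition rev_loop (f : loop) : loop :=
  @Loop (fun t => f (1 - t)) (@rev_cont f) (rev_start f) (rev_end f).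

Lemma homotopic_refl f : homotopic f f.
Proof.
exists (fun p => f p.2); split => //; last first.
  by move=> s _; rewrite loop_start loop_end.
apply: within_comp_cont (@loop_cont f); first by move=> p; exact: cvg_snd.
by move=> p [].
Qed.

Lemma homotopic_sym f g : homotopic f g -> homotopic g f.
Proof.
move=> [H [cH Hf Hg He]]; exists (fun p => H (1 - p.1, p.2)); split.
- apply: (within_comp_cont (phi := fun p : R * R => (1 - p.1, p.2))) cH.
    apply: continuous_pair => p; last exact: cvg_snd.
    by apply: cvgB; [exact: cvg_cst|exact: cvg_fst].
  move=> [s t] [/=]; rewrite !in_itv /= => h1 h2.
  by split => /=; lra.
- by move=> t It; rewrite /= subr0 Hg.
- by move=> t It; rewrite /= subrr Hf.
- move=> s; rewrite /= in_itv /= => h.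
  by apply: He; rewrite /= in_itv /=; lra.
Qed.

Let swapII (H : R * R -> T) : {within I `*` I, continuous H} ->
  {within I `*` I, continuous (fun p => H (p.2, p.1))}.
Proof.
apply: (within_comp_cont (phi := fun p : R * R => (p.2, p.1))).
  by apply: continuous_pair => p; [exact: cvg_snd|exact: cvg_fst].
by move=> [s t] [].
Qed.

Lemma homotopic_trans f g h : homotopic f g -> homotopic g h -> homotopic f h.
Proof.
move=> [H [cH Hf Hg He]] [K [cK Kg Kh Ke]].
have c := cat_within II (swapII cH) (swapII cK).
have {}c := swapII (c (fun t It => etrans (Hg t It) (esym (Kg t It)))).
eexists; split; first exact: c.
- by move=> t It; rewrite /= ifT ?mulr0 ?Hf // /half; lra.
- move=> t It /=; rewrite ifF; last by apply/negP; rewrite /half => ?; lra.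
  have -> : (2 * 1 - 1 : R) = 1 by lra.
  by rewrite Kh.
- move=> s; rewrite /= in_itv /= => hs; case: ifPn; rewrite /half => hh.
    by apply: He; rewrite /= in_itv /=; lra.
  by apply: Ke; rewrite /= in_itv /=; move: hh; rewrite -ltNge; lra.
Qed.

Lemma homotopic_cat f f' g g' : homotopic f f' -> homotopic g g' ->
  homotopic (cat_loop f g) (cat_loop f' g').
Proof.
move=> [H [cH Hf Hg He]] [K [cK Kg Kh Ke]].
have c := cat_within II cH cK.
have {}c := c (fun t It => etrans (He t It).2 (esym (Ke t It).1)).
eexists; split; first exact: c.
- move=> t; rewrite /= /cat_fun in_itv /= /half => ht; case: leP => hh.
    by rewrite Hf //= in_itv /=; lra.
  by rewrite Kg //= in_itv /=; lra.
- move=> t; rewrite /= /cat_fun in_itv /= /half => ht; case: leP => hh.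
    by rewrite Hg //= in_itv /=; lra.
  by rewrite Kh //= in_itv /=; lra.
- move=> s Is /=; split.
    by rewrite ifT ?mulr0 ?(He s Is).1 // /half; lra.
  rewrite ifF; last by apply/negP; rewrite /half => ?; lra.
  have -> : (2 * 1 - 1 : R) = 1 by lra.
  by rewrite (Ke s Is).2.
Qed.

Lemma homotopic_rev f f' : homotopic f f' -> homotopic (rev_loop f) (rev_loop f').
Proof.
move=> [H [cH Hf Hg He]]; exists (fun p => H (p.1, 1 - p.2)); split.
- apply: (within_comp_cont (phi := fun p : R * R => (p.1, 1 - p.2))) cH.
    apply: continuous_pair => p; first exact: cvg_fst.
    by apply: cvgB; [exact: cvg_cst|exact: cvg_snd].
  move=> [s t] [/=]; rewrite !in_itv /= => h1 h2.
  by split => /=; lra.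
- by move=> t; rewrite /= in_itv /= => h; rewrite Hf //= in_itv /=; lra.
- by move=> t; rewrite /= in_itv /= => h; rewrite Hg //= in_itv /=; lra.
- by move=> s Is; rewrite /= subr0 subrr; have [] := He s Is.
Qed.

Lemma homotopic_reparam (f g h : loop) (phi psi : R -> R) :
  continuous phi -> continuous psi ->
  (forall t, I t -> I (phi t)) -> (forall t, I t -> I (psi t)) ->
  phi 0 = psi 0 -> phi 1 = psi 1 ->
  (forall t, I t -> g t = f (phi t)) -> (forall t, I t -> h t = f (psi t)) ->
  homotopic g h.
Proof.
move=> cphi cpsi Iphi Ipsi e0 e1 gE hE.
exists (fun p => f ((1 - p.1) * phi p.2 + p.1 * psi p.2)); split.
- apply: (within_comp_cont (phi := fun p : R * R =>
    (1 - p.1) * phi p.2 + p.1 * psi p.2)) (@loop_cont f).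
    move=> p; apply: cvgD; apply: cvgM; try exact: cvg_fst.
    + by apply: cvgB; [exact: cvg_cst|exact: cvg_fst].
    + by apply: (@cvg_comp _ _ _ snd phi); [exact: cvg_snd|exact: cphi].
    + by apply: (@cvg_comp _ _ _ snd psi); [exact: cvg_snd|exact: cpsi].
  move=> [s t] [/= + It]; move: (Iphi t It) (Ipsi t It).
  rewrite /= !in_itv /= => /andP[a b] /andP[c d] /andP[u v]; nra.
- by move=> t It; rewrite /= subr0 mul1r mul0r addr0 gE.
- by move=> t It; rewrite /= subrr mul1r mul0r add0r hE.
- move=> s Is /=; rewrite e0 e1 -!mulrDl subrK !mul1r.
  by rewrite -!hE // loop_start loop_end.
Qed.

Lemma cat_loopA f g h :
  homotopic (cat_loop (cat_loop f g) h) (cat_loop f (cat_loop g h)).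
Proof.
pose phi (t : R) := Num.min (2 * t) (Num.min (t + 4^-1) ((1 + t) / 2)).
apply: (@homotopic_reparam (cat_loop f (cat_loop g h)) _ _ phi id) => //.
- move=> t; apply: continuous_min; last apply: continuous_min.
  + by apply: cvgM; [exact: cvg_cst|exact: cvg_id].
  + by apply: cvgD; [exact: cvg_id|exact: cvg_cst].
  + apply: cvgM; [|exact: cvg_cst].
    by apply: cvgD; [exact: cvg_cst|exact: cvg_id].
- by move=> t; exact: cvg_id.
- move=> t; rewrite /= !in_itv /= /phi => ht.
  by rewrite !le_min !ge_min; apply/andP; split; lra.
- by rewrite /phi mulr0 !min_l //; rewrite ?le_min; lra.
- by rewrite /phi !min_r //; rewrite ?ge_min; lra.
move=> t; rewrite /= in_itv /= /cat_fun /half => ht.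
case: (leP t (2^-1)) => h1; last first.
  have -> : phi t = (1 + t) / 2 by rewrite /phi !min_r //; rewrite ?ge_min; lra.
  rewrite !ifF; try by apply/negP => ?; lra.
  by congr (h _); lra.
case: (leP (2 * t) (2^-1)) => h2.
  have -> : phi t = 2 * t by rewrite /phi min_l // le_min; lra.
  by rewrite ifT.
have -> : phi t = t + 4^-1 by rewrite /phi min_r ?min_l //; rewrite ?ge_min; lra.
rewrite ifF; last by apply/negP => ?; lra.
by rewrite ifT; [congr (g _); lra|lra].
Qed.

Lemma cat_cst_loop f : homotopic (cat_loop cst_loop f) f.
Proof.
pose phi (t : R) := Num.max 0 (2 * t - 1).
apply: (@homotopic_reparam f _ _ phi id) => //.
- move=> t; apply: (@continuous_max R R (cst 0) (fun t => 2 * t - 1)).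
    exact: cvg_cst.
  apply: cvgB; [|exact: cvg_cst].
  by apply: cvgM; [exact: cvg_cst|exact: cvg_id].
- by move=> t; exact: cvg_id.
- move=> t; rewrite /= !in_itv /= /phi => ht.
  by rewrite !le_max !ge_max; apply/andP; split; lra.
- by rewrite /phi max_l //; lra.
- by rewrite /phi max_r; lra.
move=> t; rewrite /= in_itv /= /cat_fun /half => ht.
case: (leP t (2^-1)) => h1.
  by rewrite /phi max_l; [rewrite loop_start|lra].
by rewrite /phi max_r //; lra.
Qed.

Lemma cat_loop_cst f : homotopic (cat_loop f cst_loop) f.
Proof.
pose phi (t : R) := Num.min 1 (2 * t).
apply: (@homotopic_reparam f _ _ phi id) => //.
- move=> t; apply: (@continuous_min R R (cst 1) (fun t => 2 * t)).
    exact: cvg_cst.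
  by apply: cvgM; [exact: cvg_cst|exact: cvg_id].
- by move=> t; exact: cvg_id.
- move=> t; rewrite /= !in_itv /= /phi => ht.
  by rewrite !le_min !ge_min; apply/andP; split; lra.
- by rewrite /phi min_r; lra.
- by rewrite /phi min_l; lra.
move=> t; rewrite /= in_itv /= /cat_fun /half => ht.
case: (leP t (2^-1)) => h1.
  by rewrite /phi min_r //; lra.
by rewrite /phi min_l; [rewrite loop_end|lra].
Qed.

Lemma cat_loop_rev f : homotopic (cat_loop f (rev_loop f)) cst_loop.
Proof.
pose phi (t : R) := Num.min (2 * t) (2 - 2 * t).
apply: (@homotopic_reparam f _ _ phi (cst 0)) => //.
- move=> t; apply: continuous_min.
    by apply: cvgM; [exact: cvg_cst|exact: cvg_id].
  apply: cvgB; [exact: cvg_cst|].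
  by apply: cvgM; [exact: cvg_cst|exact: cvg_id].
- by move=> t; exact: cvg_cst.
- move=> t; rewrite /= !in_itv /= /phi => ht.
  by rewrite !le_min !ge_min; apply/andP; split; lra.
- by rewrite /phi /= min_l; lra.
- by rewrite /phi /= min_r; lra.
- move=> t; rewrite /= in_itv /= /cat_fun /half => ht.
  case: (leP t (2^-1)) => h1.
    by rewrite /phi min_l //; lra.
  by rewrite /phi min_r; [congr (f _); lra|lra].
- by move=> t _; rewrite /= loop_start.
Qed.

Lemma cat_rev_loop f : homotopic (cat_loop (rev_loop f) f) cst_loop.
Proof.
pose phi (t : R) := Num.max (1 - 2 * t) (2 * t - 1).
apply: (@homotopic_reparam f _ _ phi (cst 1)) => //.
- move=> t; apply: (@continuous_max R R (fun t => 1 - 2 * t) (fun t => 2 * t - 1)).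
    apply: cvgB; [exact: cvg_cst|].
    by apply: cvgM; [exact: cvg_cst|exact: cvg_id].
  apply: cvgB; [|exact: cvg_cst].
  by apply: cvgM; [exact: cvg_cst|exact: cvg_id].
- by move=> t; exact: cvg_cst.
- move=> t; rewrite /= !in_itv /= /phi => ht.
  by rewrite !le_max !ge_max; apply/andP; split; lra.
- by rewrite /phi /= max_l; lra.
- by rewrite /phi /= max_r; lra.
- move=> t; rewrite /= in_itv /= /cat_fun /half => ht.
  case: (leP t (2^-1)) => h1.
    by rewrite /phi max_l //; lra.
  by rewrite /phi max_r //; lra.
- by move=> t _; rewrite /= loop_end.
Qed.

Definition homotopicb (f g : loop) : bool := `[< homotopic f g >].

Lemma homotopicb_equiv : equiv_class_of homotopicb.
Proof.
split=> [f|f g|g f h].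
- by apply/asboolP; exact: homotopic_refl.
- by apply/asboolP/asboolP; exact: homotopic_sym.
- by move=> /asboolP fg /asboolP gh; apply/asboolP; exact: homotopic_trans fg gh.
Qed.

Canonical homotopic_equiv := EquivRelPack homotopicb_equiv.
Canonical homotopic_encModRel := defaultEncModRel homotopicb.

Definition pi1 := {eq_quot homotopicb}.
HB.instance Definition _ : EqQuotient loop homotopicb pi1 := EqQuotient.on pi1.
HB.instance Definition _ := Choice.on pi1.

Definition pi1_class (f : loop) : pi1 := \pi_pi1 f.

Lemma pi1_classP f g : pi1_class f = pi1_class g <-> homotopic f g.
Proof. by split=> [/eqmodP/asboolP|h]; last exact/eqmodP/asboolP. Qed.

(* The product f g means first g, then f. *)
Definition pi1_mul (a b : pi1) : pi1 :=
  pi1_class (cat_loop (repr b) (repr a)).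
Definition pi1_inv (a : pi1) : pi1 := pi1_class (rev_loop (repr a)).
Definition pi1_one : pi1 := pi1_class cst_loop.

Let reprh f : homotopic (repr (pi1_class f)) f.
Proof. by apply/pi1_classP; exact: reprK. Qed.

Let pi1_class_repr (a : pi1) : pi1_class (repr a) = a. Proof. exact: reprK. Qed.

Lemma pi1_mulE f g : pi1_mul (pi1_class f) (pi1_class g) = pi1_class (cat_loop g f).
Proof. by apply/pi1_classP; apply: homotopic_cat; exact: reprh. Qed.

Lemma pi1_invE f : pi1_inv (pi1_class f) = pi1_class (rev_loop f).
Proof. by apply/pi1_classP; apply: homotopic_rev; exact: reprh. Qed.

Lemma pi1_mulA : associative pi1_mul.
Proof.
move=> a b c; rewrite -(pi1_class_repr a) -(pi1_class_repr b) -(pi1_class_repr c).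
by rewrite !pi1_mulE; apply/pi1_classP/cat_loopA.
Qed.
Lemma pi1_mul1 : left_id pi1_one pi1_mul.
Proof.
move=> a; rewrite -(pi1_class_repr a) pi1_mulE.
exact/pi1_classP/cat_loop_cst.
Qed.
Lemma pi1_mulr1 : right_id pi1_one pi1_mul.
Proof.
move=> a; rewrite -(pi1_class_repr a) pi1_mulE.
exact/pi1_classP/cat_cst_loop.
Qed.
Lemma pi1_mulV : left_inverse pi1_one pi1_inv pi1_mul.
Proof.
move=> a; rewrite -(pi1_class_repr a) pi1_invE pi1_mulE.
exact/pi1_classP/cat_loop_rev.
Qed.
Lemma pi1_mulrV : right_inverse pi1_one pi1_inv pi1_mul.
Proof.
move=> a; rewrite -(pi1_class_repr a) pi1_invE pi1_mulE.
exact/pi1_classP/cat_rev_loop.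
Qed.

HB.instance Definition _ :=
  isGroup.Build pi1 pi1_mulA pi1_mul1 pi1_mulr1 pi1_mulV pi1_mulrV.

End Loops.

Section SeriesOperations.
Variables (K : fieldType) (A B : finType).

(* For a series f without constant term, (f ^+ n) w = 0 as soon as n > size w,
   so the truncated sum is the coefficient of exp f; ncexp is only used for
   such f. *)
Definition ncexp (f : ncseries K A) : ncseries K A :=
  fun w => \sum_(n < (size w).+1) (n`!%:R)^-1 * (f ^+ n) w.

(* The value at f of the continuous algebra morphism sending each letter a to
   s a. As for ncexp, the truncation is harmless when the series s a have no
   constant term, which is the only case used. *)
Definition ncsubst (s : A -> ncseries K B) (f : ncseries K A) : ncseries K B :=
  fun v => \sum_(n < (size v).+1) \sum_(w : n.-tuple A)
    f w * (\prod_(a <- w) s a) v.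

Lemma ncsubst_var (s : A -> ncseries K B) (a : A) :
  (forall b, s b [::] = 0) -> ncsubst s (ncvar K a) = s a.
Proof.
move=> s0; apply/funext => -[|b v]; rewrite /ncsubst.
  rewrite big_ord_recl big_ord0 addr0 big1 ?s0 // => w _.
  by rewrite (tuple0 w) /= mul0r.
rewrite !big_ord_recl /= big1 => [|w _]; last by rewrite (tuple0 w) mul0r.
rewrite add0r (bigD1 [tuple a]) //= /ncvar eqxx mul1r big_seq1.
rewrite big1 ?addr0 => [|w wa]; last first.
  by rewrite -(inj_eq val_inj) /= in wa; rewrite (negPf wa) mul0r.
rewrite big1 ?addr0 // => i _; rewrite big1 // => w _.
by case: eqP => [wa|]; [have := size_tuple w; rewrite wa|rewrite mul0r].
Qed.

End SeriesOperations.

Section TraceSpace.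
Variables (K : comNzRingType) (A : lalgType K).

(* |A| = A/[A, A], the quotient by the linear span of the commutators. *)
Definition commspan : A -> bool := fun x =>
  `[< exists s : seq (K * (A * A)),
      x = \sum_(t <- s) t.1 *: (t.2.1 * t.2.2 - t.2.2 * t.2.1) >].

Lemma commspan_zmod_closed : zmod_closed commspan.
Proof.
split; first by apply/asboolP; exists [::]; rewrite big_nil.
move=> x y /asboolP[s ->] /asboolP[s' ->]; apply/asboolP.
exists (s ++ [seq (- t.1, t.2) | t <- s']).
by rewrite big_cat big_map -sumrN; congr (_ + _);
  apply: eq_bigr => t _; rewrite scaleNr.
Qed.
HB.instance Definition _ := GRing.isZmodClosed.Build A commspan commspan_zmod_closed.

Definition comm_zmod : zmodClosed A := GRing.ZmodClosed.clone A commspan _.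
Definition trace_space := {quot comm_zmod}.
HB.instance Definition _ := GRing.Zmodule.on trace_space.
HB.instance Definition _ : EqQuotient A (equiv comm_zmod) trace_space :=
  EqQuotient.on trace_space.
End TraceSpace.
Arguments trace_space {K} A.

Section CompletedTraceSpace.
Variables (K : comNzRingType) (L : finType).
Local Notation S := (ncseries K L).

(* For series the span of commutators is replaced by its closure in the
   degree topology: f is a limit of elements of the span when it agrees with
   one of them on all words of length at most n, for every n. *)
Definition ccommspan : S -> bool := fun f =>
  `[< forall n : nat, exists2 g : S, commspan g &
      forall w, (size w <= n)%N -> f w = g w >].

Lemma ccommspan_zmod_closed : zmod_closed ccommspan.
Proof.
split; first by apply/asboolP => n; exists 0 => //; exact: (@rpred0 S (@comm_zmod K S)).
move=> x y /asboolP hx /asboolP hy; apply/asboolP => n.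
have [x' cx ex] := hx n; have [y' cy ey] := hy n.
exists (x' - y'); first exact: (@rpredB S (@comm_zmod K S)).
by move=> w hw; rewrite -[LHS]/(x w - y w) ex // ey.
Qed.
HB.instance Definition _ := GRing.isZmodClosed.Build S ccommspan ccommspan_zmod_closed.

Definition ccomm_zmod : zmodClosed S := GRing.ZmodClosed.clone S ccommspan _.
Definition ctrace_space := {quot ccomm_zmod}.
HB.instance Definition _ := GRing.Zmodule.on ctrace_space.
HB.instance Definition _ : EqQuotient S (equiv ccomm_zmod) ctrace_space :=
  EqQuotient.on ctrace_space.

(* The map |A| -> |ncseries K L| induced by f. The representative is irrelevant
   when f is additive and sends [A, A] into the closed span of commutators; see
   trace_mapE for algebra morphisms. *)
Definition trace_map (A : lalgType K) (f : A -> S) (c : trace_space A) :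
  ctrace_space := \pi_ctrace_space (f (repr c)).

Lemma trace_mapE (A : lalgType K) (f : {lrmorphism A -> S}) (u : A) :
  trace_map f (\pi_(trace_space A) u) = \pi_ctrace_space (f u).
Proof.
apply/eqmodP; rewrite /= /equiv -raddfB.
have : commspan (repr (\pi_(trace_space A) u) - u).
  by have /eqmodP := reprK (\pi_(trace_space A) u).
move=> /asboolP[s ->]; apply/asboolP => n.
exists (f (\sum_(t <- s) t.1 *: (t.2.1 * t.2.2 - t.2.2 * t.2.1))) => //.
apply/asboolP; exists [seq (t.1, (f t.2.1, f t.2.2)) | t <- s].
rewrite raddf_sum big_map; apply: eq_bigr => t _ /=.
by rewrite linearZ /= rmorphB /= !rmorphM.
Qed.
End CompletedTraceSpace.

HB.instance Definition _ (R : realType) := NormedModule.copy R[i] R[i]^o.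

Section Punctured.
Variable R : realType.

(* C \ {0, 1}, with the subspace topology. *)
Definition Sigma : set R[i] := [set z | z != 0 /\ z != 1].

Definition expi (t : R) : R[i] := cos t +i* sin t.

(* The letters x and y are encoded by false and true; puncture gives the point
   encircled by the corresponding generator of the homology. *)
Definition puncture (a : bool) : R := a%:R.

(* Counterclockwise circle centred at the puncture, starting at p. *)
Definition circle (a : bool) (p t : R) : R[i] :=
  (puncture a)%:C + (p - puncture a)%:C * expi (2 * pi * t).

Lemma circleE a p t : circle a p t =
  (puncture a + (p - puncture a) * cos (2 * pi * t)) +i*
  ((p - puncture a) * sin (2 * pi * t)).
Proof. by rewrite /circle /expi; simpc. Qed.

Lemma circle_Sigma a p t : 0 < p < 1 -> Sigma (circle a p t).
Proof.
move=> hp; rewrite circleE; have := cos2Dsin2 (2 * pi * t).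
set c := cos _; set s := sin _ => cs.
by split; apply/eqP => -[]; case: a; rewrite /puncture /= => h1 h2; nra.
Qed.

Lemma real_Sigma (p : R) : 0 < p < 1 -> Sigma p%:C.
Proof.
by move=> hp; split; apply/eqP => -[] h; move: hp; rewrite h ltxx ?andbF.
Qed.

Definition basept (p : R) (hp : 0 < p < 1) : Sigma :=
  SigSub (mem_set (real_Sigma hp)).

Lemma continuous_complex (f g : R -> R) :
  continuous f -> continuous g -> continuous (fun t => f t +i* g t : R[i]).
Proof.
move=> cf cg t; apply/cvgrPdist_lt => -[e e'].
rewrite ltcE /= => /andP[/eqP-> e0].
have e20 : 0 < e / 2 by rewrite divr_gt0.
have := cf t; move=> /cvgrPdist_lt /(_ _ e20) hf.
have := cg t; move=> /cvgrPdist_lt /(_ _ e20) hg.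
near=> u.
have -> : f t +i* g t - (f u +i* g u) =
  (f t - f u)%:C + 'i%C * (g t - g u)%:C by simpc.
have -> : e +i* 0 = (e / 2)%:C + (e / 2)%:C by simpc; rewrite -splitr.
apply: le_lt_trans (ler_normD _ _) _; rewrite normrM !normc_def /=.
rewrite !expr0n expr1n /= !addr0 add0r sqrtr1 mul1r !sqrtr_sqr.
by rewrite ltrD // ltcR; near: u.
Unshelve. all: by end_near.
Qed.

Definition gamma_fun a (p : R) (hp : 0 < p < 1) (t : R) : Sigma :=
  SigSub (mem_set (circle_Sigma a t hp)).

Lemma gamma_cont a (p : R) (hp : 0 < p < 1) : continuous (gamma_fun a hp).
Proof.
apply: continuous_comp_initial.
have -> : set_val \o gamma_fun a hp = circle a p by [].
have -> : circle a p = fun t => (puncture a + (p - puncture a) * cos (2 * pi * t)) +i*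
  ((p - puncture a) * sin (2 * pi * t)) by apply/funext => t; exact: circleE.
have cl : continuous (fun t : R => 2 * pi * t).
  by move=> t; apply: cvgM; [exact: cvg_cst|exact: cvg_id].
apply: continuous_complex => t.
  apply: cvgD; [exact: cvg_cst|apply: cvgM; [exact: cvg_cst|]].
  exact: (continuous_comp (cl t) (@continuous_cos R _)).
apply: cvgM; [exact: cvg_cst|].
exact: (continuous_comp (cl t) (@continuous_sin R _)).
Qed.

Lemma gamma_start a (p : R) (hp : 0 < p < 1) : gamma_fun a hp 0 = basept hp :> Sigma.
Proof.
apply: val_inj; rewrite /= circleE mulr0 cos0 sin0 mulr0 mulr1 addrC subrK //.
Qed.
Lemma gamma_end a (p : R) (hp : 0 < p < 1) : gamma_fun a hp 1 = basept hp.
Proof.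
apply: val_inj; rewrite /= circleE mulr1 mulr_natl cos2pi sin2pi.
by rewrite mulr0 mulr1 addrC subrK.
Qed.

Definition gamma a (p : R) (hp : 0 < p < 1) : loop R (basept hp) :=
  @Loop R Sigma (basept hp) (gamma_fun a hp)
    (continuous_subspaceT (@gamma_cont a p hp)) (gamma_start a hp) (gamma_end a hp).

End Punctured.

Notation TH1 R := (ncseries (complex R) bool).
Notation varx R := (ncvar (complex R) false).
Notation vary R := (ncvar (complex R) true).

Section Holonomy.
Variable R : realType.
Local Notation TH1 := (TH1 R).
Local Notation varx := (varx R).
Local Notation vary := (vary R).

Definition i2pi : R[i] := 0 +i* (2 * pi).

Definition cderiv (z : R -> R[i]) (t : R) : R[i] :=
  derive1 (fun s => complex.Re (z s)) t +i* derive1 (fun s => complex.Im (z s)) t.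

Definition cintegral (z : R -> R[i]) (a b : R) : R[i] :=
  (\int[lebesgue_measure]_(t in `[a, b]) complex.Re (z t)) +i*
  (\int[lebesgue_measure]_(t in `[a, b]) complex.Im (z t)).

(* Coefficient of the word w = (w1, ..., wk) in the iterated integral of A(z)
   over t >= t1 >= ... >= tk >= 0: the first letter goes with the largest
   time t1. *)
Fixpoint iterint (z : R -> R[i]) (w : seq bool) (t : R) : R[i] :=
  if w is a :: w' then
    cintegral (fun s => i2pi^-1 * (cderiv z s / (z s - (puncture R a)%:C)) *
                        iterint z w' s) 0 t
  else 1.

Definition Hol (z : R -> R[i]) : TH1 := fun w => iterint z w 1.

Definition C1 (z : R -> R[i]) : Prop :=
  [/\ forall t, derivable (fun s => complex.Re (z s)) t 1,
      forall t, derivable (fun s => complex.Im (z s)) t 1,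
      continuous (derive1 (fun s => complex.Re (z s))) &
      continuous (derive1 (fun s => complex.Im (z s)))].

Definition piecewise_C1 (z : R -> R[i]) : Prop :=
  exists s : seq R, [/\ path <%R 0 s, last 0 s = 1 &
    forall i, (i < size s)%N -> exists2 g : R -> R[i], C1 g &
      forall t, nth 0 (0 :: s) i <= t <= nth 0 s i -> z t = g t].

Section BasePoint.
Variables (p : R) (hp : 0 < p < 1).
Local Notation pi1S := (pi1 R (basept hp)).

(* W is defined on a homotopy class through a piecewise C^1 representative;
   such a representative exists and Hol does not depend on it, because the
   connection is flat. *)
Definition W_group (c : pi1S) : TH1 := xget 0
  [set h | exists f : loop R (basept hp), [/\ pi1_class f = c, piecewise_C1 (fun t => \val (f t)) &
    h = Hol (fun t => \val (f t))]].

(* Linear extension to the group algebra. *)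
Definition W (u : galg R[i] pi1S) : TH1 :=
  \sum_(c <- finsupp u) u c *: W_group c.
End BasePoint.

Definition has_cderiv (f : R -> R[i]) (t : R) (l : R[i]) : Prop :=
  is_derive t 1 (fun s => complex.Re (f s)) (complex.Re l) /\
  is_derive t 1 (fun s => complex.Im (f s)) (complex.Im l).

Definition KZ_solution (Psi : R -> TH1) : Prop :=
  forall t, 0 < t < 1 -> forall w,
    has_cderiv (fun s => Psi s w) t
      ((i2pi^-1 *: (t%:C^-1 *: varx + (t%:C - 1)^-1 *: vary) * Psi t) w).

(* H u = 1 + O(u) with H analytic near u = 0. *)
Definition analytic_one (H : R -> TH1) : Prop :=
  exists2 r : R, 0 < r & exists2 c : nat -> TH1, c 0%N = 1 &
    forall u, 0 < u < r -> forall w,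
      series (fun n => c n w * u%:C ^+ n) @ \oo --> H u w.

(* Phi_KZ, characterized by Psi0 = Psi1 * Phi_KZ, where z^(x / 2 pi i) is
   exp (log z . x / 2 pi i). *)
Definition KZ_associator (Phi : TH1) : Prop :=
  exists Psi0 Psi1 : R -> TH1,
  [/\ KZ_solution Psi0, KZ_solution Psi1,
      exists2 H, analytic_one H & forall t, 0 < t < 1 ->
        Psi0 t = H t * ncexp (((ln t)%:C / i2pi) *: varx),
      exists2 H, analytic_one H & forall t, 0 < t < 1 ->
        Psi1 t = H (1 - t) * ncexp (((ln (1 - t))%:C / i2pi) *: vary) &
      forall t, 0 < t < 1 -> Psi0 t = Psi1 t * Phi].

Definition subst2 (Phi a b : TH1) : TH1 :=
  ncsubst (fun l : bool => if l then b else a) Phi.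

Definition KV_x (Phi : TH1) : TH1 :=
  let g := subst2 Phi varx (- varx - vary) in g * varx * g^-1.

Definition KV_y (Phi : TH1) : TH1 :=
  let g := subst2 Phi vary (- varx - vary) in
  ncexp (- (2^-1 *: (varx + vary))) * g * vary * g^-1 *
  ncexp (2^-1 *: (varx + vary)).

(* F_Phi, extended from the completed free Lie algebra to the continuous algebra
   endomorphism with the same values on x and y. *)
Definition KV_aut (Phi : TH1) : TH1 -> TH1 :=
  fun a => subst2 a (KV_x Phi) (KV_y Phi).

Lemma ncmul_nil (f g : TH1) : (f * g) [::] = f [::] * g [::].
Proof. by rewrite [LHS]big_ord_recl big_ord0 addr0. Qed.

Lemma KV_autx Phi : KV_aut Phi varx = KV_x Phi.
Proof.
apply: ncsubst_var => -[]; rewrite /KV_x /KV_y !ncmul_nil.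
  by rewrite [vary _]/ncvar /= mulr0 !mul0r.
by rewrite [varx _]/ncvar /= mulr0 !mul0r.
Qed.

Lemma KV_auty Phi : KV_aut Phi vary = KV_y Phi.
Proof.
apply: ncsubst_var => -[]; rewrite /KV_x /KV_y !ncmul_nil.
  by rewrite [vary _]/ncvar /= mulr0 !mul0r.
by rewrite [varx _]/ncvar /= mulr0 !mul0r.
Qed.

End Holonomy.

(* Main.v *)
(* A is flat, so holonomies are governed by fundamental solutions of dY = A Y on two
   star-shaped domains: the complements of the half-lines from 0 and 1 that point away
   from 1/2 + i, respectively from 1/2 - i. The loops gamma_0 and gamma_1 are cut into
   pieces lying in these domains, which expresses their holonomies through the two
   fundamental solutions. The three real intervals compare the fundamental solutions
   with Psi_0 and Psi_1 and with their images under z -> z / (z - 1) and z -> 1 / (1 - z)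
   (which permute 0, 1 and infinity, hence substitute -x - y for one of the letters),
   and small half circles around 0 and 1 and large ones around infinity contribute
   factors e^{x/2}, e^{y/2}, e^{-(x+y)/2} up to inversion. Eliminating yields the
   hexagon relation of one half-plane and one invertible g, with the same g for both
   generators, such that W(gamma) = g^-1 rho_F(gamma) g.
   Homotopy invariance of the holonomy follows from a grid subdivision subordinate to
   five convex open sets, and gamma_0, gamma_1 generate pi_1 because two loops that
   follow the same word of convex sets are homotopic, so that a loop decomposes into
   standard loops crossing from one convex set to the next. Therefore W = g^-1 rho_F g on
   the whole group algebra, and W(u) - rho_F(u) = [g^-1 rho_F(u), g]. *)
Require Import Defs.
From mathcomp Require Import all_boot all_order all_algebra all_fingroup.
From mathcomp Require Import finmap generic_quotient ring_quotient ring lra zify.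
From mathcomp Require Import all_classical all_reals all_analysis.
From mathcomp Require Import measurable_realfun complex.

Set Implicit Arguments.
Unset Strict Implicit.
Unset Printing Implicit Defensive.

Import Order.TTheory GRing.Theory Num.Theory.
Import numFieldNormedType.Exports.
Import Quotient.

Local Open Scope complex_scope.
Local Open Scope classical_set_scope.
Local Open Scope quotient_scope.
Local Open Scope ring_scope.

(** * Calculus of complex-valued functions of a real variable *)

(** The connection is triangular in the word length: the derivative of the coefficient of [a :: w]
    involves only the coefficient of [w]. Existence, uniqueness and error estimates for dY = A Y
    therefore reduce to primitives and to induction on words. The obstacle is that Psi_0 and Psi_1
    have no limits at the ends of (0, 1), because of a divergent factor exp (log e . u / 2 pi i).
    All comparisons are made in the class O(e |ln e|^k), which absorbs multiplication by such
    factors and contains no constant but 0. A half circle around 0, 1 or infinity contributes an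
    exponential of the same residue u, which commutes with the divergent factor, and the latter
    cancels. The lower half-plane is the one that matches F: its half circle around infinity yields
    the factor e^{-(x+y)/2} of F(y) with the right sign. Generation of pi_1 is used twice: it
    extends the comparison from two loops to all classes, and, the generators being smooth, it
    provides the piecewise C^1 representatives on which W is defined. *)

Section Norm1.
Variable R : realType.
Implicit Types (z w : R[i]).

(* A real-valued submultiplicative norm on C; the norm of [R[i]] itself takes
   its values in [R[i]]. *)
Definition l1norm z : R := `|complex.Re z| + `|complex.Im z|.

Lemma l1norm_ge0 z : 0 <= l1norm z.
Proof. by rewrite addr_ge0. Qed.

Lemma l1norm_0 : l1norm 0 = 0.
Proof. by rewrite /l1norm /= normr0 addr0. Qed.

Lemma l1norm_eq0 z : l1norm z = 0 -> z = 0.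
Proof.
case: z => a b /eqP; rewrite /l1norm /= paddr_eq0 // !normr_eq0.
by move=> /andP[/eqP -> /eqP ->].
Qed.

Lemma l1norm_gt0 z : z != 0 -> 0 < l1norm z.
Proof.
move=> z0; rewrite lt_neqAle l1norm_ge0 andbT eq_sym.
by apply: contra z0 => /eqP /l1norm_eq0 ->.
Qed.

Lemma l1normD z w : l1norm (z + w) <= l1norm z + l1norm w.
Proof.
case: z => a b; case: w => c d; rewrite /l1norm /=.
by rewrite addrACA lerD // ler_normD.
Qed.

Lemma l1normN z : l1norm (- z) = l1norm z.
Proof. by case: z => a b; rewrite /l1norm /= !normrN. Qed.

Lemma l1normB z w : l1norm (z - w) = l1norm (w - z).
Proof. by rewrite -l1normN opprB. Qed.

Lemma l1normM z w : l1norm (z * w) <= l1norm z * l1norm w.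
Proof.
case: z => a b; case: w => c d; rewrite /l1norm /=.
apply: le_trans (lerD (ler_normB _ _) (ler_normD _ _)) _.
by rewrite !normrM; lra.
Qed.

Lemma l1normR (a : R) : l1norm a%:C = `|a|.
Proof. by rewrite /l1norm /= normr0 addr0. Qed.

Lemma l1norm_Ml (a : R) z : l1norm (a%:C * z) = `|a| * l1norm z.
Proof.
by case: z => c d; rewrite /l1norm /= !mul0r subr0 addr0 !normrM mulrDr.
Qed.

(** The 2 is the constant in (|a| + |b|)^2 <= 2 (a^2 + b^2). *)
Lemma l1normV z : z != 0 -> l1norm z^-1 <= 2 / l1norm z.
Proof.
move=> z0; have := l1norm_gt0 z0; case: z z0 => a b z0; rewrite /l1norm /=.
have s0 : 0 < a ^+ 2 + b ^+ 2.
  rewrite lt_neqAle addr_ge0 ?sqr_ge0 // andbT eq_sym paddr_eq0 ?sqr_ge0 //.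
  by apply: contra z0; rewrite !sqrf_eq0 => /andP[/eqP -> /eqP ->].
rewrite normrN !normrM normfV (gtr0_norm s0) -mulrDl => n0.
rewrite ler_pdivlMr // mulrAC ler_pdivrMr //.
rewrite -(real_normK (num_real a)) -(real_normK (num_real b)).
by set u := `|a|; set v := `|b|; have := sqr_ge0 (u - v); nra.
Qed.

Lemma Re_le_l1norm z : `|complex.Re z| <= l1norm z.
Proof. by rewrite /l1norm lerDl. Qed.
Lemma Im_le_l1norm z : `|complex.Im z| <= l1norm z.
Proof. by rewrite /l1norm lerDr. Qed.

End Norm1.

Section Cderiv.
Variable R : realType.
Implicit Types (f g : R -> R[i]) (t : R).

Lemma is_deriveP (f : R -> R) t l : is_derive t 1 f l <->
  forall e, 0 < e -> exists2 d, 0 < d &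
    forall h, `|h| < d -> `|f (t + h) - f t - h * l| <= e * `|h|.
Proof.
split=> [[df fl] e e0|H].
  have : (fun h => h^-1 *: ((f \o shift t) (h *: 1) - f t)) @ 0^' --> l.
    by rewrite -fl; exact: df.
  move=> /cvgrPdist_lt /(_ e e0); rewrite near_withinE => /nbhs_norm0P[d /= d0 Hd].
  exists d => // h hd; have [->|h0] := eqVneq h 0.
    by rewrite addr0 mul0r subrr subr0 normr0 mulr0.
  have := Hd h hd h0; rewrite /= [h *: 1]mulr1 -[_ *: _]/(h^-1 * (f (h + t) - f t)) => /ltW.
  rewrite -(ler_pM2r (x := `|h|)) ?normr_gt0 // -normrM.
  by apply: le_trans; rewrite -normrN le_eqVlt; apply/orP; left; apply/eqP; congr `| _ |; rewrite [h + t]addrC; field.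
have C : (fun h => h^-1 *: ((f \o shift t) (h *: 1) - f t)) @ 0^' --> l.
  apply/cvgrPdist_le => e e0; have [d d0 Hd] := H _ e0.
  rewrite near_withinE; apply/(@nbhs_norm0P R R); exists d => //= h hd h0.
  have := Hd h hd; rewrite /= [h *: 1]mulr1 -[_ *: _]/(h^-1 * (f (h + t) - f t)).
  rewrite -[in X in _ -> X](ler_pM2r (x := `|h|)) ?normr_gt0 // -normrM.
  by apply: le_trans; rewrite -normrN le_eqVlt; apply/orP; left; apply/eqP; congr `| _ |; rewrite /= [h + t]addrC; field.
by split; [apply/cvg_ex; exists l|exact: cvg_lim C].
Qed.

(** A division-free form in which the two real derivatives become a single complex estimate; the
    chain rule [sdiff_path] works with it. *)
Lemma has_cderivP f t l : has_cderiv f t l <->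
  forall e, 0 < e -> exists2 d, 0 < d &
    forall h : R, `|h| < d -> l1norm (f (t + h) - f t - h%:C * l) <= e * `|h|.
Proof.
split=> [[/is_deriveP fr /is_deriveP fi] e e0|H].
  have e2 : 0 < e / 2 by rewrite divr_gt0.
  have [d1 d10 h1] := fr _ e2; have [d2 d20 h2] := fi _ e2.
  exists (Num.min d1 d2); first by rewrite lt_min d10.
  move=> h; rewrite lt_min => /andP[/h1 H1 /h2 H2]; rewrite /l1norm.
  move: H1 H2; case: (f (t + h)) => a b; case: (f t) => c d'; case: l {fr fi h1 h2} => l l'.
  by rewrite /= !mul0r subr0 addr0 => H1 H2; lra.
split; apply/is_deriveP => e e0; have [d d0 Hd] := H _ e0; exists d => // h /Hd.
  move=> /(le_trans (Re_le_l1norm _)).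
  case: (f (t + h)) => a b; case: (f t) => c d'; case: l {H Hd} => l l' /=.
  by rewrite !mul0r subr0.
move=> /(le_trans (Im_le_l1norm _)).
case: (f (t + h)) => a b; case: (f t) => c d'; case: l {H Hd} => l l' /=.
by rewrite !mul0r addr0.
Qed.

Lemma has_cderiv_near f g t l d : 0 < d ->
  (forall s, `|s - t| < d -> f s = g s) -> has_cderiv f t l -> has_cderiv g t l.
Proof.
move=> d0 fg /has_cderivP H; apply/has_cderivP => e /H[d' d'0 Hd].
exists (Num.min d d'); first by rewrite lt_min d0.
move=> h; rewrite lt_min => /andP[hd /Hd].
by rewrite !fg ?subrr ?normr0 // addrC addKr.
Qed.

Lemma has_cderiv_cst (c : R[i]) t : has_cderiv (fun=> c) t 0.
Proof. by split; exact: is_derive_cst. Qed.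

Lemma has_cderivD f g t l m : has_cderiv f t l -> has_cderiv g t m ->
  has_cderiv (fun s => f s + g s) t (l + m).
Proof.
move=> [a b] [c d]; split.
  have -> : (fun s => complex.Re (f s + g s)) =
    (fun s => complex.Re (f s)) + (fun s => complex.Re (g s)).
    by apply/funext => s; rewrite raddfD.
  rewrite raddfD; exact: is_deriveD.
have -> : (fun s => complex.Im (f s + g s)) =
    (fun s => complex.Im (f s)) + (fun s => complex.Im (g s)).
    by apply/funext => s; rewrite raddfD.
rewrite raddfD; exact: is_deriveD.
Qed.

Lemma has_cderivM f g t l m : has_cderiv f t l -> has_cderiv g t m ->
  has_cderiv (fun s => f s * g s) t (l * g t + f t * m).
Proof.
have ReD (z w : R[i]) : complex.Re (z + w) = complex.Re z + complex.Re w.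
  by case: z; case: w.
have ImD (z w : R[i]) : complex.Im (z + w) = complex.Im z + complex.Im w.
  by case: z; case: w.
have ReM (z w : R[i]) : complex.Re (z * w) =
    complex.Re z * complex.Re w - complex.Im z * complex.Im w.
  by case: z; case: w.
have ImM (z w : R[i]) : complex.Im (z * w) =
    complex.Re z * complex.Im w + complex.Im z * complex.Re w.
  by case: z; case: w.
move=> [a b] [c d]; split.
  have -> : (fun s => complex.Re (f s * g s)) =
    (fun s => complex.Re (f s)) * (fun s => complex.Re (g s)) -
    (fun s => complex.Im (f s)) * (fun s => complex.Im (g s)).
    by apply/funext => s; rewrite ReM.
  apply: is_derive_eq (is_deriveB (is_deriveM a c) (is_deriveM b d)) _.
  by rewrite ReD !ReM /GRing.scale /=; ring.
have -> : (fun s => complex.Im (f s * g s)) =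
    (fun s => complex.Re (f s)) * (fun s => complex.Im (g s)) +
    (fun s => complex.Im (f s)) * (fun s => complex.Re (g s)).
    by apply/funext => s; rewrite ImM.
apply: is_derive_eq (is_deriveD (is_deriveM a d) (is_deriveM b c)) _.
by rewrite ImD !ImM /GRing.scale /=; ring.
Qed.

Lemma has_cderiv_eq f t l m : has_cderiv f t l -> l = m -> has_cderiv f t m.
Proof. by move=> ? <-. Qed.

Lemma has_cderivMl (c : R[i]) f t l : has_cderiv f t l ->
  has_cderiv (fun s => c * f s) t (c * l).
Proof.
move=> h; apply: has_cderiv_eq (has_cderivM (has_cderiv_cst c t) h) _.
by rewrite mul0r add0r.
Qed.

Lemma has_cderivMr (c : R[i]) f t l : has_cderiv f t l ->
  has_cderiv (fun s => f s * c) t (l * c).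
Proof.
move=> h; apply: has_cderiv_eq (has_cderivM h (has_cderiv_cst c t)) _.
by rewrite mulr0 addr0.
Qed.

Lemma has_cderivN f t l : has_cderiv f t l -> has_cderiv (fun s => - f s) t (- l).
Proof.
move=> /(has_cderivMl (-1)); rewrite mulN1r.
by under [X in has_cderiv X]eq_fun do rewrite mulN1r.
Qed.

Lemma has_cderivB f g t l m : has_cderiv f t l -> has_cderiv g t m ->
  has_cderiv (fun s => f s - g s) t (l - m).
Proof. by move=> hf /has_cderivN; exact: has_cderivD. Qed.

Lemma has_cderiv_sum I (r : seq I) (P : pred I) (F : I -> R -> R[i]) t (l : I -> R[i]) :
  (forall i, P i -> has_cderiv (F i) t (l i)) ->
  has_cderiv (fun s => \sum_(i <- r | P i) F i s) t (\sum_(i <- r | P i) l i).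
Proof.
move=> H; elim: r => [|i r IH].
  by rewrite big_nil; under eq_fun do rewrite big_nil; exact: has_cderiv_cst.
rewrite big_cons; under eq_fun do rewrite big_cons.
by case: ifP => // Pi; apply: has_cderivD IH; exact: H.
Qed.

Lemma has_cderiv_real (phi : R -> R) t (l : R) :
  is_derive t 1 phi l -> has_cderiv (fun s => (phi s)%:C) t l%:C.
Proof. by move=> h; split => //=; exact: is_derive_cst. Qed.

Lemma has_cderiv_id t : has_cderiv (fun s => s%:C) t 1.
Proof. by apply: has_cderiv_real; exact: is_derive_id. Qed.

Lemma has_cderiv_cplx (u v : R -> R) t l m : is_derive t 1 u l -> is_derive t 1 v m ->
  has_cderiv (fun s => u s +i* v s) t (l +i* m).
Proof. by []. Qed.

Definition ccont f t := forall e, 0 < e ->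
  exists2 d, 0 < d & forall s, `|s - t| < d -> l1norm (f s - f t) < e.

Lemma has_cderiv_cont f t l : has_cderiv f t l -> ccont f t.
Proof.
move=> /has_cderivP /(_ 1 ltr01)[d d0 Hd] e e0.
pose M := 2 + l1norm l; have M0 : 0 < M by rewrite ltr_wpDr ?l1norm_ge0.
exists (Num.min d (e / M)); first by rewrite lt_min d0 divr_gt0.
move=> s; rewrite lt_min ltr_pdivlMr // => /andP[/Hd + h2].
have -> : t + (s - t) = s by rewrite addrC subrK.
rewrite mul1r => h1.
apply: le_lt_trans h2; have -> : f s - f t = (f s - f t - (s - t)%:C * l) + (s - t)%:C * l.
  by rewrite subrK.
apply: le_trans (l1normD _ _) _; rewrite l1norm_Ml /M.
have : 0 <= `|s - t| by [].
by move: h1; set u := l1norm _; set v := `| _ |; set w := l1norm _; nra.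
Qed.

Lemma ccontP f t : ccont f t <->
  {for t, continuous (fun s => complex.Re (f s))} /\
  {for t, continuous (fun s => complex.Im (f s))}.
Proof.
split=> [H|[/cvgrPdist_lt H1 /cvgrPdist_lt H2] e e0].
  split; apply/cvgrPdist_lt => e /H[d d0 Hd]; apply/nbhs_ballP; exists d => //= s.
    rewrite /ball /= distrC => /Hd; apply: le_lt_trans; rewrite distrC.
    by rewrite -raddfB Re_le_l1norm.
  rewrite /ball /= distrC => /Hd; apply: le_lt_trans; rewrite distrC.
  by rewrite -raddfB Im_le_l1norm.
have e2 : 0 < e / 2 by rewrite divr_gt0.
have /nbhs_ballP[d1 /= d10 h1] := H1 _ e2; have /nbhs_ballP[d2 /= d20 h2] := H2 _ e2.
exists (Num.min d1 d2); first by rewrite lt_min d10.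
move=> s; rewrite lt_min distrC => /andP[/h1 /= k1 /h2 /= k2].
by rewrite l1normB /l1norm !raddfB [ltRHS]splitr ltrD.
Qed.

Definition ccont_within (a b : R) f := 
  {within `[a, b], continuous (fun s => complex.Re (f s))} /\
  {within `[a, b], continuous (fun s => complex.Im (f s))}.

Lemma ccont_withinW a b f : (forall t, a <= t <= b -> ccont f t) -> ccont_within a b f.
Proof.
by move=> H; split; apply: continuous_in_subspaceT => t; rewrite inE /= in_itv /= =>
  /H /ccontP[].
Qed.

Lemma ccont_withinB a b f g : ccont_within a b f -> ccont_within a b g ->
  ccont_within a b (fun s => f s - g s).
Proof.
move=> [fr fi] [gr gi]; split.
  have -> : (fun s => complex.Re (f s - g s)) =
    (fun s => complex.Re (f s)) - (fun s => complex.Re (g s)).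
    by apply/funext => s; rewrite raddfB.
  by move=> x; apply: continuousB; [exact: fr|exact: gr].
have -> : (fun s => complex.Im (f s - g s)) =
    (fun s => complex.Im (f s)) - (fun s => complex.Im (g s)).
    by apply/funext => s; rewrite raddfB.
by move=> x; apply: continuousB; [exact: fi|exact: gi].
Qed.

Lemma ccont_withinP a b f : ccont_within a b f <->
  forall t, a <= t <= b -> forall e, 0 < e -> exists2 d, 0 < d &
    forall s, a <= s <= b -> `|s - t| < d -> l1norm (f s - f t) < e.
Proof.
split=> [[/subspace_continuousP fr /subspace_continuousP fi] t tab e e0|H].
  have e2 : 0 < e / 2 by rewrite divr_gt0.
  have tI : `[a, b]%classic t by rewrite /= in_itv.
  have /cvgrPdist_lt /(_ _ e2) := fr t tI.
  rewrite near_withinE => /nbhs_ballP[d1 /= d10 h1].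
  have /cvgrPdist_lt /(_ _ e2) := fi t tI.
  rewrite near_withinE => /nbhs_ballP[d2 /= d20 h2].
  exists (Num.min d1 d2); first by rewrite lt_min d10.
  move=> s sab; rewrite lt_min distrC => /andP[k1 k2].
  have sI : `[a, b]%classic s by rewrite /= in_itv.
  rewrite l1normB /l1norm !raddfB [ltRHS]splitr ltrD //; first exact: h1.
  exact: h2.
split; apply/subspace_continuousP => t /=; rewrite in_itv /= => tab;
  apply/cvgrPdist_lt => e e0; have [d d0 Hd] := H t tab e e0;
  rewrite near_withinE; apply/nbhs_ballP; exists d => //= s; rewrite /ball /= distrC => k;
  rewrite in_itv /= => /Hd /(_ k); apply: le_lt_trans; rewrite -raddfB -normrN -raddfN opprB.
  exact: Re_le_l1norm.
exact: Im_le_l1norm.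
Qed.

Lemma ccont_withinN a b f : ccont_within a b f -> ccont_within a b (fun s => - f s).
Proof.
move=> /ccont_withinP H; apply/ccont_withinP => t tab e e0.
have [d d0 Hd] := H t tab e e0; exists d => // s sab st.
by rewrite -opprD l1normN; exact: Hd.
Qed.

Lemma ccont_withinD a b f g : ccont_within a b f -> ccont_within a b g ->
  ccont_within a b (fun s => f s + g s).
Proof.
move=> hf /ccont_withinN hg.
have -> : (fun s => f s + g s) = (fun s => f s - - g s).
  by apply/funext => s; rewrite opprK.
exact: ccont_withinB.
Qed.

Lemma ccont_within_cst a b c : ccont_within a b (fun=> c).
Proof.
by apply/ccont_withinP => t _ e e0; exists 1 => // s _ _; rewrite subrr l1norm_0.
Qed.

Lemma ccont_withinMr a b f c : ccont_within a b f -> ccont_within a b (fun s => f s * c).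
Proof.
move=> /ccont_withinP H; apply/ccont_withinP => t tab e e0.
have M0 : 0 < l1norm c + 1 by rewrite ltr_wpDl ?l1norm_ge0.
have [d d0 Hd] := H t tab _ (divr_gt0 e0 M0); exists d => // s sab st.
rewrite -mulrBl; have := Hd s sab st; rewrite ltr_pdivlMr //.
apply: le_lt_trans; apply: le_trans (l1normM _ _) _.
by rewrite ler_wpM2l ?l1norm_ge0 // lerDl.
Qed.

Lemma ccont_within_sum a b I (r : seq I) (P : pred I) (F : I -> R -> R[i]) :
  (forall i, P i -> ccont_within a b (F i)) ->
  ccont_within a b (fun s => \sum_(i <- r | P i) F i s).
Proof.
move=> H; elim: r => [|i r IH].
  have -> : (fun s => \sum_(i <- [::] | P i) F i s) = fun=> 0.
    by apply/funext => s; rewrite big_nil.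
  exact: ccont_within_cst.
have -> : (fun s => \sum_(j <- i :: r | P j) F j s) = fun s =>
    if P i then F i s + \sum_(j <- r | P j) F j s else \sum_(j <- r | P j) F j s.
  by apply/funext => s; rewrite big_cons.
by case Pi: (P i) => //; apply: ccont_withinD IH; exact: H.
Qed.

(* The factor 2 comes from treating the real and imaginary parts separately. *)
Lemma cmvt f (f' : R -> R[i]) (a b C : R) : a <= b -> ccont_within a b f ->
  (forall t, a < t < b -> has_cderiv f t (f' t) /\ l1norm (f' t) <= C) ->
  l1norm (f b - f a) <= 2 * C * (b - a).
Proof.
rewrite le_eqVlt => /predU1P[-> _ _|ab [cr ci] H].
  by rewrite !subrr l1norm_0 mulr0.
have {}H x : x \in `]a, b[ -> has_cderiv f x (f' x) /\ l1norm (f' x) <= C.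
  by rewrite in_itv /= => /H.
have [c ci' ce] := MVT ab (fun x xi => (H x xi).1.1) cr.
have [d di de] := MVT ab (fun x xi => (H x xi).1.2) ci.
rewrite /l1norm !raddfB /= ce de !normrM (gtr0_norm (x := b - a)) ?subr_gt0 //.
rewrite -mulrDl ler_pM2r ?subr_gt0 // mulr_natl mulr2n.
have [_ h1] := H c ci'; have [_ h2] := H d di.
exact: lerD (le_trans (Re_le_l1norm _) h1) (le_trans (Im_le_l1norm _) h2).
Qed.

Lemma czero_deriv f (a b : R) : a <= b -> ccont_within a b f ->
  (forall t, a < t < b -> has_cderiv f t 0) -> f b = f a.
Proof.
move=> ab cf H; apply/eqP; rewrite -subr_eq0; apply/eqP/l1norm_eq0.
apply/eqP; rewrite eq_le l1norm_ge0 andbT.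
have := cmvt (f' := fun=> 0) (C := 0) ab cf.
rewrite mulr0 mul0r; apply => t /H ?; split=> //.
by rewrite l1norm_0.
Qed.

Lemma ccont_within_sub (a b c d : R) f : a <= c -> d <= b ->
  ccont_within a b f -> ccont_within c d f.
Proof.
move=> ac db; have S : `[c, d] `<=` `[a, b].
  by move=> t /=; rewrite !in_itv /= => h; lra.
by move=> [h1 h2]; split; apply: (continuous_subspaceW S).
Qed.

(** [S] will hold the break points of a piecewise C^1 path. An exceptional point inside the interval
    splits it in two, and continuity glues the equalities there. *)
Lemma czero_deriv_off (S : seq R) f (a b : R) : a <= b -> ccont_within a b f ->
  (forall t, a < t < b -> t \notin S -> has_cderiv f t 0) -> f b = f a.
Proof.
elim: S a b => [|s S IH] a b ab cf H.
  by apply: czero_deriv => // t /H; apply.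
have [/andP[as_ sb]|nsi] := boolP (a < s < b); last first.
  apply: IH => // t ti tS; apply: H => //; rewrite inE negb_or tS andbT.
  by apply: contraNneq nsi => <-.
transitivity (f s).
  apply: IH; first exact: ltW.
    by apply: ccont_within_sub cf => //; exact: ltW.
  move=> t /andP[st tb] tS; apply: H; first by rewrite (lt_trans as_).
  by rewrite inE negb_or tS gt_eqF.
apply: IH; first exact: ltW.
  by apply: ccont_within_sub cf => //; exact: ltW.
move=> t /andP[st tb] tS; apply: H; first by rewrite st (lt_trans tb).
by rewrite inE negb_or tS lt_eqF.
Qed.

End Cderiv.

(** * Noncommutative power series *)

Section SeriesAlgebra.
Variables (K : comNzRingType) (A : finType).
Local Notation S := (ncseries K A).
Implicit Types (f g s : S) (w : seq A).

(** Since A multiplies Y from the left, the first letter is the one on which all recursions on words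
    run. *)
Definition ncshift (a : A) f : S := fun w => f (a :: w).

Lemma ncseriesP f g : (forall w, f w = g w) -> f = g.
Proof. by move=> h; apply/funext. Qed.

Lemma nc1E w : (1 : S) w = (nilp w)%:R. Proof. by []. Qed.
Lemma ncDE f g w : (f + g) w = f w + g w. Proof. by []. Qed.
Lemma ncNE f w : (- f) w = - f w. Proof. by []. Qed.
Lemma ncZE (c : K) f w : (c *: f) w = c * f w. Proof. by []. Qed.
Lemma nc_sumE I (r : seq I) (P : pred I) (F : I -> S) w :
  (\sum_(i <- r | P i) F i) w = \sum_(i <- r | P i) F i w.
Proof. by apply: (big_morph (fun f : S => f w)). Qed.

Lemma ncME f g w :
  (f * g) w = \sum_(i < (size w).+1) f (take i w) * g (drop i w).
Proof. by []. Qed.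

Lemma ncM_nil f g : (f * g) [::] = f [::] * g [::].
Proof. by rewrite ncME big_ord_recl big_ord0 addr0. Qed.

Lemma ncM_cons f g a w :
  (f * g) (a :: w) = f [::] * g (a :: w) + (ncshift a f * g) w.
Proof. by rewrite !ncME big_ord_recl. Qed.

Lemma ncshiftM f g a : ncshift a (f * g) = f [::] *: ncshift a g + ncshift a f * g.
Proof. by apply: ncseriesP => w; rewrite /ncshift ncM_cons. Qed.

(** The connection form evaluated on a tangent vector is a series of this kind, see [KZform]. *)
Definition lform (u : A -> K) : S := fun w => if w is [:: a] then u a else 0.

Lemma lformM_nil u g : (lform u * g) [::] = 0.
Proof. by rewrite ncM_nil mul0r. Qed.

Lemma lformM_cons u g a w : (lform u * g) (a :: w) = u a * g w.
Proof.
rewrite ncM_cons mul0r add0r; have -> : ncshift a (lform u) = u a *: 1.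
  by apply: ncseriesP => -[|b v]; rewrite /ncshift ncZE nc1E ?mulr1 ?mulr0.
by rewrite -scalerAl mul1r.
Qed.

Lemma lform_var a : ncvar K a = lform (fun b => (b == a)%:R).
Proof.
apply: ncseriesP => -[|b [|c w]]; rewrite /ncvar /lform //.
  by rewrite eqseq_cons andbT.
by rewrite eqseq_cons andbF.
Qed.

Lemma lformD u v : lform u + lform v = lform (fun a => u a + v a).
Proof. by apply: ncseriesP => -[|b [|c w]]; rewrite ncDE /= ?addr0. Qed.
Lemma lformN u : - lform u = lform (fun a => - u a).
Proof. by apply: ncseriesP => -[|b [|c w]]; rewrite ncNE /= ?oppr0. Qed.
Lemma lformZ c u : c *: lform u = lform (fun a => c * u a).
Proof. by apply: ncseriesP => -[|b [|d w]]; rewrite ncZE /= ?mulr0. Qed.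

Lemma lformX u n w : (lform u ^+ n) w = (size w == n)%:R * \prod_(a <- w) u a.
Proof.
elim: n w => [|n IH] [|a w].
- by rewrite expr0 nc1E big_nil mulr1.
- by rewrite expr0 nc1E mul0r.
- by rewrite exprS lformM_nil mul0r.
by rewrite exprS lformM_cons IH big_cons eqSS mulrCA.
Qed.

Definition eqlt N f g := forall w, (size w < N)%N -> f w = g w.

Lemma eqltM N f f' g g' : eqlt N f f' -> eqlt N g g' -> eqlt N (f * g) (f' * g').
Proof.
move=> hf hg w wN; rewrite !ncME; apply: eq_bigr => i _; rewrite hf ?hg //.
  by rewrite size_drop (leq_ltn_trans (leq_subr _ _)).
by rewrite size_take; case: ifP => // /ltn_trans; apply.
Qed.

(** A left factor without constant term raises the order of agreement by one; this drives the
    inductions on the degree below. *)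
Lemma eqltMS N (s : S) g g' : s [::] = 0 -> eqlt N g g' -> eqlt N.+1 (s * g) (s * g').
Proof.
move=> s0 hg [|a w] wN; first by rewrite !ncM_nil s0 !mul0r.
by rewrite !ncM_cons s0 !mul0r !add0r; apply: (eqltM (N := N)).
Qed.

Lemma eqltP f g : (forall N, eqlt N f g) -> f = g.
Proof. by move=> h; apply: ncseriesP => w; apply: (h (size w).+1). Qed.

Lemma ncX_small f n w : f [::] = 0 -> (size w < n)%N -> (f ^+ n) w = 0.
Proof.
move=> f0; elim: n w => // n IH [|a w] wn; first by rewrite exprS ncM_nil f0 mul0r.
by rewrite exprS (eqltMS (g' := 0) f0 _ wn) ?mulr0 //.
Qed.

(* The inverse is the geometric series. *)
Lemma ncunit1 f : f [::] = 1 -> f \is a GRing.unit.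
Proof.
move=> f1; pose h := 1 - f; have h0 : h [::] = 0 by rewrite /h ncDE ncNE f1 nc1E subrr.
pose G N := \sum_(n < N) h ^+ n.
pose g : S := fun w => G (size w).+1 w.
have gE N : eqlt N g (G N).
  move=> w wN; rewrite /g /G; elim: N wN => // N IH.
  rewrite ltnS leq_eqVlt => /predU1P[->//|wN]; rewrite [in RHS]big_ord_recr /= ncDE -IH //.
  by rewrite ncX_small // addr0.
have fE : f = 1 - h by rewrite /h opprB addrC subrK.
have GC N : f * G N = 1 - h ^+ N.
  rewrite fE /G; elim: N => [|N IH]; first by rewrite big_ord0 mulr0 expr0 subrr.
  by rewrite big_ord_recr /= mulrDr IH mulrBl mul1r exprS addrA subrK.
have GC' N : G N * f = 1 - h ^+ N.
  rewrite fE /G; elim: N => [|N IH]; first by rewrite big_ord0 mul0r expr0 subrr.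
  by rewrite big_ord_recr /= mulrDl IH mulrBr mulr1 exprSr addrA subrK.
have h1 N : eqlt N (1 - h ^+ N) 1.
  by move=> w wN; rewrite ncDE ncNE ncX_small // subr0.
suff [gf fg] : g * f = 1 /\ f * g = 1 by apply/unitrP; exists g.
by split; apply: eqltP => N w wN; rewrite -[RHS](h1 N w wN);
  [rewrite -GC'|rewrite -GC];
  apply: (eqltM _ _ wN) => // v; exact: gE.
Qed.

End SeriesAlgebra.

(** * Exponentials of series *)

Section SeriesExp.
Variables (K : fieldType) (A : finType).

Local Notation S := (ncseries K A).

Definition ncexp_trunc N (f : S) : S := \sum_(n < N) (n`!%:R)^-1 *: f ^+ n.

Lemma ncexpE N (f : S) w : f [::] = 0 -> (size w < N)%N ->
  ncexp f w = ncexp_trunc N f w.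
Proof.
move=> f0 wN; rewrite /ncexp /ncexp_trunc nc_sumE.
elim: N wN => // N IH; rewrite ltnS leq_eqVlt => /predU1P[->//|wN].
by rewrite [in RHS]big_ord_recr /= -IH // ncZE ncX_small // mulr0 addr0.
Qed.

Lemma ncexp_conj (f g : S) : f [::] = 0 -> g \is a GRing.unit ->
  ncexp (g * f * g^-1) = g * ncexp f * g^-1.
Proof.
move=> f0 gu; apply: eqltP => N w wN.
rewrite (ncexpE (N := N)) ?ncM_nil ?f0 ?mulr0 ?mul0r //.
transitivity ((g * ncexp_trunc N f * g^-1) w).
  congr (_ w); rewrite /ncexp_trunc mulr_sumr mulr_suml; apply: eq_bigr => i _.
  have E : (g * f * g^-1) ^+ i = g * f ^+ i * g^-1.
    elim: (i : nat) => [|n IH]; first by rewrite !expr0 mulr1 mulrV.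
    by rewrite !exprS IH !mulrA mulrVK.
  rewrite -scalerAr -scalerAl E; reflexivity.
apply: (eqltM _ _ wN) => //; apply: eqltM => // v vN.
by rewrite (ncexpE f0 vN).
Qed.

(** The closed form of the exponential of a degree-one series, whose n-th power lives on words of
    length n only. *)
Definition lexp (u : A -> K) : ncseries K A :=
  fun w => ((size w)`!%:R)^-1 * \prod_(a <- w) u a.

Lemma ncexp_lform u : ncexp (lform u) = lexp u.
Proof.
apply: ncseriesP => w; rewrite /ncexp big_ord_recr /= big1 ?add0r => [|i _].
  by rewrite lformX eqxx mul1r.
by rewrite lformX gtn_eqF ?mul0r ?mulr0.
Qed.

(** The product of the weights along a word does not depend on where the word is cut, so the
    convolution is the binomial formula for [s + t]. *)
Lemma lexpD (s t : K) u : [pchar K] =i pred0 ->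
  lexp (fun a => s * u a) * lexp (fun a => t * u a) = lexp (fun a => (s + t) * u a).
Proof.
move=> /pcharf0P K0; have pE (r : K) w : \prod_(a <- w) (r * u a) = r ^+ size w * \prod_(a <- w) u a.
  elim: w => [|a w IH]; first by rewrite !big_nil mulr1.
  by rewrite !big_cons IH exprS !mulrA; congr (_ * _); rewrite mulrAC.
apply: ncseriesP => w; rewrite ncME /lexp pE exprDn mulr_suml mulr_sumr.
(* [exprDn] gives [s] the exponent n - i, whereas [ncME] cuts off a prefix of length i. *)
rewrite (reindex_inj rev_ord_inj) /=; apply: eq_bigr => i _.
have iw : (i <= size w)%N by rewrite -ltnS.
rewrite !pE size_take size_drop subSS.
have -> : (if (size w - i < size w)%N then (size w - i)%N else size w) = (size w - i)%N.
  by case: ltnP => // h; apply/eqP; rewrite eqn_leq h leq_subr.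
rewrite subKn // -[in \prod_(a <- w) u a](cat_take_drop (size w - i) w) big_cat /=.
have F n : (n`!%:R : K) != 0 by rewrite K0 -lt0n fact_gt0.
have <- := bin_fact iw; rewrite !natrM -[_ *+ 'C(_, _)]mulr_natr.
have Cn : ('C(size w, i)%:R : K) != 0 by rewrite K0 -lt0n bin_gt0.
have F1 := F i; have F2 := F (size w - i)%N.
by field; rewrite Cn F1 F2.
Qed.

Lemma lexp0 : lexp (fun=> 0) = 1.
Proof.
apply: ncseriesP => -[|a w]; rewrite /lexp nc1E /=; first by rewrite big_nil fact0 invr1 mulr1.
by rewrite big_cons mul0r mulr0.
Qed.

Lemma eq_lexp u v : u =1 v -> lexp u = lexp v.
Proof. by move=> /funext ->. Qed.

Lemma lexpV u : [pchar K] =i pred0 -> lexp (fun a => - u a) * lexp u = 1.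
Proof.
move=> K0; transitivity (lexp (fun a => -1 * u a) * lexp (fun a => 1 * u a)).
  by congr (_ * _); apply: eq_lexp => a; rewrite ?mulN1r ?mul1r.
rewrite lexpD //; apply: etrans lexp0.
by apply: eq_lexp => a; rewrite addNr mul0r.
Qed.

Lemma lexpVr u : [pchar K] =i pred0 -> lexp u * lexp (fun a => - u a) = 1.
Proof.
move=> K0; rewrite -[RHS](lexpV (fun a => - u a) K0); congr (_ * _).
by apply: eq_lexp => a; rewrite opprK.
Qed.

Lemma lexp_nil u : lexp u [::] = 1.
Proof. by rewrite /lexp big_nil fact0 invr1 mulr1. Qed.

End SeriesExp.

(** * Substitution as an algebra morphism *)

Section SeriesSubst.
Variables (K : fieldType) (A B : finType).
Variable s : A -> ncseries K B.
Implicit Types f g : ncseries K A.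
Hypothesis s0 : forall a, s a [::] = 0.

(** The part of the substitution that comes from words of length m. It vanishes below degree m, as
    the [s a] have no constant term, so the truncation in [ncsubst] may be replaced by any larger
    one. *)
Let P m (f : ncseries K A) : ncseries K B :=
  \sum_(w : m.-tuple A) f w *: \prod_(a <- w) s a.

Let prod_small (w : seq A) v : (size v < size w)%N -> (\prod_(a <- w) s a) v = 0.
Proof.
elim: w v => // a w IH [|b v] vw; rewrite big_cons.
  by rewrite ncM_nil s0 mul0r.
by rewrite (eqltMS (g' := 0) (s0 a) _ vw) ?mulr0.
Qed.

Let ncsubstE N f v : (size v < N)%N -> ncsubst s f v = (\sum_(m < N) P m f) v.
Proof.
move=> vN; rewrite nc_sumE; transitivity (\sum_(m < (size v).+1) P m f v).
  by apply: eq_bigr => m _; rewrite /P nc_sumE.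
elim: N vN => // N IH; rewrite ltnS leq_eqVlt => /predU1P[->//|vN].
rewrite [RHS]big_ord_recr /= -IH //.
suff -> : P N f v = 0 by rewrite addr0.
rewrite /P nc_sumE big1 // => w _; rewrite ncZE prod_small ?mulr0 //.
by rewrite size_tuple.
Qed.

Let P0 f : P 0 f = f [::] *: 1.
Proof.
rewrite /P (bigD1 [tuple]) //= big_nil big1 ?addr0 // => w.
by rewrite [w]tuple0 => /eqP; case.
Qed.

Let PS m f : P m.+1 f = \sum_a s a * P m (ncshift a f).
Proof.
rewrite /P (reindex (fun p : A * m.-tuple A => [tuple of p.1 :: p.2])) /=.
  rewrite -(pair_bigA _ (fun a (w : m.-tuple A) =>
    f (a :: w) *: \prod_(b <- a :: w) s b)) /=.
  apply: eq_bigr => a _; rewrite mulr_sumr; apply: eq_bigr => w _.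
  by rewrite big_cons -scalerAr.
exists (fun t : m.+1.-tuple A => (thead t, [tuple of behead t])) => [[a w] _|t _] /=.
  by congr (_, _); apply: val_inj.
by rewrite [RHS]tuple_eta; apply: val_inj.
Qed.

(** Words are split by their first letter; unlike the definition by lengths, this form is compatible
    with products, through [ncshiftM]. *)
Lemma ncsubst_rec f :
  ncsubst s f = f [::] *: 1 + \sum_a s a * ncsubst s (ncshift a f).
Proof.
apply: eqltP => -[//|N] v vN; rewrite (ncsubstE _ vN) big_ord_recl P0.
rewrite !ncDE; congr (_ + _).
have -> : \sum_(i < N) P (lift ord0 i) f = \sum_a s a * \sum_(i < N) P i (ncshift a f).
  under eq_bigr => i _ do rewrite PS.
  rewrite exchange_big /=.
  by apply: eq_bigr => a _; rewrite mulr_sumr.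
rewrite !nc_sumE; apply: eq_bigr => a _; apply: (eqltMS (s0 a) _ vN) => u uN.
by rewrite (ncsubstE _ uN).
Qed.

Lemma ncsubst_linear : linear (ncsubst s).
Proof.
move=> c f g; apply: ncseriesP => v; rewrite ncDE ncZE /ncsubst mulr_sumr -big_split /=.
apply: eq_bigr => n _; rewrite mulr_sumr -big_split /=; apply: eq_bigr => w _.
by rewrite ncDE ncZE mulrDl mulrA.
Qed.

Lemma ncsubstD f g : ncsubst s (f + g) = ncsubst s f + ncsubst s g.
Proof. by have := ncsubst_linear 1 f g; rewrite !scale1r. Qed.

Lemma ncsubst0 : ncsubst s 0 = 0.
Proof. by apply: (addIr (ncsubst s 0)); rewrite -ncsubstD !add0r. Qed.

Lemma ncsubstZ c f : ncsubst s (c *: f) = c *: ncsubst s f.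
Proof. by have := ncsubst_linear c f 0; rewrite !addr0 ncsubst0 addr0. Qed.

Lemma ncsubst_nil f : ncsubst s f [::] = f [::].
Proof.
rewrite ncsubst_rec ncDE ncZE nc1E mulr1 nc_sumE big1 ?addr0 // => a _.
by rewrite ncM_nil s0 mul0r.
Qed.

Lemma ncsubst1 : ncsubst s 1 = 1.
Proof.
rewrite ncsubst_rec nc1E scale1r big1 ?addr0 // => a _.
have -> : ncshift a (1 : ncseries K A) = 0 by [].
by rewrite ncsubst0 mulr0.
Qed.

(** Induction on the degree of agreement: after both sides are unfolded along a first letter, each
    remaining product carries a factor [s a] and gains a degree by [eqltMS]. *)
Lemma ncsubstM f g : ncsubst s (f * g) = ncsubst s f * ncsubst s g.
Proof.
apply: eqltP => N; elim: N f g => // N IH f g v vN.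
rewrite [ncsubst s (f * g)]ncsubst_rec [ncsubst s f]ncsubst_rec ncM_nil mulrDl.
rewrite -scalerAl mul1r {1}[ncsubst s g]ncsubst_rec scalerDr scalerA.
rewrite scaler_sumr mulr_suml -!addrA !ncDE; congr (_ + _).
rewrite !nc_sumE -big_split /=; apply: eq_bigr => a _.
rewrite ncshiftM ncsubstD ncsubstZ mulrDr -scalerAr ncDE; congr (_ + _).
by rewrite -mulrA; apply: (eqltMS (s0 a) _ vN); exact: IH.
Qed.

Lemma ncsubst_eqlt N f g : eqlt N f g -> eqlt N (ncsubst s f) (ncsubst s g).
Proof.
move=> fg v vN; apply: eq_bigr => n _; apply: eq_bigr => w _; rewrite fg //.
by rewrite size_tuple; apply: leq_ltn_trans vN; rewrite -ltnS.
Qed.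

Lemma ncsubst_exp f : f [::] = 0 -> ncsubst s (ncexp f) = ncexp (ncsubst s f).
Proof.
move=> f0; apply: eqltP => N v vN.
rewrite (ncexpE (N := N)) ?ncsubst_nil //.
rewrite (ncsubst_eqlt (g := ncexp_trunc N f) _ vN); last by move=> w wN; exact: ncexpE.
congr (_ v); rewrite /ncexp_trunc (big_morph _ ncsubstD ncsubst0); apply: eq_bigr => i _.
have E : ncsubst s (f ^+ i) = ncsubst s f ^+ i.
  elim: (i : nat) => [|n IH]; first by rewrite !expr0 ncsubst1.
  by rewrite !exprS ncsubstM IH.
rewrite ncsubstZ E; reflexivity.
Qed.

End SeriesSubst.

(** * Strict complex differentiability and primitives *)

Section StrictDerivative.
Variable R : realType.
Implicit Types (f g : R[i] -> R[i]) (z c : R[i]).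

Lemma l1normD_le (u v : R[i]) (a b : R) :
  l1norm u <= a -> l1norm v <= b -> l1norm (u + v) <= a + b.
Proof. by move=> ua vb; apply: le_trans (l1normD _ _) (lerD ua vb). Qed.

Lemma l1normM_le (u v : R[i]) (a b : R) :
  l1norm u <= a -> l1norm v <= b -> l1norm (u * v) <= a * b.
Proof.
by move=> ua vb; apply: le_trans (l1normM _ _) _; apply: ler_pM; rewrite ?l1norm_ge0.
Qed.

(* Strict complex differentiability: unlike pointwise differentiability it is
   stable under integration along segments, and it forces the derivative to be
   continuous. *)
Definition sdiff f (l z : R[i]) := forall e, 0 < e -> exists2 d, 0 < d &
  forall z1 z2, l1norm (z1 - z) < d -> l1norm (z2 - z) < d ->
    l1norm (f z1 - f z2 - l * (z1 - z2)) <= e * l1norm (z1 - z2).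

Lemma sdiff_eq f l m z : sdiff f l z -> l = m -> sdiff f m z.
Proof. by move=> ? <-. Qed.

Lemma sdiff_cst c z : sdiff (fun=> c) 0 z.
Proof.
move=> e e0; exists 1 => // z1 z2 _ _.
by rewrite subrr mul0r subr0 l1norm_0 mulr_ge0 ?l1norm_ge0 // ltW.
Qed.

Lemma sdiff_lip f l z : sdiff f l z -> exists2 d, 0 < d & forall z1 z2,
  l1norm (z1 - z) < d -> l1norm (z2 - z) < d ->
  l1norm (f z1 - f z2) <= (l1norm l + 1) * l1norm (z1 - z2).
Proof.
move=> /(_ 1 ltr01)[d d0 H]; exists d => // z1 z2 h1 h2.
have -> : f z1 - f z2 = l * (z1 - z2) + (f z1 - f z2 - l * (z1 - z2)) by ring.
rewrite mulrDl; apply: le_trans (l1normD _ _) _.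
by apply: lerD; [exact: l1normM|exact: H].
Qed.

Lemma sdiff_cont f l z : sdiff f l z -> forall e, 0 < e -> exists2 d, 0 < d &
  forall z1, l1norm (z1 - z) < d -> l1norm (f z1 - f z) < e.
Proof.
move=> /sdiff_lip[d d0 H] e e0.
have M0 : 0 < l1norm l + 1 by rewrite ltr_wpDl ?l1norm_ge0.
exists (Num.min d (e / (l1norm l + 1))); first by rewrite lt_min d0 divr_gt0.
move=> z1; rewrite lt_min ltr_pdivlMr // mulrC => /andP[h1].
by apply: le_lt_trans; apply: H => //; rewrite subrr l1norm_0.
Qed.

Lemma sdiffM f g l m z : sdiff f l z -> sdiff g m z ->
  sdiff (fun z => f z * g z) (l * g z + f z * m) z.
Proof.
move=> hf hg e e0.
have [d1 d10 H1] := sdiff_lip hf.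
(* Up to e' |z1 - z2| the four error terms below have the coefficients |g z|, |l| + 1, |m| + 1 and
   |f z|, whose sum is at most [C]. *)
pose C := l1norm l + l1norm m + l1norm (f z) + l1norm (g z) + 4.
have [? ? ? ?] : [/\ 0 <= l1norm l, 0 <= l1norm m, 0 <= l1norm (f z) & 0 <= l1norm (g z)].
  by rewrite !l1norm_ge0.
have C0 : 0 < C by rewrite /C; lra.
pose e' := Num.min 1 (e / C).
have e'0 : 0 < e' by rewrite lt_min ltr01 divr_gt0.
have e'1 : e' <= 1 by rewrite ge_min lexx.
have e'C : e' * C <= e by rewrite -ler_pdivlMr // ge_min lexx orbT.
have [d2 d20 H2] := hf _ e'0; have [d3 d30 H3] := hg _ e'0.
have [d4 d40 H4] := sdiff_cont hf e'0; have [d5 d50 H5] := sdiff_cont hg e'0.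
exists (Num.min d1 (Num.min d2 (Num.min d3 (Num.min d4 d5)))).
  by rewrite !lt_min d10 d20 d30 d40.
move=> z1 z2; rewrite !lt_min => /and5P[a1 a2 a3 a4 a5] /and5P[b1 b2 b3 b4 b5].
have -> : f z1 * g z1 - f z2 * g z2 - (l * g z + f z * m) * (z1 - z2) =
  (f z1 - f z2 - l * (z1 - z2)) * g z + (f z1 - f z2) * (g z1 - g z) +
  (f z2 - f z) * (g z1 - g z2) + f z * (g z1 - g z2 - m * (z1 - z2)).
  by ring.
have {}H1 := H1 _ _ a1 b1; have {}H2 := H2 _ _ a2 b2; have {}H3 := H3 _ _ a3 b3.
have k1 := H5 _ a5; have k2 := H4 _ b4.
set n := l1norm (z1 - z2) in H1 H2 H3 *.
have n0 : 0 <= n by rewrite l1norm_ge0.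
have Hg : l1norm (g z1 - g z2) <= (l1norm m + 1) * n.
  have -> : g z1 - g z2 = m * (z1 - z2) + (g z1 - g z2 - m * (z1 - z2)) by ring.
  rewrite mulrDl; apply: le_trans (l1normD _ _) _; apply: lerD; first exact: l1normM.
  by apply: le_trans H3 _; rewrite ler_wpM2r.
apply: le_trans (_ : e' * n * l1norm (g z) + (l1norm l + 1) * n * e' +
    e' * ((l1norm m + 1) * n) + l1norm (f z) * (e' * n) <= _).
  by apply: l1normD_le; [apply: l1normD_le; [apply: l1normD_le|]|];
    apply: l1normM_le; rewrite // ltW.
apply: le_trans (_ : (e' * C) * n <= _); last by rewrite ler_wpM2r.
by rewrite /C; have := mulr_ge0 (ltW e'0) n0; nra.
Qed.

Lemma sdiff_inv c z : z != c -> sdiff (fun z => (z - c)^-1) (- (z - c)^-2) z.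
Proof.
move=> zc e e0; have z0 : z - c != 0 by rewrite subr_eq0.
pose n := l1norm (z - c); have n0 : 0 < n by exact: l1norm_gt0.
(* The first bound keeps both points at distance more than n / 2 from [c], so that the inverses are
   at most 4 / n. The error is then at most 128 d / n^3, which the second bound makes at most
   [e]. *)
pose d := Num.min (n / 2) (e * n ^+ 3 / 200).
exists d; first by rewrite lt_min !divr_gt0 ?mulr_gt0 ?exprn_gt0.
move=> z1 z2 h1 h2.
have aux w : l1norm (w - z) < d -> w - c != 0 /\ l1norm (w - c)^-1 <= 4 / n.
  rewrite lt_min => /andP[h _].
  have h' : n / 2 < l1norm (w - c).
    have := l1normD (z - w) (w - c); rewrite addrA subrK -/n l1normB; lra.
  have w0 : w - c != 0.
    by apply: contraTneq h' => ->; rewrite l1norm_0 -leNgt divr_ge0 // ltW.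
  split=> //; apply: le_trans (l1normV w0) _.
  rewrite ler_pdivrMr ?(le_lt_trans _ h') ?divr_ge0 ?(ltW n0) //.
  rewrite mulrAC ler_pdivlMr //; lra.
have [w1 k1] := aux _ h1; have [w2 k2] := aux _ h2.
have k0 : l1norm (z - c)^-1 <= 4 / n.
  by have [] := aux z _; rewrite // subrr l1norm_0 (le_lt_trans (l1norm_ge0 _) h1).
have -> : (z1 - c)^-1 - (z2 - c)^-1 - (- (z - c)^-2) * (z1 - z2) =
  (z1 - z2) * ((z - c)^-1 * ((z1 - c)^-1 * (((z1 - z) * (z - c)^-1) +
    (z2 - z) * (z2 - c)^-1))).
  by field; rewrite z0 w1 w2.
apply: le_trans (l1normM _ _) _; rewrite mulrC ler_wpM2r ?l1norm_ge0 //.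
have n4 : 0 <= 4 / n by rewrite divr_ge0 // ltW.
have d0 : 0 <= d by rewrite ltW // (le_lt_trans (l1norm_ge0 _) h1).
apply: le_trans (_ : (4 / n) * ((4 / n) * (d * (4 / n) + d * (4 / n))) <= _).
  apply: l1normM_le => //; apply: l1normM_le => //.
  by apply: l1normD_le; apply: l1normM_le => //; apply: ltW.
have -> : 4 / n * (4 / n * (d * (4 / n) + d * (4 / n))) = d * (128 / n ^+ 3).
  by field; rewrite gt_eqF.
rewrite mulrA ler_pdivrMr ?exprn_gt0 //.
have : d <= e * n ^+ 3 / 200 by rewrite ge_min lexx orbT.
have : 0 <= e * n ^+ 3 by rewrite mulr_ge0 ?exprn_ge0 // ltW.
by move: (e * n ^+ 3) => q; lra.
Qed.

Lemma sdiff_path f (y : R -> R[i]) t l m : sdiff f m (y t) -> has_cderiv y t l ->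
  has_cderiv (fun s => f (y s)) t (m * l).
Proof.
move=> hf hy; apply/has_cderivP => e e0.
have hc := has_cderiv_cont hy; move: hy => /has_cderivP hy.
pose C := l1norm l + l1norm m + 2.
have [? ?] : 0 <= l1norm l /\ 0 <= l1norm m by rewrite !l1norm_ge0.
have C0 : 0 < C by rewrite /C; lra.
pose e' := Num.min 1 (e / C).
have e'0 : 0 < e' by rewrite lt_min ltr01 divr_gt0.
have e'1 : e' <= 1 by rewrite ge_min lexx.
have e'C : e' * C <= e by rewrite -ler_pdivlMr // ge_min lexx orbT.
have [d1 d10 H1] := hf _ e'0; have [d2 d20 H2] := hy _ e'0; have [d3 d30 H3] := hc _ d10.
exists (Num.min d2 d3); first by rewrite lt_min d20.
move=> h; rewrite lt_min => /andP[/H2 k2 h3].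
have k1 : l1norm (y (t + h) - y t) < d1 by apply: H3; rewrite addrC addKr.
have := H1 _ (y t) k1; rewrite subrr l1norm_0 => /(_ d10) k.
have -> : f (y (t + h)) - f (y t) - h%:C * (m * l) =
  (f (y (t + h)) - f (y t) - m * (y (t + h) - y t)) +
  m * (y (t + h) - y t - h%:C * l) by ring.
have n0 : 0 <= `|h| by [].
have k3 : l1norm (y (t + h) - y t) <= (1 + l1norm l) * `|h|.
  have -> : y (t + h) - y t = (y (t + h) - y t - h%:C * l) + h%:C * l by ring.
  rewrite mulrDl; apply: le_trans (l1normD _ _) _; apply: lerD; last by rewrite l1norm_Ml mulrC.
  by apply: le_trans k2 _; rewrite ler_wpM2r.
apply: le_trans (l1normD _ _) _.
apply: le_trans (_ : e' * ((1 + l1norm l) * `|h|) + l1norm m * (e' * `|h|) <= _).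
  apply: lerD; first by apply: le_trans k _; rewrite ler_pM2l.
  by apply: le_trans (l1normM _ _) _; rewrite ler_wpM2l.
apply: le_trans (_ : (e' * C) * `|h| <= _); last by rewrite ler_wpM2r.
by rewrite /C; have := mulr_ge0 (ltW e'0) n0; nra.
Qed.

(* A Lebesgue-number argument on the unit interval. *)
Lemma unif_segment (P : R -> R -> Prop) :
  (forall r, 0 <= r <= 1 -> exists2 d, 0 < d & forall r' d', `|r' - r| < d ->
     0 < d' < d -> P d' r') ->
  exists2 d, 0 < d & forall r, 0 <= r <= 1 -> P d r.
Proof.
move=> H; have /compact_near_coveringP K := @segment_compact R 0 1.
have : \forall d \near (0 : R)^'+, `[0, 1]%classic `<=` P d.
  apply: K => r /=; rewrite in_itv /= => /H[d d0 Hd].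
  exists (ball r d, [set x : R | 0 < x < d]); last first.
    by move=> [r' d'] [/= hr' hd']; apply: Hd => //; rewrite distrC.
  split; first exact: nbhsx_ballx.
  by near=> x; apply/andP; split; near: x; [exact: nbhs_right_gt|exact: nbhs_right_lt].
move=> [e /= e0 He]; exists (e / 2); first by rewrite divr_gt0.
move=> r hr; apply: He => /=; rewrite ?divr_gt0 ?in_itv //=.
by rewrite /ball /= sub0r normrN gtr0_norm ?divr_gt0 // ltr_pdivrMr // ltr_pMr // ltr1n.
Unshelve. all: by end_near.
Qed.

Section Star.
Variables (D : set R[i]) (c : R[i]).
Hypothesis starD : forall z (r : R), D z -> 0 <= r <= 1 -> D (c + r%:C * (z - c)).
Hypothesis openD : forall z, D z -> exists2 d, 0 < d & forall w, l1norm (w - z) < d -> D w.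

(** A short secant starting at [w] is approximated by strict differentiability at [z] and also at
    [w]; comparing the two bounds f' w - f' z. *)
Lemma sdiff_deriv_cont f f' z : (forall w, D w -> sdiff f (f' w) w) -> D z ->
  forall e, 0 < e -> exists2 d, 0 < d &
    forall w, l1norm (w - z) < d -> l1norm (f' w - f' z) <= e.
Proof.
move=> hf Dz e e0; have [d1 d10 H1] := openD Dz.
have e2 : 0 < e / 2 by rewrite divr_gt0.
have [d2 d20 H2] := hf z Dz _ e2.
exists (Num.min d1 (d2 / 2)); first by rewrite lt_min d10 divr_gt0.
move=> w; rewrite lt_min => /andP[w1 w2].
have [d3 d30 H3] := hf w (H1 _ w1) _ e2.
pose h := Num.min (d2 / 2) d3 / 2.
have h0 : 0 < h by rewrite divr_gt0 // lt_min d30 divr_gt0.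
have [h2 h3] : h < d2 / 2 /\ h < d3.
  have : 2 * h <= d2 / 2 /\ 2 * h <= d3.
    by rewrite /h mulrC divfK ?pnatr_eq0 // !ge_min !lexx orbT.
  lra.
have hn : l1norm h%:C = h by rewrite l1normR gtr0_norm.
have ww : w + h%:C - w = h%:C by rewrite addrC addKr.
have k3 := H3 (w + h%:C) w; rewrite ww subrr l1norm_0 hn in k3.
have k2 := H2 (w + h%:C) w; rewrite ww hn in k2.
have {}k2 : l1norm (f (w + h%:C) - f w - f' z * h%:C) <= e / 2 * h.
  apply: k2; last by apply: lt_trans w2 _; rewrite ltr_pdivrMr // ltr_pMr // ltr1n.
  rewrite addrAC [ltRHS](splitr d2).
  by apply: le_lt_trans (l1normD _ _) _; rewrite hn ltrD.
rewrite -(ler_pM2r h0) -[X in _ * X <= _](gtr0_norm h0) mulrC -l1norm_Ml.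
have -> : h%:C * (f' w - f' z) = (f (w + h%:C) - f w - f' z * h%:C) -
   (f (w + h%:C) - f w - f' w * h%:C) by ring.
apply: le_trans (l1normD _ _) _; rewrite l1normN (splitr e) mulrDl.
by apply: lerD => //; exact: k3.
Qed.

(** The integral of [f] over the segment from [c] to [z], encoded as the increment of an
    antiderivative so that the mean value inequality can estimate it. *)
Definition is_prim f z (v : R[i]) := exists G : R -> R[i],
  [/\ ccont_within 0 1 G, forall r, 0 < r < 1 ->
     has_cderiv G r (f (c + r%:C * (z - c)) * (z - c)) & v = G 1 - G 0].

Definition prim f z : R[i] := xget 0 [set v | is_prim f z v].

Lemma antideriv (g : R -> R[i]) : (forall t, ccont g t) -> exists G,
  forall t : R, 0 <= t <= 1 -> has_cderiv G t (g t).
Proof.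
move=> cg; have real (u : R -> R) : continuous u -> exists U : R -> R,
    forall t : R, 0 <= t <= 1 -> is_derive t 1 U (u t).
  (* The limits -1 and 2 make every point of [0, 1] interior, as the fundamental theorem of calculus
     requires. *)
  move=> cu; exists (fun x => \int[lebesgue_measure]_(t in `[-1, x]) u t) => t ht.
  have t2 : t < 2 by lra.
  have t1 : -1 < t by lra.
  have iu : lebesgue_measure.-integrable `[-1, 2] (EFin \o u).
    apply: continuous_compact_integrable; first exact: segment_compact.
    exact: continuous_subspaceT.
  have [d e] := @continuous_FTC1_closed R u (-1) t 2 t2 iu t1 (cu t).
  by split; [exact: d|rewrite -derive1E].
have [|U HU] := real (fun s => complex.Re (g s)); first by move=> t; have /ccontP[] := cg t.
have [|V HV] := real (fun s => complex.Im (g s)); first by move=> t; have /ccontP[] := cg t.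
by exists (fun t => U t +i* V t) => t ht; split; [exact: HU|exact: HV].
Qed.

Lemma prim_exists f f' z : (forall w, D w -> sdiff f (f' w) w) -> D z ->
  is_prim f z (prim f z).
Proof.
move=> hf Dz.
(* Clamping to [0, 1]: [f] is controlled on [D] only, while [antideriv] asks for continuity on the
   whole line. *)
pose cl (r : R) := Num.max 0 (Num.min r 1).
have cl01 r : 0 <= cl r <= 1 by rewrite /cl le_max lexx ge_max ler01 ge_min lexx orbT.
have clE r : 0 <= r <= 1 -> cl r = r.
  by move=> /andP[r0 r1]; rewrite /cl min_l // max_r.
have cl_lip r s : `|cl r - cl s| <= `|r - s|.
  rewrite /cl ler_norml; have := ler_norm (r - s); have := ler_norm (- (r - s)).
  rewrite normrN; case: (leP r 1) => h1; case: (leP s 1) => h2;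
    case: (leP 0 r) => h3; case: (leP 0 s) => h4;
    rewrite ?(max_r (@ler01 R)); lra.
have [|G HG] := @antideriv (fun r => f (c + (cl r)%:C * (z - c)) * (z - c)).
  move=> t e e0; have n0 : 0 < l1norm (z - c) + 1 by rewrite ltr_wpDl ?l1norm_ge0.
  have en0 : 0 < e / (l1norm (z - c) + 1) by rewrite divr_gt0.
  have [d d0 Hd] := sdiff_cont (hf _ (starD Dz (cl01 t))) en0.
  exists (d / (l1norm (z - c) + 1)) => [|s]; first by rewrite divr_gt0.
  rewrite ltr_pdivlMr // => st; rewrite -mulrBl.
  have := Hd (c + (cl s)%:C * (z - c)).
  have -> : c + (cl s)%:C * (z - c) - (c + (cl t)%:C * (z - c)) =
      (cl s - cl t)%:C * (z - c) by rewrite rmorphB /=; ring.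
  have k : l1norm ((cl s - cl t)%:C * (z - c)) < d.
    apply: le_lt_trans st; rewrite l1norm_Ml.
    by apply: ler_pM; rewrite ?l1norm_ge0 ?cl_lip // lerDl.
  move=> /(_ k); rewrite ltr_pdivlMr //; apply: le_lt_trans.
  apply: le_trans (l1normM _ _) _.
  by rewrite ler_wpM2l ?l1norm_ge0 // lerDl.
apply: (xgetPex 0 (P := [set v | is_prim f z v])); exists (G 1 - G 0), G; split => //.
  by apply: ccont_withinW => t /HG; exact: has_cderiv_cont.
move=> r /andP[r0 r1]; have r01 : 0 <= r <= 1 by rewrite !ltW.
by have := HG r r01; rewrite clE.
Qed.

(** A Poincare lemma. The derivative in r of r f(c + r (z - c)) is f + r f' (z - c), which is also
    the first variation in z of the integrand f(c + r (z - c)) (z - c). Hence the difference of two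
    primitives minus f z (z1 - z2) is the increment of a function [K] with small derivative. *)
Lemma sdiff_prim f f' z : (forall w, D w -> sdiff f (f' w) w) -> D z ->
  sdiff (prim f) (f z) z.
Proof.
move=> hf Dz e e0.
pose n := l1norm (z - c); have n0 : 0 <= n by exact: l1norm_ge0.
(* The derivative of [K] will be at most (n + 3) e' |z1 - z2|, and [cmvt] loses a factor 2. *)
pose e' := e / (2 * (n + 4)).
have e'0 : 0 < e' by rewrite divr_gt0 // mulr_gt0 // ltr_wpDl.
pose p (r : R) z1 := c + r%:C * (z1 - c).
have D01 r : 0 <= r <= 1 -> D (p r z) by move=> hr; exact: starD.
(* Estimates uniform in r along the segment; the bound on |f'| d absorbs the second-order term in z2
   - z and z1 - z2. *)
have [d1 d10 H1] : exists2 d, 0 < d & forall r, 0 <= r <= 1 ->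
    [/\ l1norm (f' (p r z)) * d <= e' & forall z1 z2, l1norm (z1 - z) < d ->
      l1norm (z2 - z) < d -> l1norm (f (p r z1) - f (p r z)) <= e' /\
      l1norm (f (p r z1) - f (p r z2) - f' (p r z) * (p r z1 - p r z2)) <=
      e' * l1norm (z1 - z2)].
  apply: (unif_segment (P := fun d r => [/\ l1norm (f' (p r z)) * d <= e' &
    forall z1 z2, l1norm (z1 - z) < d ->
      l1norm (z2 - z) < d -> l1norm (f (p r z1) - f (p r z)) <= e' /\
      l1norm (f (p r z1) - f (p r z2) - f' (p r z) * (p r z1 - p r z2)) <=
      e' * l1norm (z1 - z2)])) => r hr.
  have Dr := D01 r hr; have e4 : 0 < e' / 4 by rewrite divr_gt0.
  have [da da0 Ha] := hf _ Dr _ e4; have [db db0 Hb] := sdiff_cont (hf _ Dr) e4.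
  have [dc dc0 Hc] := sdiff_deriv_cont hf Dr e4.
  have [de de0 He] := sdiff_deriv_cont hf Dr (@ltr01 R).
  pose M := l1norm (f' (p r z)) + 1.
  have M0 : 0 < M by rewrite ltr_wpDl ?l1norm_ge0.
  pose del := Num.min da (Num.min db (Num.min dc de)).
  have del0 : 0 < del by rewrite !lt_min da0 db0 dc0.
  pose d := Num.min 1 (Num.min (e' / M) (del / (2 * (n + 2)))).
  have n2 : 0 < n + 2 by rewrite ltr_wpDl.
  have d0 : 0 < d.
    have q1 : 0 < e' / M by exact: divr_gt0.
    have q2 : 0 < del / (2 * (n + 2)) by apply: divr_gt0 => //; exact: mulr_gt0.
    by rewrite /d !lt_min ltr01 q1 q2.
  exists d => // r' d' hr' /andP[d'0 d'd].
  have d1 : d <= 1 by rewrite ge_min lexx.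
  have dM : d * M <= e' by rewrite -ler_pdivlMr // !ge_min lexx !orbT.
  have ddel : d * (2 * (n + 2)) <= del.
    by rewrite -ler_pdivlMr ?mulr_gt0 // !ge_min lexx !orbT.
  have r'2 : `|r'| <= 2.
    rewrite -[r'](subrK r); apply: le_trans (ler_normD _ _) _.
    by rewrite (ger0_norm (proj1 (andP hr))); move: (andP hr) => [_ r1]; lra.
  have near1 w : l1norm (w - z) < d' -> l1norm (p r' w - p r z) < del.
    move=> hw; have -> : p r' w - p r z = (r' - r)%:C * (z - c) + r'%:C * (w - z).
      by rewrite /p rmorphB /=; ring.
    apply: le_lt_trans (l1normD _ _) _; rewrite !l1norm_Ml.
    have : `|r' - r| * l1norm (z - c) <= d * n by rewrite ler_wpM2r // ltW.
    have : `|r'| * l1norm (w - z) <= 2 * d.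
      by apply: ler_pM; rewrite ?l1norm_ge0 // ltW // (lt_trans hw).
    by have := mulr_ge0 (ltW d0) n0; nra.
  have zz : l1norm (p r' z - p r z) < del by apply: near1; rewrite subrr l1norm_0.
  have lda x : x < del -> x < da by rewrite lt_min => /andP[].
  have ldb x : x < del -> x < db by rewrite !lt_min => /and4P[].
  have ldc x : x < del -> x < dc by rewrite !lt_min => /and4P[].
  have lde x : x < del -> x < de by rewrite !lt_min => /and4P[].
  split.
    apply: le_trans dM; rewrite mulrC; apply: ler_pM; rewrite ?l1norm_ge0 ?(ltW d'0) ?(ltW d'd) //.
    rewrite -[f' (p r' z)](subrK (f' (p r z))) addrC; apply: l1normD_le => //.
    exact: He (lde _ zz).
  move=> z1 z2 /near1 h1 /near1 h2; split.
    have -> : f (p r' z1) - f (p r' z) =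
      (f (p r' z1) - f (p r z)) - (f (p r' z) - f (p r z)) by ring.
    apply: le_trans (_ : e' / 4 + e' / 4 <= _); last by lra.
    by apply: l1normD_le; rewrite ?l1normN ltW // Hb // ldb.
  have -> : f (p r' z1) - f (p r' z2) - f' (p r' z) * (p r' z1 - p r' z2) =
    (f (p r' z1) - f (p r' z2) - f' (p r z) * (p r' z1 - p r' z2)) -
    (f' (p r' z) - f' (p r z)) * (p r' z1 - p r' z2) by ring.
  have pE : l1norm (p r' z1 - p r' z2) <= 2 * l1norm (z1 - z2).
    have -> : p r' z1 - p r' z2 = r'%:C * (z1 - z2) by rewrite /p; ring.
    by rewrite l1norm_Ml ler_wpM2r ?l1norm_ge0.
  apply: le_trans (_ : e' / 4 * (2 * l1norm (z1 - z2)) +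
     e' / 4 * (2 * l1norm (z1 - z2)) <= _); last by lra.
  apply: l1normD_le; last first.
    by rewrite l1normN; apply: l1normM_le => //; apply: Hc (ldc _ zz).
  apply: le_trans (Ha _ _ (lda _ h1) (lda _ h2)) _.
  by rewrite ler_wpM2l // ltW.
have [d2 d20 H2] := openD Dz.
exists (Num.min 1 (Num.min d1 d2)); first by rewrite !lt_min ltr01 d10.
move=> z1 z2; rewrite !lt_min => /and3P[a1 a2 a3] /and3P[b1 b2 b3].
have [G1 [cG1 dG1 ->]] := prim_exists hf (H2 _ a3).
have [G2 [cG2 dG2 ->]] := prim_exists hf (H2 _ b3).
pose K (r : R) := G1 r - G2 r - (z1 - z2) * (r%:C * f (p r z)).
have pder r : has_cderiv (fun s => p s z) r (z - c).
  apply: has_cderiv_eq (has_cderivD (has_cderiv_cst c r)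
    (has_cderivMr (z - c) (has_cderiv_id r))) _.
  by rewrite add0r mul1r.
have fder r : 0 <= r <= 1 ->
    has_cderiv (fun s : R => (z1 - z2) * (s%:C * f (p s z))) r
      ((z1 - z2) * (f (p r z) + r%:C * (f' (p r z) * (z - c)))).
  move=> hr; apply: has_cderivMl.
  apply: has_cderiv_eq (has_cderivM (has_cderiv_id r) (sdiff_path (hf _ (D01 r hr)) (pder r))) _.
  by rewrite mul1r.
have KE : K 1 - K 0 = G1 1 - G1 0 - (G2 1 - G2 0) - f z * (z1 - z2).
  by rewrite /K /p mul1r mul0r mulr0 mul1r [c + _]addrC subrK; ring.
rewrite -KE.
have -> : e * l1norm (z1 - z2) = 2 * (e' * (n + 4) * l1norm (z1 - z2)) * (1 - 0).
  by rewrite /e'; field; rewrite gt_eqF // ltr_wpDl.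
apply: cmvt => //.
  apply: ccont_withinB; first exact: ccont_withinB.
  by apply: ccont_withinW => r /fder; exact: has_cderiv_cont.
move=> r hr; have hr' : 0 <= r <= 1 by case/andP: hr => *; rewrite !ltW.
split; first by apply: has_cderivB (has_cderivB (dG1 r hr) (dG2 r hr)) (fder r hr').
have [k1 k2] := H1 r hr'; have [k3 k4] := k2 z1 z2 a2 b2.
have pE : p r z1 - p r z2 = r%:C * (z1 - z2) by rewrite /p; ring.
rewrite pE in k4.
rewrite -/(p r z1) -/(p r z2).
have -> : f (p r z1) * (z1 - c) - f (p r z2) * (z2 - c) -
    (z1 - z2) * (f (p r z) + r%:C * (f' (p r z) * (z - c))) =
  (z1 - z2) * (f (p r z1) - f (p r z)) +
  (z2 - c) * (f (p r z1) - f (p r z2) - f' (p r z) * (r%:C * (z1 - z2))) +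
  r%:C * (f' (p r z) * (z2 - z) * (z1 - z2)) by ring.
set m := l1norm (z1 - z2).
have m0 : 0 <= m by exact: l1norm_ge0.
have h5 : l1norm (z2 - c) <= n + 1.
  have -> : z2 - c = (z - c) + (z2 - z) by ring.
  by apply: l1normD_le => //; exact: ltW.
apply: le_trans (_ : m * e' + (n + 1) * (e' * m) + (e' * m) <= _).
  apply: l1normD_le; first by apply: l1normD_le; apply: l1normM_le.
  rewrite l1norm_Ml -[leRHS]mul1r; apply: ler_pM; rewrite ?l1norm_ge0 //.
    by case/andP: hr' => *; rewrite ger0_norm.
  apply: l1normM_le => //; apply: le_trans k1; apply: le_trans (l1normM _ _) _.
  by rewrite ler_wpM2l ?l1norm_ge0 // ltW.
by have := mulr_ge0 (ltW e'0) m0; nra.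
Qed.
End Star.
End StrictDerivative.

(** * Linear differential equations and the KZ equation on slit domains *)

Section SeriesODE.
Variable R : realType.
Local Notation S := (TH1 R).
Implicit Types (V W : R -> S) (al : R -> bool -> R[i]).

Definition ncderiv V t (L : S) := forall w, has_cderiv (fun s => V s w) t (L w).

Definition nccont (a b : R) V := forall w, ccont_within a b (fun s => V s w).

Lemma ncderiv_eq V t L M : ncderiv V t L -> L = M -> ncderiv V t M.
Proof. by move=> ? <-. Qed.

Lemma ncderiv_cst (C : S) t : ncderiv (fun=> C) t 0.
Proof. by move=> w; exact: has_cderiv_cst. Qed.

Lemma ncderivM V W t L M : ncderiv V t L -> ncderiv W t M ->
  ncderiv (fun s => V s * W s) t (L * W t + V t * M).
Proof.
move=> hV hW w; rewrite ncDE !ncME -big_split /=.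
apply: has_cderiv_sum => i _; exact: has_cderivM.
Qed.

Lemma ncderivMr V t L (C : S) : ncderiv V t L -> ncderiv (fun s => V s * C) t (L * C).
Proof.
move=> h; apply: ncderiv_eq (ncderivM h (ncderiv_cst C t)) _.
by rewrite mulr0 addr0.
Qed.

Lemma ncderiv_subst (s : bool -> S) V t L : ncderiv V t L ->
  ncderiv (fun u => ncsubst s (V u)) t (ncsubst s L).
Proof.
move=> hV w; apply: has_cderiv_sum => n _; apply: has_cderiv_sum => v _.
exact: has_cderivMr.
Qed.

Lemma nccontMr a b V (C : S) : nccont a b V -> nccont a b (fun s => V s * C).
Proof.
by move=> h w; apply: ccont_within_sum => i _; apply: ccont_withinMr; exact: h.
Qed.

Lemma ncderiv_cont a b V L : (forall t, a <= t <= b -> ncderiv V t (L t)) -> nccont a b V.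
Proof. by move=> h w; apply: ccont_withinW => t /h /(_ w); exact: has_cderiv_cont. Qed.

(** Induction on words: two solutions that agree on [w] have the same derivative on [x :: w], so
    they differ there by a constant, which the initial value makes 0. *)
Lemma ode_unique (X : seq R) al V W a b : a <= b -> nccont a b V -> nccont a b W ->
  (forall t, a < t < b -> t \notin X -> ncderiv V t (lform (al t) * V t)) ->
  (forall t, a < t < b -> t \notin X -> ncderiv W t (lform (al t) * W t)) ->
  V a = W a -> V b = W b.
Proof.
move=> ab cV cW hV hW Vab; suff H w t : a <= t <= b -> V t w = W t w.
  by apply: ncseriesP => w; apply: H; rewrite ab lexx.
elim: w t => [|x w IH] t /andP[at_ tb].
- apply/eqP; rewrite -subr_eq0; apply/eqP.
  transitivity (V a [::] - W a [::]); last by rewrite Vab subrr.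
  apply: (czero_deriv_off (S := X) (f := fun s => V s [::] - W s [::])) => //.
    by apply: ccont_withinB;
      [exact: ccont_within_sub (lexx a) tb (cV _)|exact: ccont_within_sub (lexx a) tb (cW _)].
  move=> u /andP[au ut] uX; have uab : a < u < b by rewrite au (lt_le_trans ut).
  apply: has_cderiv_eq (has_cderivB (hV u uab uX [::]) (hW u uab uX [::])) _.
  by rewrite !lformM_nil subrr.
- apply/eqP; rewrite -subr_eq0; apply/eqP.
  transitivity (V a (x :: w) - W a (x :: w)); last by rewrite Vab subrr.
  apply: (czero_deriv_off (S := X) (f := fun s => V s (x :: w) - W s (x :: w))) => //.
    by apply: ccont_withinB;
      [exact: ccont_within_sub (lexx a) tb (cV _)|exact: ccont_within_sub (lexx a) tb (cW _)].
  move=> u /andP[au ut] uX; have uab : a < u < b by rewrite au (lt_le_trans ut).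
  apply: has_cderiv_eq (has_cderivB (hV u uab uX _) (hW u uab uX _)) _.
  by rewrite !lformM_cons IH ?subrr // ltW //= ltW; case/andP: uab.
Qed.

(** Right multiplication by a constant preserves the solutions of dY = A Y, and Y(t) Y(a)^-1 V(a)
    has the initial value of [V]. *)
Lemma ode_transport (X : seq R) al V Y a b : a <= b -> nccont a b V -> nccont a b Y ->
  (forall t, a < t < b -> t \notin X -> ncderiv V t (lform (al t) * V t)) ->
  (forall t, a < t < b -> t \notin X -> ncderiv Y t (lform (al t) * Y t)) ->
  Y a \is a GRing.unit -> V b = Y b * (Y a)^-1 * V a.
Proof.
move=> ab cV cY hV hY Ya; rewrite -mulrA.
apply: (ode_unique (X := X) (al := al) (W := fun t => Y t * ((Y a)^-1 * V a)) ab) => //.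
- exact: nccontMr.
- by move=> t tab tX; rewrite mulrA; apply: ncderivMr; exact: hY.
- by rewrite mulVKr.
Qed.

End SeriesODE.

Section KZDomain.
Variable R : realType.
Implicit Types (s : R) (z : R[i]).

Definition slit_center s : R[i] := 2^-1 +i* s.

(* The complement of the two half-lines that start at 0 and 1 and point away
   from [slit_center s]. *)
Definition slit_dom s : set R[i] := [set z | forall r : R, 0 <= r <= 1 ->
  Sigma (slit_center s + r%:C * (z - slit_center s))].

Lemma slit_dom_star s z (r : R) : slit_dom s z -> 0 <= r <= 1 ->
  slit_dom s (slit_center s + r%:C * (z - slit_center s)).
Proof.
move=> Uz /andP[r0 r1] r' /andP[r'0 r'1].
have := Uz (r' * r); rewrite mulr_ge0 //= mulr_ile1 // => /(_ isT).
by rewrite rmorphM /= [_ + _ - _]addrC addKr mulrA.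
Qed.

Lemma slit_dom_Sigma s z : slit_dom s z -> Sigma z.
Proof. by move=> /(_ 1); rewrite ler01 lexx mul1r addrC subrK => /(_ isT). Qed.

Lemma Sigma_open z : Sigma z -> exists2 d, 0 < d & forall w, l1norm (w - z) < d -> Sigma w.
Proof.
have aux (c : R[i]) : z != c -> exists2 d, 0 < d & forall w, l1norm (w - z) < d -> w != c.
  move=> zc; exists (l1norm (z - c)); first by rewrite l1norm_gt0 // subr_eq0.
  by move=> w; apply: contraTneq => ->; rewrite l1normB ltxx.
move=> [/aux[d d0 hd] /aux[e e0 he]]; exists (Num.min d e); first by rewrite lt_min d0.
by move=> w; rewrite lt_min => /andP[/hd ? /he].
Qed.

Lemma slit_dom_open s z : slit_dom s z ->
  exists2 d, 0 < d & forall w, l1norm (w - z) < d -> slit_dom s w.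
Proof.
move=> Uz; set c := slit_center s.
have [d d0 Hd] : exists2 d, 0 < d & forall r, 0 <= r <= 1 ->
    forall w, l1norm (w - z) < d -> Sigma (c + r%:C * (w - c)).
  apply: (unif_segment (P := fun d r => forall w, l1norm (w - z) < d ->
    Sigma (c + r%:C * (w - c)))) => r hr.
  have [d d0 Hd] := Sigma_open (Uz r hr).
  pose n := l1norm (z - c); have n0 : 0 <= n by exact: l1norm_ge0.
  pose e := Num.min 1 (d / (n + 3)).
  have e0 : 0 < e by rewrite lt_min ltr01 divr_gt0 // ltr_wpDl.
  have e1 : e <= 1 by rewrite ge_min lexx.
  have ed : e * (n + 3) <= d by rewrite -ler_pdivlMr ?ltr_wpDl // ge_min lexx orbT.
  exists e => // r' d' hr' /andP[d'0 d'e] w hw; apply: Hd.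
  have r'2 : `|r'| <= 2.
    rewrite -[r'](subrK r); apply: le_trans (ler_normD _ _) _.
    by rewrite (ger0_norm (proj1 (andP hr))); move: (andP hr) => [_ r1]; lra.
  have -> : c + r'%:C * (w - c) - (c + r%:C * (z - c)) =
    (r' - r)%:C * (z - c) + r'%:C * (w - z) by rewrite rmorphB /=; ring.
  apply: le_lt_trans (l1normD _ _) _; rewrite !l1norm_Ml.
  have : `|r' - r| * l1norm (z - c) <= e * n by rewrite ler_wpM2r // ltW.
  have : `|r'| * l1norm (w - z) <= 2 * e.
    by apply: ler_pM; rewrite ?l1norm_ge0 // ltW // (lt_trans hw).
  by nra.
by exists d => // w hw r hr; exact: Hd.
Qed.

Let memE s z (r : R) : slit_center s + r%:C * (z - slit_center s) =
  (2^-1 + r * (complex.Re z - 2^-1)) +i* (s + r * (complex.Im z - s)).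
Proof. by case: z => a b; rewrite /slit_center; simpc; rewrite /=. Qed.

Let SigmaE (a b : R) : (b = 0 -> a != 0 /\ a != 1) -> Sigma (a +i* b).
Proof.
move=> H; split; apply/eqP => -[ha hb]; have [/eqP h0 /eqP h1] := H hb.
  by apply: h0.
by apply: h1.
Qed.

(** The centre lies strictly on the side of [s], so a segment from it into the closed half-plane of
    that side meets the real axis at most in its end point. *)
Lemma slit_dom_half s z : s != 0 -> Sigma z -> 0 <= s * complex.Im z -> slit_dom s z.
Proof.
move=> s0 Sz hz r /andP[r0 r1]; have [->|rn1] := eqVneq r 1.
  by rewrite mul1r addrC subrK.
rewrite memE; apply: SigmaE => h; exfalso.
have s2 : 0 < s * s by rewrite -expr2 exprn_even_gt0.
have {}r1 : r < 1 by rewrite lt_neqAle rn1.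
have : s * (s + r * (complex.Im z - s)) = 0 by rewrite h mulr0.
by move: (complex.Im z) hz {h} => v; nra.
Qed.

Lemma slit_dom_strip s z : 0 < complex.Re z < 1 -> slit_dom s z.
Proof.
move=> /andP[h1 h2] r /andP[r0 r1]; rewrite memE; apply: SigmaE => _.
by move: (complex.Re z) h1 h2 => u h1 h2; split; apply/eqP; nra.
Qed.

(** For both signs the slit from 0 lies on |Im z| = - 2 Re z, and the open sector between the two
    slits avoids both; likewise to the right of 1 in [slit_dom_right]. *)
Lemma slit_dom_left s z : s = 1 \/ s = -1 ->
  2 * complex.Re z + `|complex.Im z| < 0 -> slit_dom s z.
Proof.
move=> hs hz r /andP[r0 r1]; rewrite memE; apply: SigmaE.
have := ler_norm (complex.Im z); have := ler_norm (- complex.Im z); rewrite normrN.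
move: (complex.Re z) (complex.Im z) (`|complex.Im z|) hz => u v n h h1 h2 h3.
by split; apply/eqP; case: hs h3 => -> h3; nra.
Qed.

Lemma slit_dom_right s z : s = 1 \/ s = -1 ->
  `|complex.Im z| < 2 * (complex.Re z - 1) -> slit_dom s z.
Proof.
move=> hs hz r /andP[r0 r1]; rewrite memE; apply: SigmaE.
have := ler_norm (complex.Im z); have := ler_norm (- complex.Im z); rewrite normrN.
move: (complex.Re z) (complex.Im z) (`|complex.Im z|) hz => u v n h h1 h2 h3.
by split; apply/eqP; case: hs h3 => -> h3; nra.
Qed.

(** The first letter is integrated last, as in [iterint]; [sdiff_prim] turns the integrals along
    segments into holomorphic primitives. *)
Fixpoint fsol s (w : seq bool) : R[i] -> R[i] :=
  if w is a :: w' then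
    prim (slit_center s) (fun z => (i2pi R)^-1 * (z - (puncture R a)%:C)^-1 * fsol s w' z)
  else fun=> 1.

Lemma fsol_integrand s a w f' z : slit_dom s z -> sdiff (fsol s w) (f' z) z ->
  sdiff (fun z => (i2pi R)^-1 * (z - (puncture R a)%:C)^-1 * fsol s w z)
    ((i2pi R)^-1 * (- (z - (puncture R a)%:C)^-2) * fsol s w z +
     (i2pi R)^-1 * (z - (puncture R a)%:C)^-1 * f' z) z.
Proof.
move=> /slit_dom_Sigma[z0 z1] hw.
have za : z != (puncture R a)%:C by case: a; rewrite /puncture /= ?rmorph1 ?rmorph0.
apply: sdiffM hw.
apply: sdiff_eq (sdiffM (sdiff_cst _ _) (sdiff_inv za)) _.
by rewrite mul0r add0r.
Qed.

Lemma fsol_sdiff s w : exists f', forall z, slit_dom s z -> sdiff (fsol s w) (f' z) z.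
Proof.
elim: w => [|a w [f' IH]]; first by exists (fun=> 0) => z _; exact: sdiff_cst.
exists (fun z => (i2pi R)^-1 * (z - (puncture R a)%:C)^-1 * fsol s w z) => z Uz.
apply: (sdiff_prim (@slit_dom_star s) (@slit_dom_open s) _ Uz) => v Uv.
exact: fsol_integrand (IH v Uv).
Qed.

Lemma fsol_cons_sdiff s a w z : slit_dom s z -> sdiff (fsol s (a :: w))
  ((i2pi R)^-1 * (z - (puncture R a)%:C)^-1 * fsol s w z) z.
Proof.
move=> Uz; have [f' H] := fsol_sdiff s w.
apply: (sdiff_prim (@slit_dom_star s) (@slit_dom_open s) _ Uz) => v Uv.
exact: fsol_integrand (H v Uv).
Qed.

Definition KZsol s z : TH1 R := fun w => fsol s w z.

Lemma KZsol_unit s z : KZsol s z \is a GRing.unit.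
Proof. exact: ncunit1. Qed.

(** The coefficients of the connection form A at the point [y] on the tangent vector [l]. *)
Definition KZform (y : R[i]) (l : R[i]) : bool -> R[i] :=
  fun a => (i2pi R)^-1 * (l / (y - (puncture R a)%:C)).

Lemma KZsol_deriv s (y : R -> R[i]) t l : slit_dom s (y t) -> has_cderiv y t l ->
  ncderiv (fun u => KZsol s (y u)) t (lform (KZform (y t) l) * KZsol s (y t)).
Proof.
move=> Uy hy [|a w]; first by rewrite lformM_nil; exact: has_cderiv_cst.
rewrite lformM_cons; apply: has_cderiv_eq (sdiff_path (fsol_cons_sdiff a w Uy) hy) _.
by rewrite /KZform /KZsol; ring.
Qed.

Lemma KZsol_cont s (y : R -> R[i]) a b : (forall t, a <= t <= b -> slit_dom s (y t)) ->
  ccont_within a b y -> nccont a b (fun t => KZsol s (y t)).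
Proof.
move=> Uy /ccont_withinP cy w; have [f' H] := fsol_sdiff s w.
apply/ccont_withinP => t tab e e0.
have [d d0 Hd] := sdiff_cont (H _ (Uy t tab)) e0.
have [d' d'0 Hd'] := cy t tab d d0.
by exists d' => // u uab ut; apply: Hd; exact: Hd'.
Qed.

End KZDomain.

(** * Iterated integrals along piecewise smooth paths *)

Lemma integrable_setU_disj d (T : measurableType d) (R : realType)
    (mu : {measure set T -> \bar R}) (A B : set T) (f : T -> \bar R) :
  measurable A -> measurable B -> [disjoint A & B] ->
  mu.-integrable A f -> mu.-integrable B f -> mu.-integrable (A `|` B) f.
Proof.
move=> mA mB AB /integrableP[mfA iA] /integrableP[mfB iB].
have mf : measurable_fun (A `|` B) f by apply/(measurable_funU _ mA mB).
apply/integrableP; split => //.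
rewrite ge0_integral_setU //; first exact: lte_add_pinfty.
exact: measurableT_comp.
Qed.

Section IteratedIntegrals.
Variable R : realType.
Local Notation mu := (@lebesgue_measure R).
Implicit Types (z h : R -> R[i]) (w : seq bool).

(** At a break point the two-sided derivative [cderiv] may be meaningless. End points are null sets,
    so equality with a continuous function in the interior is enough. *)
Lemma integrable_eq_oo (u k : R -> R) (a b : R) : a < b ->
  {within `[a, b], continuous k} -> (forall t, a < t < b -> u t = k t) ->
  mu.-integrable `[a, b] (EFin \o u).
Proof.
move=> ab ck uk.
have pt (c : R) : mu.-integrable [set c] (EFin \o u).
  apply: null_set_integrable => //; first exact: measurable_fun_set1.
  exact: lebesgue_measure_set1.
have io : mu.-integrable `]a, b[ (EFin \o u).
  have ik : mu.-integrable `[a, b] (EFin \o k).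
    by apply: continuous_compact_integrable => //; exact: segment_compact.
  have {}ik : mu.-integrable `]a, b[ (EFin \o k).
    apply: integrableS ik => // t /=.
    by rewrite !in_itv /= => /andP[h1 h2]; rewrite !ltW.
  apply: eq_integrable ik => // t.
  by rewrite inE /= in_itv /= => /uk ->.
have -> : `[a, b]%classic = ([set a] `|` `]a, b[%classic) `|` [set b] :> set R.
  apply/seteqP; split => [t /=|t /=]; rewrite !in_itv /=.
    move=> /andP[]; rewrite le_eqVlt => /predU1P[->|h1]; first by left; left.
    rewrite le_eqVlt => /predU1P[->|h2]; first by right.
    by left; right; rewrite h1.
  by move=> [[->|/andP[h1 h2]]|->]; rewrite ?lexx ?ltW.
apply: integrable_setU_disj => //; first exact: measurableU.
  apply/disj_set2P; apply/seteqP; split => // t [/= [->|] e]; first by rewrite -e ltxx in ab.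
  by move: e; rewrite in_itv /= => /andP[_ h] e; rewrite e ltxx in h.
apply: integrable_setU_disj => //.
apply/disj_set2P; apply/seteqP; split => // t [/= ->].
by rewrite in_itv /= ltxx.
Qed.

Lemma integrable_cat (u : R -> R) (a b c : R) : a < b -> b < c ->
  mu.-integrable `[a, b] (EFin \o u) -> mu.-integrable `[b, c] (EFin \o u) ->
  mu.-integrable `[a, c] (EFin \o u).
Proof.
move=> ab bc iab ibc.
have -> : `[a, c]%classic = `[a, b]%classic `|` `]b, c]%classic :> set R.
  apply/seteqP; split => t /=; rewrite !in_itv /=.
    by move=> /andP[h1 h2]; case: (leP t b) => h3; [left; rewrite h1|right].
  by move=> [] /andP[h1 h2]; lra.
apply: integrable_setU_disj => //.
  apply/disj_set2P; apply/seteqP; split => // t [/=]; rewrite !in_itv /= => h1 h2; lra.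
apply: integrableS ibc => // t /=.
by rewrite !in_itv /= => /andP[h1 ->]; rewrite ltW.
Qed.

Lemma pieces_ind (P : R -> R -> Prop) (a : R) (s : seq R) :
  (forall a b c, a < b -> b < c -> P a b -> P b c -> P a c) ->
  path <%R a s -> s != [::] ->
  (forall i, (i < size s)%N -> nth 0 (a :: s) i < nth 0 s i ->
     P (nth 0 (a :: s) i) (nth 0 s i)) -> P a (last a s).
Proof.
move=> Pcat; elim: s a => // b s IH a /= /andP[ab bs] _ H.
case: s bs H IH => [|c s] bs H IH; first exact: (H 0%N).
apply: (Pcat _ b) => //.
- have lt_last : forall (x : R) t, path <%R x t -> t != [::] -> x < last x t.
    move=> x t; elim: t x => // y [|y' t] IHt x /= /andP[xy yt] _ //.
    by apply: lt_trans xy _; apply: (IHt y).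
  exact: (lt_last b (c :: s)).
- exact: (H 0%N).
by apply: IH => // i hi; exact: (H i.+1).
Qed.

Lemma pieces_in (a : R) (s : seq R) t : a < t < last a s -> t \notin s ->
  exists2 i, (i < size s)%N & nth 0 (a :: s) i < t < nth 0 s i.
Proof.
elim: s a => [a /andP[h1 h2]|b s IH a /= /andP[at_ tl]].
  by have := lt_trans h1 h2; rewrite ltxx.
rewrite inE negb_or => /andP[tb ts].
have [lt_tb|lt_bt|e] := ltgtP t b; last by rewrite e eqxx in tb.
  by exists 0%N; rewrite //= at_.
by have [|i hi ht] := IH b _ ts; [rewrite lt_bt|exists i.+1].
Qed.

Lemma cderivE z t l : has_cderiv z t l -> cderiv z t = l.
Proof. by case: l => a b [hr hi]; rewrite /cderiv !derive1E !derive_val. Qed.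

Lemma C1_has_cderiv z t : C1 z -> has_cderiv z t (cderiv z t).
Proof.
move=> [h1 h2 _ _]; split.
  apply: (DeriveDef (h1 t)); rewrite /cderiv /= derive1E; reflexivity.
apply: (DeriveDef (h2 t)); rewrite /cderiv /= derive1E; reflexivity.
Qed.

Lemma cintegral_cont h : 
  mu.-integrable `[0, 1] (EFin \o (fun t => complex.Re (h t))) ->
  mu.-integrable `[0, 1] (EFin \o (fun t => complex.Im (h t))) ->
  ccont_within 0 1 (fun t => cintegral h 0 t).
Proof.
by move=> ir ii; split; apply: (parameterized_integral_continuous ler01).
Qed.

Lemma cintegral_deriv h (t : R) : 0 < t < 1 ->
  mu.-integrable `[0, 1] (EFin \o (fun t => complex.Re (h t))) ->
  mu.-integrable `[0, 1] (EFin \o (fun t => complex.Im (h t))) ->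
  ccont h t -> has_cderiv (fun t => cintegral h 0 t) t (h t).
Proof.
move=> /andP[t0 t1] ir ii /ccontP[cr ci].
have [d1 e1] := continuous_FTC1_closed t1 ir t0 cr.
have [d2 e2] := continuous_FTC1_closed t1 ii t0 ci.
split.
  by apply: (DeriveDef d1); rewrite -derive1E; exact: e1.
by apply: (DeriveDef d2); rewrite -derive1E; exact: e2.
Qed.

Lemma cintegral00 h : cintegral h 0 0 = 0.
Proof. by rewrite /cintegral set_itv1 !Rintegral_set1. Qed.

Lemma ccont_withinM a b f g : ccont_within a b f -> ccont_within a b g ->
  @ccont_within R a b (fun s => f s * g s).
Proof.
have ReM (x y : R[i]) : complex.Re (x * y) =
    complex.Re x * complex.Re y - complex.Im x * complex.Im y.
  by case: x; case: y.
have ImM (x y : R[i]) : complex.Im (x * y) =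
    complex.Re x * complex.Im y + complex.Im x * complex.Re y.
  by case: x; case: y.
move=> [fr fi] [gr gi]; split.
  have -> : (fun s => complex.Re (f s * g s)) =
    (fun s => complex.Re (f s)) * (fun s => complex.Re (g s)) -
    (fun s => complex.Im (f s)) * (fun s => complex.Im (g s)).
    by apply/funext => s; rewrite ReM.
  by move=> x; apply: continuousB; apply: continuousM; [exact: fr|exact: gr|exact: fi|exact: gi].
have -> : (fun s => complex.Im (f s * g s)) =
    (fun s => complex.Re (f s)) * (fun s => complex.Im (g s)) +
    (fun s => complex.Im (f s)) * (fun s => complex.Re (g s)).
    by apply/funext => s; rewrite ImM.
by move=> x; apply: continuousD; apply: continuousM; [exact: fr|exact: gi|exact: fi|exact: gr].
Qed.

Lemma ccont_within_interior a b f t : a < t < b -> ccont_within a b f -> @ccont R f t.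
Proof.
move=> /andP[at_ tb] /ccont_withinP H e e0.
have [|d d0 Hd] := H t _ e e0; first by rewrite !ltW.
exists (Num.min d (Num.min (t - a) (b - t))); first by rewrite !lt_min d0 !subr_gt0 at_.
move=> s; rewrite !lt_min !ltr_norml => /and3P[h1 /andP[h2 h3] /andP[h4 h5]].
by apply: Hd; [lra|rewrite ltr_norml].
Qed.

Lemma ccont_near f g t d : 0 < d -> (forall s, `|s - t| < d -> f s = g s) ->
  @ccont R f t -> ccont g t.
Proof.
move=> d0 fg H e /H[d' d'0 Hd]; exists (Num.min d d'); first by rewrite lt_min d0.
move=> s; rewrite lt_min => /andP[h1 /Hd]; rewrite !fg //.
by rewrite subrr normr0.
Qed.

Lemma sdiff_ccont_within f (y : R -> R[i]) a b :
  (forall t, a <= t <= b -> exists l, sdiff f l (y t)) ->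
  ccont_within a b y -> ccont_within a b (fun t => f (y t)).
Proof.
move=> H /ccont_withinP cy; apply/ccont_withinP => t tab e e0.
have [l hl] := H t tab; have [d d0 Hd] := sdiff_cont hl e0.
have [d' d'0 Hd'] := cy t tab d d0.
by exists d' => // u uab ut; apply: Hd; exact: Hd'.
Qed.

Lemma eq_ccont_within a b f g : (forall t, a <= t <= b -> f t = g t) ->
  ccont_within a b f -> @ccont_within R a b g.
Proof.
move=> fg /ccont_withinP H; apply/ccont_withinP => t tab e e0.
have [d d0 Hd] := H t tab e e0; exists d => // s sab st.
by rewrite -!fg //; exact: Hd.
Qed.

Lemma ccont_withinP_ccont a b f : (forall t, ccont f t) -> @ccont_within R a b f.
Proof. by move=> h; apply: ccont_withinW. Qed.

Definition itform z w (a : bool) (s : R) : R[i] :=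
  (i2pi R)^-1 * (cderiv z s / (z s - (puncture R a)%:C)) * iterint z w s.

Section Piecewise.
Variable z : R -> R[i].
Hypothesis zS : forall t, 0 <= t <= 1 -> Sigma (z t).
Hypothesis zC : piecewise_C1 z.

Let s := projT1 (cid zC).
Let s_path : path <%R 0 s. Proof. by have [] := projT2 (cid zC). Qed.
Let s_last : last 0 s = 1. Proof. by have [] := projT2 (cid zC). Qed.
Let s_C1 i : (i < size s)%N -> exists2 g : R -> R[i], C1 g &
      forall t, nth 0 (0 :: s) i <= t <= nth 0 s i -> z t = g t.
Proof. by have [_ _] := projT2 (cid zC); apply. Qed.

Let s_nil : s != [::].
Proof. by apply: contra_eq_neq s_last => ->; rewrite /= eq_sym oner_eq0. Qed.

Let s_ge0 i : (i <= size s)%N -> 0 <= nth 0 (0 :: s) i <= 1.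
Proof.
move=> hi; have ss : sorted <=%R (0 :: s) by apply: (sub_path (e := <%R)) => // x y /ltW.
rewrite -s_last (last_nth 0) -{1}[0]/(nth 0 (0 :: s) 0).
by apply/andP; split; apply: (sorted_leq_nth le_trans lexx) => //; rewrite inE /= ltnS.
Qed.

Let piece_sub i t : (i < size s)%N -> nth 0 (0 :: s) i <= t <= nth 0 s i -> 0 <= t <= 1.
Proof.
move=> hi /andP[h1 h2]; have /andP[k1 _] := s_ge0 (ltnW hi).
have /andP[_ k2] := @s_ge0 i.+1 hi.
by rewrite (le_trans k1 h1) (le_trans h2 k2).
Qed.

Let interior i g t : (i < size s)%N -> nth 0 (0 :: s) i < t < nth 0 s i ->
  (forall t, nth 0 (0 :: s) i <= t <= nth 0 s i -> z t = g t) ->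
  exists2 d, 0 < d & forall u, `|u - t| < d ->
    z u = g u /\ nth 0 (0 :: s) i < u < nth 0 s i.
Proof.
set a := nth 0 _ _; set b := nth 0 _ _ => hi /andP[at_ tb] zg.
exists (Num.min (t - a) (b - t)); first by rewrite lt_min !subr_gt0 at_.
move=> u; rewrite lt_min !ltr_norml => /andP[/andP[h1 h2] /andP[h3 h4]].
have [h5 h6] : a < u /\ u < b by split; lra.
by rewrite zg ?h5 ?h6 // !ltW.
Qed.

Let cderiv_piece i g t : (i < size s)%N -> nth 0 (0 :: s) i < t < nth 0 s i -> C1 g ->
  (forall t, nth 0 (0 :: s) i <= t <= nth 0 s i -> z t = g t) ->
  has_cderiv z t (cderiv g t).
Proof.
move=> hi ht gC zg; have [d d0 Hd] := interior hi ht zg.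
apply: (has_cderiv_near d0 _ (C1_has_cderiv t gC)) => u /Hd [-> //].
Qed.

Let piece_cont i g w a : (i < size s)%N -> C1 g ->
  (forall t, nth 0 (0 :: s) i <= t <= nth 0 s i -> z t = g t) ->
  ccont_within 0 1 (fun t => iterint z w t) ->
  ccont_within (nth 0 (0 :: s) i) (nth 0 s i) (fun t =>
    (i2pi R)^-1 * (cderiv g t / (g t - (puncture R a)%:C)) * iterint z w t).
Proof.
move=> hi gC zg cw; apply: ccont_withinM; last first.
  apply: ccont_within_sub cw; first by have /andP[] := s_ge0 (ltnW hi).
  by have /andP[] := @s_ge0 i.+1 hi.
apply: ccont_withinM; first exact: ccont_within_cst.
apply: ccont_withinM.
  by apply: ccont_withinP_ccont => t; apply/ccontP; case: gC => _ _ c1 c2; split;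
    [exact: c1|exact: c2].
apply: (sdiff_ccont_within (f := fun x => (x - (puncture R a)%:C)^-1)).
  move=> t ht; eexists; apply: sdiff_inv; rewrite -zg //.
  have [z0 z1] := zS (piece_sub hi ht).
  by case: a; rewrite /puncture /= ?rmorph1 ?rmorph0.
by apply: ccont_withinP_ccont => t; apply: has_cderiv_cont (C1_has_cderiv t gC).
Qed.

Let itform_integrable w a : ccont_within 0 1 (fun t => iterint z w t) ->
  mu.-integrable `[0, 1] (EFin \o (fun t => complex.Re (itform z w a t))) /\
  mu.-integrable `[0, 1] (EFin \o (fun t => complex.Im (itform z w a t))).
Proof.
move=> cw; rewrite -s_last.
apply: (pieces_ind (P := fun a' b =>
    mu.-integrable `[a', b] (EFin \o (fun t => complex.Re (itform z w a t))) /\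
  mu.-integrable `[a', b] (EFin \o (fun t => complex.Im (itform z w a t))))) => //.
  by move=> a' b' c' ab bc [h1 h2] [h3 h4]; split; exact: (integrable_cat ab bc).
move=> i hi ab; have [g gC zg] := s_C1 hi.
have [kr ki] := piece_cont a hi gC zg cw.
have E t : nth 0 (0 :: s) i < t < nth 0 s i -> itform z w a t =
   (i2pi R)^-1 * (cderiv g t / (g t - (puncture R a)%:C)) * iterint z w t.
  move=> ht; rewrite /itform (cderivE (cderiv_piece hi ht gC zg)) zg //.
  by case/andP: ht => *; rewrite !ltW.
by split; apply: (integrable_eq_oo ab _ (fun t ht => congr1 _ (E t ht))).
Qed.

Lemma iterint_cont w : ccont_within 0 1 (fun t => iterint z w t).
Proof.
elim: w => [|a w IH]; first exact: ccont_within_cst.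
by have [h1 h2] := itform_integrable a IH; exact: cintegral_cont.
Qed.

Lemma piecewise_cont : ccont_within 0 1 z.
Proof.
rewrite -s_last.
suff : forall a t, path <%R a t -> t != [::] -> (forall i, (i < size t)%N ->
    exists2 g : R -> R[i], C1 g & forall u, nth 0 (a :: t) i <= u <= nth 0 t i -> z u = g u) ->
    a < last a t /\ ccont_within a (last a t) z.
  by move=> /(_ 0 s s_path s_nil s_C1)[].
move=> a t; elim: t a => // b t IH a /= /andP[ab bt] _ H.
have cab : ccont_within a b z.
  have [g gC zg] := H 0%N isT; apply: (eq_ccont_within (f := g)).
    by move=> u hu; rewrite zg.
  by apply: ccont_withinP_ccont => u; apply: has_cderiv_cont (C1_has_cderiv u gC).
case: t bt H IH => [//|c t] bt H IH.
have [|bl cbl] := IH b bt isT; first by move=> i hi; exact: (H i.+1).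
split; first exact: lt_trans bl.
move: (last b (c :: t)) bl cbl => l bl /ccont_withinP cbl; move/ccont_withinP: cab => cab.
apply/ccont_withinP => u /andP[au ul] e e0.
have [ub|bu|ub] := ltgtP u b.
- have [|d d0 Hd] := cab u _ e e0; first by rewrite au ltW.
  exists (Num.min d (b - u)); first by rewrite lt_min d0 subr_gt0.
  move=> v /andP[av vl]; rewrite lt_min => /andP[h1 h2]; apply: Hd => //.
  by rewrite av; move: h2; rewrite ltr_norml; lra.
- have [|d d0 Hd] := cbl u _ e e0; first by rewrite ul ltW.
  exists (Num.min d (u - b)); first by rewrite lt_min d0 subr_gt0.
  move=> v /andP[av vl]; rewrite lt_min => /andP[h1 h2]; apply: Hd => //.
  by rewrite vl andbT; move: h2; rewrite ltr_norml; lra.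
have [|d d0 Hd] := cab u _ e e0; first by rewrite ub lexx ltW.
have [|d' d'0 Hd'] := cbl u _ e e0; first by rewrite ub lexx ltW.
exists (Num.min d d'); first by rewrite lt_min d0.
move=> v /andP[av vl]; rewrite lt_min => /andP[h1 h2].
case: (leP v b) => vb; first by apply: Hd => //; rewrite av vb.
by apply: Hd' => //; rewrite vl ltW.
Qed.

(** The exceptional set consists of the break points; elsewhere the integrand is continuous and the
    fundamental theorem of calculus applies. *)
Lemma iterint_deriv : exists X : seq R, forall t, 0 < t < 1 -> t \notin X ->
  has_cderiv z t (cderiv z t) /\
  ncderiv (fun u => (fun w => iterint z w u) : TH1 R) t
    (lform (KZform (z t) (cderiv z t)) * ((fun w => iterint z w t) : TH1 R)).
Proof.
exists s => t ht tX; have [|i hi hti] := @pieces_in 0 s t _ tX; first by rewrite s_last.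
have [g gC zg] := s_C1 hi; have hz := cderiv_piece hi hti gC zg.
rewrite (cderivE hz); split=> // -[|a w]; first by rewrite lformM_nil; exact: has_cderiv_cst.
rewrite lformM_cons; have [h1 h2] := itform_integrable a (iterint_cont w).
have hzt : z t = g t by apply: zg; case/andP: hti => *; rewrite !ltW.
apply: has_cderiv_eq (cintegral_deriv ht h1 h2 _) _; last first.
  by rewrite /itform (cderivE hz).
have [d d0 Hd] := interior hi hti zg.
apply: (ccont_near d0 _ (ccont_within_interior hti (piece_cont a hi gC zg (iterint_cont w)))).
by move=> u /Hd[zu hu]; rewrite /itform (cderivE (cderiv_piece hi hu gC zg)) zu.
Qed.

(** Both sides solve the pullback of dY = A Y along [z]. The path has to lie in the slit domain on
    [a, b] only, so it can be cut into arcs in different domains. *)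
Lemma iterint_transport (c a b : R) : 0 <= a -> a <= b -> b <= 1 ->
  (forall t, a <= t <= b -> slit_dom c (z t)) ->
  ((fun w => iterint z w b) : TH1 R) =
  KZsol c (z b) * (KZsol c (z a))^-1 * ((fun w => iterint z w a) : TH1 R).
Proof.
move=> a0 ab b1 Uz; have [X HX] := iterint_deriv.
apply: (ode_transport (X := X) (al := fun t => KZform (z t) (cderiv z t)) ab
   (V := fun u => (fun w => iterint z w u) : TH1 R)
   (Y := fun u => KZsol c (z u))).
- by move=> w; apply: ccont_within_sub (iterint_cont w).
- by apply: KZsol_cont => //; apply: ccont_within_sub piecewise_cont.
- by move=> t /andP[at_ tb] tX; have [|_] := HX t _ tX; first by
    rewrite (le_lt_trans a0 at_) (lt_le_trans tb b1).
- move=> t /andP[at_ tb] tX; have [|hz _] := HX t _ tX; first by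
    rewrite (le_lt_trans a0 at_) (lt_le_trans tb b1).
  by apply: KZsol_deriv => //; apply: Uz; rewrite !ltW.
exact: KZsol_unit.
Qed.

Lemma iterint0 : ((fun w => iterint z w 0) : TH1 R) = 1.
Proof. by apply: ncseriesP => -[|a w] //=; rewrite cintegral00. Qed.

End Piecewise.
End IteratedIntegrals.

(** * Asymptotics along half circles *)

Section Asymptotics.
Variable R : realType.
Local Notation S := (TH1 R).
Implicit Types (f g : R -> R[i]) (F G : R -> S).

(* O(e |ln e|^k) for some k, respectively O(|ln e|^k), as e tends to 0+. *)
Definition csmall f := exists C (k : nat) d, [/\ 0 <= C, 0 < d &
  forall e, 0 < e < d -> l1norm (f e) <= C * e * (1 + `|ln e|) ^+ k].
Definition cpoly f := exists C (k : nat) d, [/\ 0 <= C, 0 < d &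
  forall e, 0 < e < d -> l1norm (f e) <= C * (1 + `|ln e|) ^+ k].

Let ln1 (e : R) (k m : nat) : (1 + `|ln e|) ^+ k <= (1 + `|ln e|) ^+ (k + m).
Proof. by rewrite exprD ler_peMr ?exprn_ge0 ?addr_ge0 // exprn_ege1 // lerDl. Qed.

Let ln0 (e : R) (k : nat) : 0 <= (1 + `|ln e|) ^+ k.
Proof. by rewrite exprn_ge0 // addr_ge0. Qed.

Lemma csmallD f g : csmall f -> csmall g -> csmall (fun e => f e + g e).
Proof.
move=> [C [k [d [C0 d0 H]]]] [C' [k' [d' [C'0 d'0 H']]]].
exists (C + C'), (k + k')%N, (Num.min d d'); split; rewrite ?addr_ge0 ?lt_min ?d0 //.
move=> e /andP[e0]; rewrite lt_min => /andP[ed ed'].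
rewrite !mulrDl; apply: l1normD_le.
  apply: le_trans (H _ _) _; first by rewrite e0.
  by rewrite ler_wpM2l // mulr_ge0 // ltW.
apply: le_trans (H' _ _) _; first by rewrite e0.
by rewrite addnC ler_wpM2l // mulr_ge0 // ltW.
Qed.

Lemma cpoly_csmallM f g : cpoly f -> csmall g -> csmall (fun e => f e * g e).
Proof.
move=> [C [k [d [C0 d0 H]]]] [C' [k' [d' [C'0 d'0 H']]]].
exists (C * C'), (k + k')%N, (Num.min d d'); split; rewrite ?mulr_ge0 ?lt_min ?d0 //.
move=> e /andP[e0]; rewrite lt_min => /andP[ed ed'].
rewrite exprD; have -> : C * C' * e * ((1 + `|ln e|) ^+ k * (1 + `|ln e|) ^+ k') =
  (C * (1 + `|ln e|) ^+ k) * (C' * e * (1 + `|ln e|) ^+ k') by ring.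
by apply: l1normM_le; [apply: H|apply: H']; rewrite e0.
Qed.

Lemma cpolyD f g : cpoly f -> cpoly g -> cpoly (fun e => f e + g e).
Proof.
move=> [C [k [d [C0 d0 H]]]] [C' [k' [d' [C'0 d'0 H']]]].
exists (C + C'), (k + k')%N, (Num.min d d'); split; rewrite ?addr_ge0 ?lt_min ?d0 //.
move=> e /andP[e0]; rewrite lt_min => /andP[ed ed'].
rewrite mulrDl; apply: l1normD_le.
  by apply: le_trans (H _ _) _; rewrite ?e0 // ler_wpM2l.
by apply: le_trans (H' _ _) _; rewrite ?e0 // addnC ler_wpM2l.
Qed.

Lemma cpolyM f g : cpoly f -> cpoly g -> cpoly (fun e => f e * g e).
Proof.
move=> [C [k [d [C0 d0 H]]]] [C' [k' [d' [C'0 d'0 H']]]].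
exists (C * C'), (k + k')%N, (Num.min d d'); split; rewrite ?mulr_ge0 ?lt_min ?d0 //.
move=> e /andP[e0]; rewrite lt_min => /andP[ed ed']; rewrite exprD mulrACA.
by apply: l1normM_le; [apply: H|apply: H']; rewrite e0.
Qed.

Lemma eq_csmall f g d : 0 < d -> (forall e, 0 < e < d -> f e = g e) -> csmall f -> csmall g.
Proof.
move=> d0 fg [C [k [d' [C0 d'0 H]]]]; exists C, k, (Num.min d d'); split => //.
  by rewrite lt_min d0.
by move=> e /andP[e0]; rewrite lt_min => /andP[ed ed']; rewrite -fg ?H ?e0.
Qed.

Lemma csmall0 : csmall (fun=> 0).
Proof.
by exists 0, 0%N, 1; split => // e _; rewrite l1norm_0 !mul0r.
Qed.

(** For e = exp(-t) the claim is that the exponential beats (1 + t)^k; this follows from 1 + x <=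
    exp x at x = t / (k + 1), raised to the power k + 1. *)
Lemma csmall_cst (c : R[i]) : csmall (fun=> c) -> c = 0.
Proof.
move=> [C [k [d [C0 d0 H]]]]; apply: l1norm_eq0; apply/eqP.
rewrite eq_le l1norm_ge0 andbT leNgt; apply/negP => c0.
pose m : R := (k.+1)%:R; have m0 : 0 < m by rewrite ltr0n.
(* 1 - ln d places exp(-t) below [d], and the quotient makes t |c| at least C m^(k+1). *)
pose t := Num.max (Num.max 0 (1 - ln d)) (C * m ^+ k.+1 / l1norm c).
have t0 : 0 <= t by rewrite !le_max lexx.
have td : 1 - ln d <= t by rewrite !le_max lexx orbT.
have tC : C * m ^+ k.+1 / l1norm c <= t by rewrite !le_max lexx !orbT.
have := H (expR (- t)); rewrite expR_gt0 /=.
have -> : expR (- t) < d by rewrite -[d]lnK ?ltr_expR; [lra|].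
rewrite expRK normrN (ger0_norm t0) => /(_ isT).
apply/negP; rewrite -ltNge.
have t1 : 0 < 1 + t by rewrite ltr_pwDl.
rewrite -(ltr_pM2r (x := expR t)) ?expR_gt0 //.
have -> : C * expR (- t) * (1 + t) ^+ k * expR t = C * (1 + t) ^+ k.
  by rewrite mulrAC -(mulrA C) -expRD addNr expR0 mulr1.
have h1 : (1 + t) ^+ k.+1 <= m ^+ k.+1 * expR t.
  have -> : expR t = (expR (t / m)) ^+ k.+1.
    by rewrite -expRM_natl -/m mulrCA divff ?mulr1 // gt_eqF.
  rewrite -exprMn; apply: lerXn2r; rewrite ?nnegrE ?mulr_ge0 ?expR_ge0 ?(ltW t1) ?(ltW m0) //.
  apply: le_trans (_ : m * (1 + t / m) <= _); last by rewrite ler_pM2l // expR_ge1Dx.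
  rewrite mulrDr mulrCA divff ?gt_eqF // !mulr1 lerD2r /m.
  by rewrite -[leLHS]/(1%:R) ler_nat.
rewrite -(ltr_pM2r (x := m ^+ k.+1)) ?exprn_gt0 //.
apply: lt_le_trans (_ : l1norm c * (1 + t) ^+ k.+1 <= _); last first.
  by rewrite -mulrA [expR t * _]mulrC ler_pM2l.
rewrite [(1 + t) ^+ k.+1]exprS mulrA (mulrAC C) ltr_pM2r ?exprn_gt0 //.
by rewrite -ltr_pdivrMl // mulrC; apply: le_lt_trans tC _; rewrite ltrDr.
Qed.

Lemma cpoly_cst (c : R[i]) : cpoly (fun=> c).
Proof.
by exists (l1norm c), 0%N, 1; split => //; [exact: l1norm_ge0|move=> e _; rewrite mulr1].
Qed.

Lemma csmall_lin f C d : 0 < d -> (forall e, 0 < e < d -> l1norm (f e) <= C * e) -> csmall f.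
Proof.
move=> d0 H; exists `|C|, 0%N, d; split => // e he; rewrite mulr1.
apply: le_trans (H e he) _; rewrite ler_wpM2r ?ler_norm //.
by case/andP: he => /ltW.
Qed.

Definition ncsmall F := forall w, csmall (fun e => F e w).
Definition ncpoly F := forall w, cpoly (fun e => F e w).

Let csmall_sum I (r : seq I) (P : pred I) (f : I -> R -> R[i]) :
  (forall i, csmall (f i)) -> csmall (fun e => \sum_(i <- r | P i) f i e).
Proof.
move=> H; elim: r => [|i r IH].
  apply: (eq_csmall (f := fun=> 0) ltr01) csmall0 => e _.
  by rewrite big_nil.
case Pi : (P i).
  apply: (eq_csmall ltr01 _ (csmallD (H i) IH)) => e _.
  by rewrite big_cons Pi.
apply: (eq_csmall ltr01 _ IH) => e _.
by rewrite big_cons Pi.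
Qed.

Let cpoly_sum I (r : seq I) (f : I -> R -> R[i]) :
  (forall i, cpoly (f i)) -> cpoly (fun e => \sum_(i <- r) f i e).
Proof.
move=> H; elim: r => [|i r IH].
  have -> : (fun e => \sum_(i <- [::]) f i e) = fun=> 0 by apply/funext => e; rewrite big_nil.
  by exists 0, 0%N, 1; split => // e _; rewrite l1norm_0 mul0r.
have -> : (fun e => \sum_(j <- i :: r) f j e) = fun e => f i e + \sum_(j <- r) f j e.
  by apply/funext => e; rewrite big_cons.
exact: cpolyD.
Qed.

Lemma ncpolyD F G : ncpoly F -> ncpoly G -> ncpoly (fun e => F e + G e).
Proof. by move=> hF hG w; exact: cpolyD (hF w) (hG w). Qed.

Lemma ncpolyM F G : ncpoly F -> ncpoly G -> ncpoly (fun e => F e * G e).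
Proof. by move=> hF hG w; apply: cpoly_sum => i; apply: cpolyM. Qed.

Lemma ncsmallD F G : ncsmall F -> ncsmall G -> ncsmall (fun e => F e + G e).
Proof. by move=> hF hG w; exact: csmallD (hF w) (hG w). Qed.

Lemma ncpoly_ncsmallM F G : ncpoly F -> ncsmall G -> ncsmall (fun e => F e * G e).
Proof. by move=> hF hG w; apply: csmall_sum => i; apply: cpoly_csmallM. Qed.

Lemma ncsmall_ncpolyM F G : ncsmall F -> ncpoly G -> ncsmall (fun e => F e * G e).
Proof.
move=> hF hG w; apply: csmall_sum => i.
by apply: (eq_csmall ltr01 _ (cpoly_csmallM (hG _) (hF _))) => e _; rewrite mulrC.
Qed.

Lemma csmall_cpoly f : csmall f -> cpoly f.
Proof.
move=> [C [k [d [C0 d0 H]]]]; exists C, k, (Num.min 1 d); split; rewrite ?lt_min ?ltr01 //.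
move=> e /andP[e0]; rewrite lt_min => /andP[e1 ed].
apply: le_trans (H e _) _; first by rewrite e0.
by rewrite -mulrA ler_wpM2l // ler_piMl // ltW.
Qed.

Lemma ncsmall_ncpoly F : ncsmall F -> ncpoly F.
Proof. by move=> h w; exact: csmall_cpoly. Qed.

Lemma ncpoly_cst (C : S) : ncpoly (fun=> C).
Proof. by move=> w; exact: cpoly_cst. Qed.

Lemma ncsmall_cst (C : S) : ncsmall (fun=> C) -> C = 0.
Proof. by move=> h; apply: ncseriesP => w; exact: csmall_cst (h w). Qed.

Lemma eq_ncsmall F G d : 0 < d -> (forall e, 0 < e < d -> F e = G e) -> ncsmall F -> ncsmall G.
Proof. by move=> d0 FG h w; apply: (eq_csmall d0 _ (h w)) => e /FG ->. Qed.

Lemma ncsmallN F : ncsmall F -> ncsmall (fun e => - F e).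
Proof.
move=> h; apply: (eq_ncsmall ltr01 _ (ncpoly_ncsmallM (ncpoly_cst (- 1)) h)) => e _.
by rewrite mulN1r.
Qed.

Lemma ncsmall_subst (s : bool -> S) F : ncsmall F -> ncsmall (fun e => ncsubst s (F e)).
Proof.
move=> h v; apply: csmall_sum => n; apply: csmall_sum => w.
apply: (eq_csmall ltr01 _ (cpoly_csmallM (cpoly_cst ((\prod_(a <- w) s a) v)) (h w))) => e _.
by rewrite mulrC.
Qed.

(* The series z^(u / 2 pi i) for the linear form u. *)
Definition zpow (u : bool -> R[i]) (e : R) : S :=
  lexp (fun a => ((ln e)%:C / i2pi R) * u a).

Lemma lexp_scale (c : R[i]) (u : bool -> R[i]) w :
  lexp (fun a => c * u a) w = c ^+ size w * lexp u w.
Proof.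
rewrite /lexp mulrCA; congr (_ * _).
elim: w => [|a w IH]; first by rewrite !big_nil mulr1.
by rewrite !big_cons IH exprS; ring.
Qed.

Lemma l1normX_le (z : R[i]) (n : nat) : l1norm (z ^+ n) <= l1norm z ^+ n.
Proof.
elim: n => [|n IH]; first by rewrite !expr0 -[1]/(1%:C) l1normR normr1.
by rewrite !exprS; exact: l1normM_le.
Qed.

Lemma zpow_poly u : ncpoly (zpow u).
Proof.
move=> w; pose n := size w; exists (l1norm (i2pi R)^-1 ^+ n * l1norm (lexp u w)), n, 1.
split; rewrite ?mulr_ge0 ?exprn_ge0 ?l1norm_ge0 // => e _.
rewrite /zpow lexp_scale mulrAC; apply: l1normM_le => //.
apply: le_trans (l1normX_le _ _) _; rewrite -exprMn.
apply: lerXn2r; rewrite ?nnegrE ?mulr_ge0 ?addr_ge0 ?l1norm_ge0 //.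
rewrite l1norm_Ml mulrC; apply: ler_pM; rewrite ?l1norm_ge0 //.
by rewrite lerDr.
Qed.

(** [E] is the divergent factor and [Ei] its inverse, both of polynomial growth in ln e. As [X] can
    be moved through [E], the constant Cb - X Ca turns out to equal an expression [W] of the small
    class. *)
Lemma connection F G (h1 h2 h3 : R -> S) (E Ei : R -> S) (X Ca Cb : S) d :
  0 < d -> ncpoly E -> ncpoly Ei -> ncsmall h1 -> ncsmall h2 -> ncsmall h3 ->
  (forall e, Ei e * E e = 1) -> (forall e, E e * X = X * E e) ->
  (forall e, 0 < e < d -> [/\ F e = (1 + h1 e) * E e, G e = (1 + h2 e) * E e &
    G e * Cb = (X + h3 e) * (F e * Ca)]) -> Cb = X * Ca.
Proof.
move=> d0 pE pEi s1 s2 s3 EiE EX H; apply/eqP; rewrite -subr_eq0; apply/eqP.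
apply: ncsmall_cst.
pose W e := Ei e * ((X * h1 e + h3 e * (1 + h1 e)) * (E e * Ca)) -
  Ei e * (h2 e * (E e * Cb)).
apply: (eq_ncsmall (F := W) d0).
  move=> e /H[-> -> GF]; set P := E e * Cb; set Q := E e * Ca.
  have e1 : (X + h3 e) * (1 + h1 e) = X + (X * h1 e + h3 e * (1 + h1 e)).
    by rewrite mulrDl mulrDr mulr1 addrA.
  move: GF; rewrite -!mulrA -/P -/Q mulrA e1 !mulrDl mul1r => GF.
  have PE : P - X * Q = (X * h1 e + h3 e * (1 + h1 e)) * Q - h2 e * P.
    by rewrite -[P in LHS](addrK (h2 e * P)) GF mulrDl addrAC [X * Q + _]addrC addrK.
  have XQ : X * Q = E e * (X * Ca) by rewrite /Q mulrA -EX mulrA.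
  by rewrite /W -/P -/Q -mulrBr -PE XQ /P -mulrBr mulrA EiE mul1r.
have p1 (h : R -> S) : ncsmall h -> ncpoly (fun e => 1 + h e).
  by move=> hh; apply: ncpolyD (ncpoly_cst 1) (ncsmall_ncpoly hh).
have pEC (C : S) : ncpoly (fun e => E e * C) by apply: ncpolyM pE (ncpoly_cst C).
apply: ncsmallD.
  apply: ncpoly_ncsmallM => //; apply: ncsmall_ncpolyM; last exact: pEC.
    apply: ncsmallD; first exact: ncpoly_ncsmallM (ncpoly_cst X) s1.
  by apply: ncsmall_ncpolyM => //; exact: p1.
apply: ncsmallN; apply: ncpoly_ncsmallM => //; apply: ncsmall_ncpolyM => //.
Qed.

End Asymptotics.

(** * Normalized local behaviour and transport along small arcs *)

Section Arcs.
Variable R : realType.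
Local Notation S := (TH1 R).

Lemma pchar_complex : [pchar R[i]] =i pred0.
Proof. exact: pchar_num. Qed.

(** The normalized local behaviour e^(u / 2 pi i) at a regular singular point with residue [u], the
    error being a left factor. *)
Definition asym (f : R -> S) (u : bool -> R[i]) := exists h : R -> S, exists d : R,
  [/\ 0 < d, ncsmall h & forall e, 0 < e < d -> f e = (1 + h e) * zpow u e].

Lemma ncsubst_lform (m : bool -> bool -> R[i]) (u : bool -> R[i]) :
  ncsubst (fun a => lform (m a)) (lform u) =
  lform (fun b => u true * m true b + u false * m false b).
Proof.
rewrite ncsubst_rec // big_bool /= scale0r add0r.
have E a : ncshift a (lform u) = u a *: 1.
  by apply: ncseriesP => -[|b w]; rewrite /ncshift ncZE nc1E ?mulr1 ?mulr0.
rewrite !E !ncsubstZ // !ncsubst1 // -!scalerAr !mulr1 !lformZ lformD.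
by [].
Qed.

Lemma asym_subst (m : bool -> bool -> R[i]) f u : asym f u ->
  asym (fun e => ncsubst (fun a => lform (m a)) (f e))
    (fun b => u true * m true b + u false * m false b).
Proof.
move=> [h [d [d0 hs H]]]; exists (fun e => ncsubst (fun a => lform (m a)) (h e)), d.
split=> //; first exact: ncsmall_subst.
move=> e /H ->; rewrite ncsubstM // ncsubstD ncsubst1 //; congr (_ * _).
rewrite /zpow -[lexp (fun a => _ * u a)]ncexp_lform.
rewrite ncsubst_exp; [|by []|by []].
rewrite ncsubst_lform ncexp_lform.
apply: eq_lexp => b; ring.
Qed.

Lemma csmall_mobius (f : R -> R[i]) : csmall f -> csmall (fun e => f (e / (1 + e))).
Proof.
(* |ln (e / (1 + e))| <= |ln e| + 1, whence the factor 2^k. *)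
move=> [C [k [d [C0 d0 H]]]]; exists (C * 2 ^+ k), k, (Num.min 1 d).
split; rewrite ?mulr_ge0 ?exprn_ge0 ?lt_min ?ltr01 //.
move=> e /andP[e0]; rewrite lt_min => /andP[e1 ed].
have p0 : 0 < 1 + e by rewrite addr_gt0.
have t0 : 0 < e / (1 + e) by rewrite divr_gt0.
have te : e / (1 + e) <= e by rewrite ler_pdivrMr // ler_peMr ?lerDl // ltW.
apply: le_trans (H _ _) _; first by rewrite t0 (le_lt_trans te).
have -> : C * 2 ^+ k * e * (1 + `|ln e|) ^+ k = C * e * (2 * (1 + `|ln e|)) ^+ k.
  by rewrite exprMn; ring.
have l1 : `|ln (1 + e)| <= 1.
  rewrite ger0_norm; last by rewrite ln_ge0 // lerDl ltW.
  by apply: le_trans (le_ln1Dx _) _; [rewrite (lt_trans _ e0) // ltrN10|exact: ltW].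
have Ct : 0 <= C * (e / (1 + e)) by apply: mulr_ge0 => //; exact: ltW.
apply: ler_pM; rewrite ?exprn_ge0 ?addr_ge0 //.
  by rewrite ler_wpM2l.
apply: lerXn2r; rewrite ?nnegrE ?mulr_ge0 ?addr_ge0 //.
rewrite lnM ?posrE ?invr_gt0 // lnV ?posrE //.
have := normr_ge0 (ln e); have := ler_normB (ln e) (ln (1 + e)); lra.
Qed.

(** The local parameters on neighbouring real intervals differ by the substitution of e / (1 + e)
    for e, and ln (1 + e) <= e makes the change of the exponential factor an admissible error. *)
Lemma asym_mobius f u : asym f u -> asym (fun e => f (e / (1 + e))) u.
Proof.
move=> [h [d [d0 hs H]]].
have alg (a b : S) : (1 + a) * (1 + b) = 1 + (a + b + a * b).
  by rewrite mulrDl mul1r mulrDr mulr1 -!addrA; congr (1 + _); rewrite addrCA.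
pose g (e : R) : S := lexp (fun a => ((- ln (1 + e))%:C / i2pi R) * u a) - 1.
exists (fun e => h (e / (1 + e)) + g e + h (e / (1 + e)) * g e), (Num.min 1 d).
have h's : ncsmall (fun e => h (e / (1 + e))) by move=> w; exact: csmall_mobius (hs w).
have gs : ncsmall g.
  move=> [|a w]; rewrite /g.
    apply: (eq_csmall ltr01 _ (csmall0 R)) => e _.
    by rewrite ncDE ncNE lexp_nil nc1E subrr.
  pose n := size w.
  pose M := l1norm (i2pi R)^-1 ^+ n.+1 * l1norm (lexp u (a :: w)).
  have M0 : 0 <= M by rewrite mulr_ge0 ?exprn_ge0 ?l1norm_ge0.
  apply: (csmall_lin (C := M) ltr01) => e /andP[e0 e1].
  have l0 : 0 <= ln (1 + e) by rewrite ln_ge0 // lerDl ltW.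
  have l1 : ln (1 + e) <= e by apply: le_ln1Dx; rewrite (lt_trans _ e0) // ltrN10.
  rewrite ncDE ncNE nc1E subr0 lexp_scale /M mulrAC; apply: l1normM_le => //.
  apply: le_trans (l1normX_le _ _) _.
  apply: le_trans (_ : (e * l1norm (i2pi R)^-1) ^+ n.+1 <= _).
    apply: lerXn2r; rewrite ?nnegrE ?mulr_ge0 ?l1norm_ge0 ?(ltW e0) //.
    by rewrite l1norm_Ml normrN ger0_norm // ler_wpM2r ?l1norm_ge0.
  rewrite exprMn mulrC ler_wpM2l ?exprn_ge0 ?l1norm_ge0 //.
  by rewrite exprS ler_piMr ?(ltW e0) // exprn_ile1 // ltW.
split; first by rewrite lt_min ltr01.
  by apply: ncsmallD; [exact: ncsmallD|apply: ncsmall_ncpolyM h's (ncsmall_ncpoly gs)].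
move=> e /andP[e0]; rewrite lt_min => /andP[e1 ed].
have p0 : 0 < 1 + e by rewrite addr_gt0.
have t0 : 0 < e / (1 + e) by rewrite divr_gt0.
have te : e / (1 + e) <= e by rewrite ler_pdivrMr // ler_peMr ?lerDl // ltW.
rewrite H ?t0 ?(le_lt_trans te) //.
have -> : zpow u (e / (1 + e)) = (1 + g e) * zpow u e.
  have -> : 1 + g e = lexp (fun a => ((- ln (1 + e))%:C / i2pi R) * u a).
    by rewrite addrC subrK.
  rewrite /zpow lexpD; last exact: pchar_complex.
  apply: eq_lexp => a; rewrite lnM ?posrE ?invr_gt0 // lnV ?posrE // rmorphD /=.
  by ring.
rewrite mulrA; congr (_ * _).
exact: alg.
Qed.

Lemma lexp_time_deriv (u : bool -> R[i]) (t : R) :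
  ncderiv (fun t => lexp (fun a => t%:C * u a)) t (lform u * lexp (fun a => t%:C * u a)).
Proof.
have XE (w : seq bool) : (fun t : R => lexp (fun a => t%:C * u a) w) =
    fun t => (t ^+ size w)%:C * lexp u w.
  by apply/funext => x; rewrite lexp_scale rmorphXn.
move=> [|a w].
  rewrite lformM_nil; apply: (has_cderiv_near ltr01 _ (has_cderiv_cst 1 t)) => x _.
  by rewrite lexp_nil.
rewrite lformM_cons lexp_scale XE.
have hX : is_derive t 1 (fun t : R => t ^+ (size w).+1) ((size w).+1%:R * t ^+ size w).
  by apply: (DeriveDef (@exprn_derivable R _ t 1)); rewrite exp_derive /GRing.scale /= mulr1.
apply: has_cderiv_eq (has_cderivMr _ (has_cderiv_real hX)) _.
rewrite /lexp big_cons [size (a :: w)]/= factS natrM rmorphM rmorphXn /= rmorph_nat.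
have n0 : ((size w).+1%:R : R[i]) != 0 by rewrite pnatr_eq0.
have f0 : ((size w)`!%:R : R[i]) != 0 by rewrite pnatr_eq0 -lt0n fact_gt0.
move: ((size w).+1%:R : R[i]) n0 ((size w)`!%:R : R[i]) f0 => m m0 q q0.
by field; rewrite m0 q0.
Qed.

Lemma lexp_time_bound (u : bool -> R[i]) (T : R) w : 0 <= T ->
  exists2 B, 0 <= B & forall t : R, 0 <= t <= T -> l1norm (lexp (fun a => t%:C * u a) w) <= B.
Proof.
move=> T0; exists (T ^+ size w * l1norm (lexp u w)).
  by rewrite mulr_ge0 ?exprn_ge0 ?l1norm_ge0.
move=> t /andP[t0 tT]; rewrite lexp_scale -rmorphXn l1norm_Ml ger0_norm ?exprn_ge0 //.
by rewrite ler_wpM2r ?l1norm_ge0 // lerXn2r.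
Qed.

(** The form converges at rate e to the constant form [al0], whose transport over the time [T] is
    the exponential. The error on [a :: w] comes from that on [w] by one integration, which replaces
    a Gronwall estimate. *)
Lemma arc_small (al : R -> R -> bool -> R[i]) (al0 : bool -> R[i]) (V : R -> R -> S)
    (d C T : R) : 0 < d -> 0 <= C -> 0 <= T ->
  (forall e, 0 < e < d -> V e 0 = 1 /\ forall t, 0 <= t <= T ->
     ncderiv (V e) t (lform (al e t) * V e t) /\
     forall a, l1norm (al e t a - al0 a) <= C * e) ->
  ncsmall (fun e => V e T - lexp (fun a => T%:C * al0 a)).
Proof.
move=> d0 C0 T0 H.
pose E (t : R) : S := lexp (fun a => t%:C * al0 a).
suff K w : exists2 C', 0 <= C' & forall e, 0 < e < Num.min 1 d -> forall t, 0 <= t <= T ->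
    l1norm (V e t w - E t w) <= C' * e.
  move=> w; have [C' C'0 HC'] := K w.
  have m0 : 0 < Num.min 1 d by rewrite lt_min ltr01.
  apply: (csmall_lin (C := C') m0) => e he.
  by apply: HC' => //; rewrite T0 lexx.
have E0 : E 0 = 1.
  by rewrite /E -[RHS](@lexp0 R[i] bool); apply: eq_lexp => a; rewrite mul0r.
have md e : 0 < e < Num.min 1 d -> 0 < e < d /\ e <= 1.
  by move=> /andP[e0]; rewrite lt_min => /andP[/ltW -> ->]; rewrite e0.
elim: w => [|a w [C' C'0 IH]].
  exists 0 => // e /md[/H[V0 HV] e1] t /andP[t0 tT]; rewrite mul0r.
  have -> : V e t [::] = V e 0 [::].
    apply: (czero_deriv (f := fun t => V e t [::]) t0).
      apply: ccont_withinW => u /andP[u0 ut].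
      have [|/(_ [::]) + _] := HV u; first by rewrite u0 (le_trans ut).
      exact: has_cderiv_cont.
    move=> u /andP[u0 ut]; have [|/(_ [::]) + _] := HV u.
      by rewrite !ltW // (lt_le_trans ut).
    by rewrite lformM_nil.
  by rewrite V0 /E lexp_nil nc1E subrr l1norm_0.
have [B B0 HB] := lexp_time_bound al0 w T0.
pose D := C * (B + C') + l1norm (al0 a) * C'.
have D0 : 0 <= D by rewrite addr_ge0 ?mulr_ge0 ?addr_ge0 ?l1norm_ge0.
exists (2 * D * T); first by rewrite !mulr_ge0.
move=> e he t /andP[t0 tT]; have [ed e1] := md e he; have [V0 HV] := H e ed.
have e0 : 0 < e by case/andP: he.
pose f u := V e u (a :: w) - E u (a :: w).
have f0 : f 0 = 0 by rewrite /f V0 E0 subrr.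
have df u : 0 <= u <= T -> has_cderiv f u (al e u a * V e u w - al0 a * E u w).
  move=> hu; have [/(_ (a :: w)) h1 _] := HV u hu.
  have := lexp_time_deriv al0 u (a :: w).
  rewrite !lformM_cons in h1 *; exact: has_cderivB.
rewrite -/(f t) -[f t]subr0 -f0.
apply: le_trans (_ : 2 * (D * e) * (t - 0) <= _); last first.
  rewrite subr0 -!mulrA ler_pM2l // ler_wpM2l // mulrC.
  by rewrite ler_wpM2r // ltW.
apply: cmvt => //.
  apply: ccont_withinW => u /andP[u0 ut]; apply: has_cderiv_cont (df u _).
  by rewrite u0 (le_trans ut).
move=> u /andP[u0 ut]; have hu : 0 <= u <= T by rewrite !ltW // (lt_le_trans ut).
split; first exact: df.
have [_ ha] := HV u hu.
have -> : al e u a * V e u w - al0 a * E u w =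
  (al e u a - al0 a) * V e u w + al0 a * (V e u w - E u w) by ring.
have hV := IH e he u hu.
have hV2 : l1norm (V e u w) <= B + C'.
  have -> : V e u w = E u w + (V e u w - E u w) by ring.
  apply: l1normD_le; first exact: HB.
  by apply: le_trans hV _; rewrite ler_piMr.
have -> : D * e = C * e * (B + C') + l1norm (al0 a) * (C' * e) by rewrite /D; ring.
by apply: l1normD_le; apply: l1normM_le.
Qed.

Lemma KZ_arc_small s (y y' : R -> R -> R[i]) (al0 : bool -> R[i]) (d C T : R) :
  0 < d -> 0 <= C -> 0 <= T ->
  (forall e t, 0 < e < d -> 0 <= t <= T -> [/\ slit_dom s (y e t), has_cderiv (y e) t (y' e t) &
     forall a, l1norm (KZform (y e t) (y' e t) a - al0 a) <= C * e]) ->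
  ncsmall (fun e => KZsol s (y e T) * (KZsol s (y e 0))^-1 - lexp (fun a => T%:C * al0 a)).
Proof.
move=> d0 C0 T0 H.
apply: (arc_small (al := fun e t => KZform (y e t) (y' e t))
  (V := fun e t => KZsol s (y e t) * (KZsol s (y e 0))^-1) d0 C0 T0) => e he.
split; first by rewrite mulrV // KZsol_unit.
move=> t ht; have [Uy hy ha] := H e t he ht; split=> //.
by rewrite mulrA; apply: ncderivMr; exact: KZsol_deriv.
Qed.

End Arcs.

(** * The half circles around 0, 1 and infinity *)

Section HalfCircles.
Variable R : realType.
Local Notation S := (TH1 R).

(** For s = 1 or -1 and t from 0 to pi, the half circle from 1 to -1 in the half-plane of sign
    [s]. *)
Definition arcp (s t : R) : R[i] := cos t +i* (s * sin t).

Lemma arcp0 s : arcp s 0 = 1.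
Proof. by rewrite /arcp cos0 sin0 mulr0. Qed.

Lemma arcp_pi s : arcp s pi = -1.
Proof. by rewrite /arcp cospi sinpi mulr0; apply/eqP; rewrite eq_complex /= oppr0 !eqxx. Qed.

Lemma arcp_deriv (s t : R) : s * s = 1 ->
  has_cderiv (arcp s) t ((0 +i* s) * arcp s t).
Proof.
move=> s1; have -> : (0 +i* s) * arcp s t = (- sin t) +i* (s * cos t).
  by rewrite /arcp; simpc; rewrite mulrA s1 mul1r.
exact: has_cderiv_cplx.
Qed.

Lemma arcp_bounds (s t : R) : s = 1 \/ s = -1 -> 1 <= l1norm (arcp s t) <= 2.
Proof.
move=> hs; rewrite /l1norm /arcp /=; have -> : `|s * sin t| = `|sin t|.
  by case: hs => ->; rewrite ?mul1r ?mulN1r ?normrN.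
have := cos_max t; have := sin_max t; have := cos2Dsin2 t.
rewrite -(real_normK (num_real (cos t))) -(real_normK (num_real (sin t))).
have := normr_ge0 (cos t); have := normr_ge0 (sin t).
by move: `|cos t| `|sin t| => c u *; apply/andP; split; nra.
Qed.

Let l1norm1 : l1norm (1 : R[i]) = 1.
Proof. by rewrite /l1norm /= normr0 normr1 addr0. Qed.

Lemma l1norm_away (u v : R[i]) : 1 <= l1norm u -> l1norm v <= 2^-1 ->
  u + v != 0 /\ l1norm (u + v)^-1 <= 4.
Proof.
move=> hu hv; have h : 2^-1 <= l1norm (u + v).
  by have := l1normD (u + v) (- v); rewrite addrK l1normN; lra.
have n0 : u + v != 0.
  by apply: contraTneq h => ->; rewrite l1norm_0 -ltNge invr_gt0.
split=> //; apply: le_trans (l1normV n0) _.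
by rewrite ler_pdivrMr ?l1norm_gt0 //; lra.
Qed.

Let Q := l1norm (i2pi R)^-1.

Lemma i2pi_neq0 : i2pi R != 0.
Proof.
by apply/eqP => -[] /eqP; rewrite mulf_eq0 pnatr_eq0 /= gt_eqF // pi_gt0.
Qed.

(** Half a turn, pi i s over 2 pi i: the origin of the factors 1/2 in all exponents. *)
Lemma pi_i2pi (s : R) : pi%:C * ((i2pi R)^-1 * (0 +i* s)) = (s / 2)%:C.
Proof.
apply: (mulfI i2pi_neq0); rewrite mulrCA mulVKf ?i2pi_neq0 //.
rewrite /i2pi; simpc; apply/eqP; rewrite eq_complex /=.
by apply/andP; split; apply/eqP; field.
Qed.

Section Sign.
Variable s : R.
Hypothesis hs : s = 1 \/ s = -1.

Let s1 : s * s = 1. Proof. by case: hs => ->; rewrite ?mulr1 ?mulrNN ?mulr1. Qed.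
Let s_neq0 : s != 0.
Proof. by apply/eqP => s0; move: s1; rewrite s0 mulr0 => /eqP; rewrite eq_sym oner_eq0. Qed.
Let hNs : - s = 1 \/ - s = -1.
Proof. by case: hs => ->; [right|left; rewrite opprK]. Qed.
Let is1 (r : R) : r = s \/ r = - s -> l1norm (0 +i* r) <= 1.
Proof.
rewrite /l1norm /= normr0 add0r => -[] ->; rewrite ?normrN.
  by case: hs => ->; rewrite ?normrN normr1.
by case: hs => ->; rewrite ?normrN normr1.
Qed.

Let sin_pi (t : R) : 0 <= t <= pi -> 0 <= sin t.
Proof. by move=> ht; exact: sin_ge0_pi. Qed.

Lemma half_circle0 : ncsmall (fun e => KZsol s (- e)%:C * (KZsol s e%:C)^-1 -
  lexp (fun a : bool => (s / 2)%:C * (a == false)%:R)).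
Proof.
pose y (e t : R) := e%:C * arcp s t.
pose y' (e t : R) := e%:C * ((0 +i* s) * arcp s t).
pose al0 (a : bool) : R[i] := if a then 0 else (i2pi R)^-1 * (0 +i* s).
(* With e < 1/4 and [arcp] of norm at most 2 the arc has norm at most 1/2 and stays away from 1. The
   letter y then has an error of order (2 e) 4, the letter x none. *)
have d0 : 0 < 4^-1 :> R by rewrite invr_gt0.
have C0 : 0 <= Q * (2 * 4) by rewrite !mulr_ge0 // l1norm_ge0.
apply: (eq_ncsmall d0 _ (@KZ_arc_small R s y y' al0 _ _ pi d0 C0 (pi_ge0 R) _)).
  move=> e he; rewrite /y arcp_pi arcp0 mulr1 mulrN1 -rmorphN; congr (_ - _).
  apply: eq_lexp => -[]; rewrite /al0 ?mulr0 //= mulr1; exact: pi_i2pi.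
move=> e t /andP[e0 e4] ht; have /andP[A1 A2] := arcp_bounds t hs.
have [||n0 nV] := @l1norm_away (-1) (y e t) _ _.
- by rewrite l1normN l1norm1.
- rewrite /y l1norm_Ml gtr0_norm //; nra.
have A0 : arcp s t != 0 by apply: contraTneq A1 => ->; rewrite l1norm_0 -ltNge.
have e0C : e%:C != 0 by apply/eqP => -[] /eqP; rewrite gt_eqF.
split.
- apply: slit_dom_half => //; first split; first by rewrite mulf_neq0.
    by rewrite -subr_eq0 addrC.
  have -> : complex.Im (y e t) = e * (s * sin t) by rewrite /y /arcp; simpc; rewrite /=.
  by rewrite mulrCA [s * (s * _)]mulrA s1 mul1r mulr_ge0 ?sin_pi // ltW.
- by apply: has_cderivMl; exact: arcp_deriv.
case; rewrite /KZform /al0 /puncture /=; last first.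
  rewrite subr0 /y' /y.
  have -> : (i2pi R)^-1 * (e%:C * ((0 +i* s) * arcp s t) / (e%:C * arcp s t)) -
    (i2pi R)^-1 * (0 +i* s) = 0 by field; rewrite A0 e0C i2pi_neq0.
  by rewrite l1norm_0 !mulr_ge0 ?l1norm_ge0 // ltW.
rewrite subr0 -mulrA; apply: l1normM_le => //.
have -> : y e t - 1%:C = -1 + y e t by rewrite addrC.
rewrite [2 * 4 * e]mulrAC; apply: l1normM_le => //.
rewrite l1norm_Ml gtr0_norm // mulrC ler_pM2r // -[2]mul1r.
by apply: l1normM_le => //; apply: is1; left.
Qed.

(** From 1 - e to 1 + e on the side [s] the turn around 1 is opposite to that of [half_circle0]
    around 0, hence the sign and the use of [arcp (- s)]. *)
Lemma half_circle1 : ncsmall (fun e => KZsol s (1 + e)%:C * (KZsol s (1 - e)%:C)^-1 -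
  lexp (fun a : bool => (- s / 2)%:C * (a == true)%:R)).
Proof.
pose y (e t : R) := 1 - e%:C * arcp (- s) t.
pose y' (e t : R) := - (e%:C * ((0 +i* (- s)) * arcp (- s) t)).
pose al0 (a : bool) : R[i] := if a then (i2pi R)^-1 * (0 +i* (- s)) else 0.
have d0 : 0 < 4^-1 :> R by rewrite invr_gt0.
have C0 : 0 <= Q * (2 * 4) by rewrite !mulr_ge0 // l1norm_ge0.
apply: (eq_ncsmall d0 _ (@KZ_arc_small R s y y' al0 _ _ pi d0 C0 (pi_ge0 R) _)).
  move=> e he; rewrite /y arcp_pi arcp0 mulr1 mulrN1 opprK.
  have -> : (1 + e)%:C = 1 + e%:C by rewrite rmorphD /= rmorph1.
  have -> : (1 - e)%:C = 1 - e%:C by rewrite rmorphB /= rmorph1.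
  congr (_ - _); apply: eq_lexp => -[]; rewrite /al0 ?mulr0 //= mulr1; exact: pi_i2pi.
move=> e t /andP[e0 e4] ht; have /andP[A1 A2] := arcp_bounds t hNs.
have [||n0 nV] := @l1norm_away 1 (- (e%:C * arcp (- s) t)) _ _.
- by rewrite l1norm1.
- rewrite l1normN l1norm_Ml gtr0_norm //; nra.
have A0 : arcp (- s) t != 0 by apply: contraTneq A1 => ->; rewrite l1norm_0 -ltNge.
have e0C : e%:C != 0 by apply/eqP => -[] /eqP; rewrite gt_eqF.
have yE : y e t - 1 = - (e%:C * arcp (- s) t) by rewrite /y addrC addKr.
split.
- apply: slit_dom_half => //; first split; first exact: n0.
    by rewrite -subr_eq0 yE oppr_eq0 mulf_neq0.
  have -> : complex.Im (y e t) = e * (s * sin t).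
    by rewrite /y /arcp; simpc; rewrite /=; ring.
  by rewrite mulrCA [s * (s * _)]mulrA s1 mul1r mulr_ge0 ?sin_pi // ltW.
- rewrite /y /y' -[X in has_cderiv _ _ X]add0r; apply: has_cderivD; first exact: has_cderiv_cst.
  by apply: has_cderivN; apply: has_cderivMl; apply: arcp_deriv; rewrite mulrNN.
case; rewrite /KZform /al0 /puncture /=.
  rewrite yE /y'.
  have -> : (i2pi R)^-1 * (- (e%:C * ((0 +i* - s) * arcp (- s) t)) / - (e%:C * arcp (- s) t)) -
    (i2pi R)^-1 * (0 +i* - s) = 0 by field; rewrite A0 e0C i2pi_neq0.
  by rewrite l1norm_0 !mulr_ge0 ?l1norm_ge0 // ltW.
rewrite !subr0 -mulrA; apply: l1normM_le => //.
rewrite [2 * 4 * e]mulrAC; apply: l1normM_le => //; rewrite l1normN.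
rewrite l1norm_Ml gtr0_norm // mulrC ler_pM2r // -[2]mul1r.
by apply: l1normM_le => //; apply: is1; right.
Qed.

(** Far out dz / z and dz / (z - 1) have the same limit in the angle, so both letters receive the
    same exponent; its sign comes from the direction, from -1/e to 1/e. *)
Lemma half_circle_oo : ncsmall (fun e => KZsol s (e^-1)%:C * (KZsol s (- e^-1)%:C)^-1 -
  lexp (fun a : bool => (s / 2)%:C * -1)).
Proof.
pose y (e t : R) := - ((e^-1)%:C * arcp (- s) t).
pose y' (e t : R) := - ((e^-1)%:C * ((0 +i* (- s)) * arcp (- s) t)).
pose al0 (a : bool) : R[i] := (i2pi R)^-1 * (0 +i* (- s)).
have d0 : 0 < 4^-1 :> R by rewrite invr_gt0.
have C0 : 0 <= Q * (1 * 4) by rewrite !mulr_ge0 // l1norm_ge0.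
apply: (eq_ncsmall d0 _ (@KZ_arc_small R s y y' al0 _ _ pi d0 C0 (pi_ge0 R) _)).
  move=> e he; rewrite /y arcp_pi arcp0 mulr1 mulrN1 opprK -rmorphN; congr (_ - _).
  apply: eq_lexp => a; rewrite /al0 pi_i2pi mulrN1 -rmorphN.
  by congr (_%:C); field.
move=> e t /andP[e0 e4] ht; have /andP[A1 A2] := arcp_bounds t hNs.
have [|n0 nV] := @l1norm_away (arcp (- s) t) e%:C A1 _.
  rewrite l1normR gtr0_norm //; lra.
have A0 : arcp (- s) t != 0 by apply: contraTneq A1 => ->; rewrite l1norm_0 -ltNge.
have e0C : e%:C != 0 by apply/eqP => -[] /eqP; rewrite gt_eqF.
have eVC : (e^-1)%:C = e%:C^-1 by rewrite fmorphV.
have yE : y e t - 1 = - (e%:C^-1 * (arcp (- s) t + e%:C)).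
  by rewrite /y eVC; field; rewrite e0C.
split.
- apply: slit_dom_half => //; first split.
    by rewrite /y oppr_eq0 mulf_neq0 // eVC invr_eq0.
    by rewrite -subr_eq0 yE oppr_eq0 mulf_neq0 // invr_eq0.
  have -> : complex.Im (y e t) = e^-1 * (s * sin t).
    by rewrite /y /arcp; simpc; rewrite /=; ring.
  by rewrite mulrCA [s * (s * _)]mulrA s1 mul1r mulr_ge0 ?sin_pi // invr_ge0 ltW.
- by apply: has_cderivN; apply: has_cderivMl; apply: arcp_deriv; rewrite mulrNN.
case; rewrite /KZform /al0 /puncture /=.
  rewrite yE /y' eVC.
  have -> : (i2pi R)^-1 * (- (e%:C^-1 * ((0 +i* - s) * arcp (- s) t)) /
       - (e%:C^-1 * (arcp (- s) t + e%:C))) - (i2pi R)^-1 * (0 +i* - s) =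
     (i2pi R)^-1 * (e%:C * ((0 +i* s) / (arcp (- s) t + e%:C))).
    have -> : 0 +i* - s = - (0 +i* s) by apply/eqP; rewrite eq_complex /= oppr0 !eqxx.
    by field; rewrite n0 e0C i2pi_neq0.
  rewrite -mulrA; apply: l1normM_le => //.
  rewrite l1norm_Ml gtr0_norm // mulrC ler_pM2r //; apply: l1normM_le => //.
  by apply: is1; left.
rewrite subr0 /y' /y eVC.
have -> : (i2pi R)^-1 * (- (e%:C^-1 * ((0 +i* - s) * arcp (- s) t)) /
    - (e%:C^-1 * arcp (- s) t)) - (i2pi R)^-1 * (0 +i* - s) = 0.
  by field; rewrite A0 e0C i2pi_neq0.
by rewrite l1norm_0 !mulr_ge0 ?l1norm_ge0 // ltW.
Qed.

End Sign.
End HalfCircles.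

(** * The KZ associator and the hexagon relation *)

Section KZSolutions.
Variable R : realType.
Local Notation S := (TH1 R).

Lemma complex_norm_l1norm (z : R[i]) (e : R) : `|z| < e%:C -> l1norm z < 2 * e.
Proof.
case: z => a b; rewrite normc_def ltcR /= => h.
have aux (x y : R) : Num.sqrt (x ^+ 2 + y ^+ 2) < e -> `|x| < e.
  apply: le_lt_trans; rewrite -sqrtr_sqr; apply: ler_wsqrtr.
  by rewrite lerDl sqr_ge0.
have h1 := aux _ _ h; have h2 : `|b| < e by apply: (aux b a); rewrite addrC.
by rewrite /l1norm /=; lra.
Qed.

Lemma cvg_l1norm (u : nat -> R[i]) (l : R[i]) : (u @ \oo --> l)%classic ->
  forall e : R, 0 < e -> exists N, forall n, (N <= n)%N -> l1norm (u n - l) < e.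
Proof.
move=> /cvgrPdist_lt ul e e0.
have e2 : 0 < (e / 2)%:C by rewrite ltcR divr_gt0.
have [N _ HN] := ul _ e2; exists N => n Nn.
have := complex_norm_l1norm (HN n Nn); rewrite l1normB mulrCA divff ?pnatr_eq0 //.
by rewrite mulr1.
Qed.

Lemma geometric_bound (B q : R) (a : nat -> R[i]) n : 0 <= B -> 0 <= q <= 2^-1 ->
  (forall k, l1norm (a k) <= B * q ^+ k) ->
  l1norm (\sum_(0 <= k < n.+1) a k - a 0%N) <= 2 * B * q.
Proof.
move=> B0 /andP[q0 q2] H.
have : l1norm (\sum_(0 <= k < n.+1) a k - a 0%N) <= 2 * B * q - 2 * B * q ^+ n.+1.
  elim: n => [|n IH]; first by rewrite big_nat1 subrr l1norm_0 expr1 subrr.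
  rewrite big_nat_recr //= addrAC.
  apply: le_trans (l1normD _ _) _; apply: le_trans (lerD IH (H _)) _.
  rewrite [in leRHS]exprS; have := exprn_ge0 n.+1 q0.
  by move: (q ^+ n.+1) => r r0; have := mulr_ge0 B0 r0; nra.
move/le_trans; apply; rewrite lerBlDr lerDl !mulr_ge0 // exprn_ge0 //.
Qed.

(** The series converges at u0 = r / 2, so its terms are bounded there. For smaller e they are
    dominated by a geometric progression of ratio e / u0, and everything beyond the constant term is
    O(e). *)
Lemma analytic_one_small (H : R -> S) : analytic_one H -> ncsmall (fun e => H e - 1).
Proof.
move=> [r r0 [c c0 Hc]] w.
pose u0 := r / 2; have u00 : 0 < u0 by rewrite divr_gt0.
have u0r : u0 < r by rewrite ltr_pdivrMr // ltr_pMr // ltr1n.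
pose a (u : R) n := c n w * u%:C ^+ n.
have [B B0 HB] : exists2 B, 0 <= B & forall n, l1norm (a u0 n) <= B.
  have [|N HN] := cvg_l1norm (Hc u0 _ w) (@ltr01 R); first by rewrite u00.
  exists (2 + \sum_(k < N) l1norm (a u0 k)).
    by rewrite addr_ge0 // sumr_ge0 // => k _; exact: l1norm_ge0.
  move=> n; have s0 : 0 <= \sum_(k < N) l1norm (a u0 k).
    by rewrite sumr_ge0 // => k _; exact: l1norm_ge0.
  case: (ltnP n N) => nN.
    rewrite (bigD1 (Ordinal nN)) //= addrCA lerDl addr_ge0 // sumr_ge0 // => k _.
    exact: l1norm_ge0.
  have -> : a u0 n = (series (a u0) n.+1 - H u0 w) - (series (a u0) n - H u0 w).
    by rewrite /series /= big_nat_recr //=; ring.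
  apply: le_trans (_ : 1 + 1 <= _); last by rewrite -[leLHS]addr0 lerD2l.
  apply: l1normD_le; rewrite ?l1normN ltW //; apply: HN => //.
  exact: leq_trans nN _.
apply: (csmall_lin (C := 2 * B / u0) (d := u0 / 2)); first by rewrite divr_gt0.
move=> e /andP[e0 eu].
have q2 : 0 <= e / u0 <= 2^-1.
  by rewrite divr_ge0 ?(ltW e0) ?(ltW u00) //= ler_pdivrMr // mulrC ltW.
have Ha k : l1norm (a e k) <= B * (e / u0) ^+ k.
  have -> : a e k = a u0 k * ((e / u0) ^+ k)%:C.
    rewrite /a rmorphXn /= -mulrA -exprMn -rmorphM /=; congr (_ * _%:C ^+ _).
    by rewrite mulrC divfK // gt_eqF.
  apply: l1normM_le => //; rewrite l1normR ger0_norm // exprn_ge0 //.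
  by case/andP: q2.
rewrite leNgt; apply/negP => hlt.
pose del := l1norm ((H e - 1) w) - 2 * B / u0 * e.
have del0 : 0 < del by rewrite subr_gt0.
have er : 0 < e < r by rewrite e0 (lt_trans eu) // (lt_trans _ u0r) // ltr_pdivrMr // ltr_pMr // ltr1n.
have [N HN] := cvg_l1norm (Hc e er w) del0.
have k1 := HN N.+1 (leqnSn N).
have k2 := geometric_bound N B0 q2 Ha.
have a0 : a e 0%N = (1 : S) w by rewrite /a c0 expr0 mulr1.
have : l1norm ((H e - 1) w) < del + 2 * B * (e / u0).
  have -> : (H e - 1) w = - (series (a e) N.+1 - H e w) + (series (a e) N.+1 - a e 0%N).
    by rewrite a0 ncDE ncNE; ring.
  apply: le_lt_trans (l1normD _ _) _; rewrite l1normN.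
  exact: ltr_leD.
by rewrite /del mulrA -[2 * B * e / u0]mulrAC subrK ltxx.
Qed.

Lemma KZ_solutionP (Psi : R -> S) : KZ_solution Psi <-> forall t, 0 < t < 1 ->
  ncderiv Psi t (lform (KZform t%:C 1) * Psi t).
Proof.
have E (t : R) : (i2pi R)^-1 *: (t%:C^-1 *: varx R + (t%:C - 1)^-1 *: vary R) =
    lform (KZform t%:C 1).
  rewrite !lform_var !lformZ lformD lformZ; congr lform; apply/funext => -[].
    by rewrite /KZform /puncture /= mulr0 add0r mulr1 div1r.
  by rewrite /KZform /puncture /= mulr0 addr0 mulr1 div1r subr0.
by split=> H t ht w; have := H t ht w; rewrite E.
Qed.

(** The reference point is the midpoint, because the equations in question are singular at the ends
    of (0, 1). *)
Lemma interval_const (P Y : R -> S) (al : R -> bool -> R[i]) :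
  (forall t, 0 < t < 1 -> P t \is a GRing.unit /\ ncderiv P t (lform (al t) * P t)) ->
  (forall t, 0 < t < 1 -> ncderiv Y t (lform (al t) * Y t)) ->
  exists C, forall t, 0 < t < 1 -> Y t = P t * C.
Proof.
move=> HP HY; pose t0 : R := 2^-1; exists ((P t0)^-1 * Y t0) => t ht.
have ht0 : 0 < t0 < 1 by rewrite /t0; apply/andP; split; lra.
have in01 (a b u : R) : 0 < a < 1 -> 0 < b < 1 -> a <= u <= b -> 0 < u < 1.
  by move=> h1 h2 h3; lra.
have tr (a b : R) : 0 < a < 1 -> 0 < b < 1 -> a <= b -> Y b = P b * (P a)^-1 * Y a.
  move=> ha hb ab; have [Pa _] := HP a ha.
  apply: (ode_transport (X := [::]) (al := al) ab) => //.
  - by apply: ncderiv_cont => u hu; apply: HY; exact: in01 ha hb hu.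
  - by apply: ncderiv_cont => u hu; apply: (HP u _).2; exact: in01 ha hb hu.
  - by move=> u /andP[au ub] _; apply: HY; apply: in01 ha hb _; rewrite !ltW.
  - by move=> u /andP[au ub] _; apply: (HP u _).2; apply: in01 ha hb _; rewrite !ltW.
have [tt|tt] := leP t0 t; first by rewrite (tr t0 t) // mulrA.
rewrite (tr t t0) //; last exact: ltW.
rewrite -[P t0 * _ * Y t]mulrA (mulKr (HP _ ht0).1).
by rewrite (mulVKr (HP _ ht).1).
Qed.

(** The constant term has derivative 0 and tends to 1 where the solution is normalized; this makes
    all values of the solution invertible. *)
Lemma KZ_solution_nil (Psi H : R -> S) (f : R -> R) (u : bool -> R[i]) : KZ_solution Psi ->
  analytic_one H -> (forall e, 0 < e < 1 -> 0 < f e < 1 /\ Psi (f e) = H e * zpow u e) ->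
  forall t, 0 < t < 1 -> Psi t [::] = 1.
Proof.
move=> /KZ_solutionP hPsi hH HP t ht.
have cst (a b : R) : 0 < a < 1 -> 0 < b < 1 -> a <= b -> Psi b [::] = Psi a [::].
  move=> ha hb ab; apply: (czero_deriv (f := fun t => Psi t [::]) ab).
    apply: ccont_withinW => v hv; have v01 : 0 < v < 1 by lra.
    exact: has_cderiv_cont (hPsi v v01 [::]).
  move=> v hv; have v01 : 0 < v < 1 by lra.
  by have := hPsi v v01 [::]; rewrite lformM_nil.
apply/eqP; rewrite -subr_eq0; apply/eqP; apply: csmall_cst.
apply: (eq_csmall (f := fun e => (H e - 1) [::]) (@ltr01 R)); last exact: analytic_one_small.
move=> e he; have [fe fE] := HP e he.
have -> : Psi t [::] = Psi (f e) [::].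
  by case: (leP t (f e)) => h; [rewrite (cst t (f e))|rewrite (cst (f e) t) // ltW].
by rewrite fE ncM_nil /zpow lexp_nil mulr1 ncDE ncNE nc1E.
Qed.

(** [qb e * (qa e)^-1] is the transport along a half circle. Its limit is the exponential of a
    multiple of the residue [u] and hence commutes with the divergent factor, as [connection]
    requires. *)
Lemma asym_connection (F G : R -> S) (u : bool -> R[i]) (c : R[i]) (Ca Cb : S)
    (qa qb : R -> S) (d : R) : 0 < d -> asym F u -> asym G u ->
  ncsmall (fun e => qb e * (qa e)^-1 - lexp (fun a => c * u a)) ->
  (forall e, 0 < e < d -> [/\ qa e \is a GRing.unit, qa e = F e * Ca & qb e = G e * Cb]) ->
  Cb = lexp (fun a => c * u a) * Ca.
Proof.
move=> d0 [h1 [d1 [d10 s1 H1]]] [h2 [d2 [d20 s2 H2]]] s3 H.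
have comm (x y : R[i]) : lexp (fun a => x * u a) * lexp (fun a => y * u a) =
    lexp (fun a => y * u a) * lexp (fun a => x * u a).
  by rewrite !lexpD ?[x + y]addrC //; exact: pchar_complex.
apply: (connection (F := F) (G := G) (d := Num.min d (Num.min d1 d2)) (h1 := h1) (h2 := h2)
  (h3 := fun e => qb e * (qa e)^-1 - lexp (fun a => c * u a))
  (E := zpow u) (Ei := zpow (fun a => - u a))) => //.
- by rewrite !lt_min d0 d10.
- exact: zpow_poly.
- exact: zpow_poly.
- move=> e; rewrite /zpow -[RHS](lexpV (fun a => ((ln e)%:C / i2pi R) * u a) (pchar_complex R)).
  by congr (_ * _); apply: eq_lexp => a; rewrite mulrN.
- by move=> e; exact: comm.
move=> e /andP[e0]; rewrite !lt_min => /and3P[ed ed1 ed2].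
have [qu qaE qbE] := H e (introT andP (conj e0 ed)).
split; [by apply: H1; rewrite e0|by apply: H2; rewrite e0|].
by rewrite addrC subrK -qaE -qbE mulrVK.
Qed.

(** Pullbacks of the letters: x dlog z + y dlog (z - 1) becomes x dlog t + (- x - y) dlog (t - 1)
    under z = t / (t - 1), and y dlog t + (- x - y) dlog (t - 1) under z = 1 / (1 - t), which is
    [mob2]. The indices 0, 1, 2 number the real intervals from left to right. *)
Definition mob0 (a b : bool) : R[i] := if a then -1 else (b == false)%:R.
Definition mob2 (a b : bool) : R[i] := if a then -1 else (b == true)%:R.

Section Pieces.
Variables (Phi : S) (Psi0 Psi1 : R -> S) (H0 H1 : R -> S).
Hypothesis (kz0 : KZ_solution Psi0) (kz1 : KZ_solution Psi1).
Hypothesis (a0 : analytic_one H0) (a1 : analytic_one H1).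
Hypothesis e0 : forall t, 0 < t < 1 -> Psi0 t = H0 t * ncexp (((ln t)%:C / i2pi R) *: varx R).
Hypothesis e1 : forall t, 0 < t < 1 ->
  Psi1 t = H1 (1 - t) * ncexp (((ln (1 - t))%:C / i2pi R) *: vary R).
Hypothesis ePhi : forall t, 0 < t < 1 -> Psi0 t = Psi1 t * Phi.

Let ux (b : bool) : R[i] := (b == false)%:R.
Let uy (b : bool) : R[i] := (b == true)%:R.
Let uz (b : bool) : R[i] := -1.

Let zpowx e : ncexp (((ln e)%:C / i2pi R) *: varx R) = zpow ux e.
Proof. by rewrite lform_var lformZ ncexp_lform. Qed.
Let zpowy e : ncexp (((ln e)%:C / i2pi R) *: vary R) = zpow uy e.
Proof. by rewrite lform_var lformZ ncexp_lform. Qed.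

Let asym0 : asym Psi0 ux.
Proof.
exists (fun e => H0 e - 1), 1; split=> //; first exact: analytic_one_small.
by move=> e /e0; rewrite zpowx [1 + _]addrC subrK.
Qed.

Let onem01 (t : R) : 0 < t < 1 -> 0 < 1 - t < 1. Proof. by move=> h; lra. Qed.

Let asym1 : asym (fun e => Psi1 (1 - e)) uy.
Proof.
exists (fun e => H1 e - 1), 1; split=> //; first exact: analytic_one_small.
move=> e /onem01 /e1 ->; rewrite zpowy; have -> : 1 - (1 - e) = e by ring.
by congr (_ * _); rewrite addrC subrK.
Qed.

Let unit0 t : 0 < t < 1 -> Psi0 t \is a GRing.unit.
Proof.
move=> ht; apply: ncunit1; apply: (KZ_solution_nil (f := id) (u := ux) kz0 a0) => // e he.
by rewrite e0 // zpowx.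
Qed.

Let unit1 t : 0 < t < 1 -> Psi1 t \is a GRing.unit.
Proof.
move=> ht; apply: ncunit1; apply: (KZ_solution_nil (f := fun e => 1 - e) (u := uy) kz1 a1) => // e he.
rewrite e1 ?onem01 // zpowy; have -> : 1 - (1 - e) = e by ring.
by split=> //; exact: onem01.
Qed.

Lemma Phi_unit : Phi \is a GRing.unit.
Proof.
have h : 0 < (2^-1 : R) < 1 by apply/andP; split; lra.
by rewrite -(unitrMr _ (unit1 h)) -ePhi // unit0.
Qed.

Let subst_unit (m : bool -> bool -> R[i]) (F : S) : F \is a GRing.unit ->
  ncsubst (fun a => lform (m a)) F \is a GRing.unit.
Proof.
by move=> Fu; apply/unitrP; exists (ncsubst (fun a => lform (m a)) F^-1);
  rewrite -!ncsubstM // mulVr // mulrV // ncsubst1.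
Qed.

(** Substituting the letters turns the KZ equation into its pullback along [phi], so both functions
    solve the same equation on (0, 1). *)
Let mob_const s (m : bool -> bool -> R[i]) (phi : R -> R) (phi' : R -> R) :
  (forall t, 0 < t < 1 -> slit_dom s (phi t)%:C) ->
  (forall t : R, 0 < t < 1 -> is_derive t 1 phi (phi' t)) ->
  (forall t b, 0 < t < 1 -> KZform t%:C 1 true * m true b + KZform t%:C 1 false * m false b =
     KZform (phi t)%:C (phi' t)%:C b) ->
  exists C, forall t, 0 < t < 1 ->
    KZsol s (phi t)%:C = ncsubst (fun a => lform (m a)) (Psi0 t) * C.
Proof.
move=> Uphi dphi mE.
apply: (interval_const (Y := fun t => KZsol s (phi t)%:C)
   (P := fun t => ncsubst (fun a => lform (m a)) (Psi0 t))
   (al := fun t => KZform (phi t)%:C (phi' t)%:C)) => t ht.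
  split; first by apply: subst_unit; exact: unit0.
  have /KZ_solutionP /(_ t ht) h := kz0.
  apply: ncderiv_eq (ncderiv_subst _ h) _; rewrite ncsubstM // ncsubst_lform.
  by congr (lform _ * _); apply/funext => b; rewrite mE.
apply: (KZsol_deriv (y := fun t => (phi t)%:C)); first exact: Uphi.
exact: has_cderiv_real (dphi t ht).
Qed.

Definition mob1 (a b : bool) : R[i] := (a == b)%:R.

Let subst_mob1 (F : S) : ncsubst (fun a => lform (mob1 a)) F = F.
Proof.
apply: ncseriesP => v; elim: v F => [|b v IH] F; first by rewrite ncsubst_nil.
rewrite ncsubst_rec // big_bool /= !ncDE ncZE nc1E mulr0 add0r !lformM_cons !IH.
by rewrite /mob1 /ncshift; case: b; rewrite /= ?mul1r ?mul0r ?addr0 ?add0r.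
Qed.

Let t_neq (t : R) : 0 < t < 1 -> [/\ t%:C != 0, t%:C - 1 != 0 & t - 1 != 0].
Proof.
move=> /andP[h1 h2]; split; first by apply/eqP => -[] /eqP; rewrite gt_eqF.
  by rewrite subr_eq0; apply/eqP => -[] /eqP; rewrite lt_eqF.
by rewrite subr_eq0 lt_eqF.
Qed.

Section Sign.
Variable s : R.
Hypothesis hs : s = 1 \/ s = -1.

Let s_neq0 : s != 0.
Proof. by case: hs => ->; rewrite ?oppr_eq0 oner_eq0. Qed.

Let real_dom (u : R) : u != 0 -> u != 1 -> slit_dom s u%:C.
Proof.
move=> u0 u1; apply: slit_dom_half => //; last by rewrite mulr0.
by split; apply/eqP => -[] /eqP; [rewrite (negPf u0)|rewrite (negPf u1)].
Qed.

Lemma mob1_const : exists C, forall t, 0 < t < 1 -> KZsol s t%:C = Psi0 t * C.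
Proof.
have [|t b ht|C HC] := @mob_const s mob1 id (fun=> 1).
- by move=> t ht; apply: slit_dom_strip.
- by case: b; rewrite /mob1 /= ?mulr1 ?mulr0 ?addr0 ?add0r.
by exists C => t ht; rewrite HC // subst_mob1.
Qed.

Lemma mob0_const : exists C, forall t, 0 < t < 1 ->
  KZsol s (t / (t - 1))%:C = ncsubst (fun a => lform (mob0 a)) (Psi0 t) * C.
Proof.
apply: (@mob_const s mob0 (fun t => t / (t - 1)) (fun t => - (t - 1)^-2)).
- move=> t ht; have [_ _ t1] := t_neq ht; apply: real_dom.
    by rewrite mulf_neq0 ?invr_eq0 // gt_eqF //; case/andP: ht.
  apply/eqP => /(congr1 (fun x => x * (t - 1))); rewrite divfK // mul1r; lra.
- move=> t ht; have [_ _ t1] := t_neq ht.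
  have h : is_derive t 1 (fun t : R => t - 1) 1.
    by apply: is_derive_eq; rewrite subr0.
  have h' : is_derive t 1 (fun t : R => (t - 1)^-1) (- (t - 1)^-2).
    by apply: is_derive_eq (@is_deriveV R (fun t => t - 1) t 1 1 t1 h) _; rewrite /GRing.scale /= mulr1.
  apply: is_derive_eq (is_deriveM (is_derive_id t 1) h') _.
  by rewrite /GRing.scale /=; field.
move=> t b ht; have [c0 c1 t1] := t_neq ht.
have tE : (t / (t - 1))%:C = t%:C / (t%:C - 1).
  by rewrite rmorphM fmorphV rmorphB /= rmorph1.
have t'E : (- (t - 1)^-2)%:C = - (t%:C - 1)^-2.
  by rewrite rmorphN fmorphV rmorphXn rmorphB /= rmorph1.
have c2 : t%:C - (t%:C - 1) != 0 by rewrite opprB addrC subrK oner_eq0.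
rewrite /KZform /mob0 /puncture tE t'E.
by case: b; rewrite /= ?rmorph1 ?rmorph0; field; rewrite ?mulN1r ?i2pi_neq0 ?c0 ?c1 ?c2.
Qed.

Lemma mob2_const : exists C, forall t, 0 < t < 1 ->
  KZsol s ((1 - t)^-1)%:C = ncsubst (fun a => lform (mob2 a)) (Psi0 t) * C.
Proof.
apply: (@mob_const s mob2 (fun t => (1 - t)^-1) (fun t => (1 - t)^-2)).
- move=> t ht; have /andP[h1 h2] := onem01 ht; apply: real_dom.
    by rewrite invr_eq0 gt_eqF.
  apply/eqP => h; have := mulVf (lt0r_neq0 h1); rewrite h mul1r; lra.
- move=> t ht; have /andP[h1 h2] := onem01 ht.
  have h : is_derive t 1 (fun t : R => 1 - t) (-1).
    apply: is_derive_eq; ring.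
  apply: is_derive_eq (@is_deriveV R (fun t => 1 - t) t (-1) 1 (lt0r_neq0 h1) h) _.
  by rewrite /GRing.scale /= mulrN1 opprK.
move=> t b ht; have [c0 c1 t1] := t_neq ht.
have c1' : 1 - t%:C != 0 by rewrite -opprB oppr_eq0.
have tE : ((1 - t)^-1)%:C = (1 - t%:C)^-1.
  by rewrite fmorphV rmorphB /= rmorph1.
have t'E : ((1 - t)^-2)%:C = (1 - t%:C)^-2.
  by rewrite fmorphV rmorphXn rmorphB /= rmorph1.
have c2 : 1 - (1 - t%:C) != 0 by rewrite opprB addrC subrK.
rewrite /KZform /mob2 /puncture tE t'E.
by case: b; rewrite /= ?rmorph1 ?rmorph0; field; rewrite ?mulN1r ?i2pi_neq0 ?c0 ?c1 ?c1' ?c2.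
Qed.

(** The three equalities come from the half circles around 0, 1 and infinity. To the left of 1 and
    near infinity the normalized solution is built from [Psi1] instead of [Psi0], whence the factors
    [Phi]. *)
Lemma KZ_connection : exists C0 C1 C2 : S, [/\
  forall t, 0 < t < 1 -> [/\ KZsol s t%:C = Psi0 t * C1,
    KZsol s (t / (t - 1))%:C = ncsubst (fun a => lform (mob0 a)) (Psi0 t) * C0 &
    KZsol s ((1 - t)^-1)%:C = ncsubst (fun a => lform (mob2 a)) (Psi0 t) * C2],
  C0 = lexp (fun a => (s / 2)%:C * ux a) * C1,
  C2 = lexp (fun a => (- s / 2)%:C * uy a) * (Phi * C1) &
  ncsubst (fun a => lform (mob2 a)) Phi * C2 =
  lexp (fun a => (s / 2)%:C * uz a) * (ncsubst (fun a => lform (mob0 a)) Phi * C0)].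
Proof.
have [C1 hC1] := mob1_const; have [C0 hC0] := mob0_const; have [C2 hC2] := mob2_const.
have as00 : asym (fun e => ncsubst (fun a => lform (mob0 a)) (Psi0 e)) ux.
  have := asym_subst mob0 asym0; congr (asym _ _); apply/funext => b.
  by rewrite /ux /mob0 /= mul0r add0r mul1r.
have as01 : asym (fun e => ncsubst (fun a => lform (mob0 a)) (Psi1 (1 - e))) uz.
  have := asym_subst mob0 asym1; congr (asym _ _); apply/funext => b.
  by rewrite /uy /mob0 /= mul0r addr0 mul1r.
have as20 : asym (fun e => ncsubst (fun a => lform (mob2 a)) (Psi0 e)) uy.
  have := asym_subst mob2 asym0; congr (asym _ _); apply/funext => b.
  by rewrite /ux /mob2 /= mul0r add0r mul1r.
have as21 : asym (fun e => ncsubst (fun a => lform (mob2 a)) (Psi1 (1 - e))) uz.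
  have := asym_subst mob2 asym1; congr (asym _ _); apply/funext => b.
  by rewrite /uy /mob2 /= mul0r addr0 mul1r.
have te (e : R) : 0 < e -> 0 < e / (1 + e) < 1.
  by move=> he; rewrite divr_gt0 ?addr_gt0 //= ltr_pdivrMr ?addr_gt0 // mul1r ltrDr.
have n1 (e : R) : 0 < e -> 1 + e != 0 by move=> he; rewrite gt_eqF // addr_gt0.
exists C0, C1, C2; split=> //; first by move=> t ht; rewrite hC1 // hC0 // hC2.
(* At 0: t / (t - 1) = - e for t = e / (1 + e). *)
- apply: (asym_connection (F := Psi0) (u := ux)
    (G := fun e => ncsubst (fun a => lform (mob0 a)) (Psi0 (e / (1 + e))))
    (qa := fun e => KZsol s e%:C) (qb := fun e => KZsol s (- e)%:C) (d := 1)) => //.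
  + exact: (asym_mobius as00).
  + exact: half_circle0.
  move=> e he; split; [exact: KZsol_unit|exact: hC1|].
  have pe : 0 < e by case/andP: he.
  rewrite -hC0 ?te //; congr (KZsol s _%:C); field; rewrite n1 //=.
  by have -> : e + -1 * (1 + e) = -1 by ring; rewrite oppr_eq0 oner_eq0.
(* At 1: 1 / (1 - t) = 1 + e for the same t. *)
- apply: (asym_connection (F := fun e => Psi1 (1 - e)) (u := uy)
    (G := fun e => ncsubst (fun a => lform (mob2 a)) (Psi0 (e / (1 + e))))
    (qa := fun e => KZsol s (1 - e)%:C) (qb := fun e => KZsol s (1 + e)%:C) (d := 1)) => //.
  + exact: (asym_mobius as20).
  + exact: half_circle1.
  move=> e he; have pe : 0 < e by case/andP: he.
  split; first exact: KZsol_unit.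
    by rewrite hC1 ?onem01 // ePhi ?onem01 // mulrA.
  rewrite -hC2 ?te //; congr (KZsol s _%:C); field; rewrite n1 //=.
  by rewrite addrK oner_eq0.
(* At infinity: t / (t - 1) = - 1/e for t = 1 - e / (1 + e), and 1 / (1 - t) = 1/e for t = 1 - e. *)
apply: (asym_connection (u := uz) (c := (s / 2)%:C) (Cb := ncsubst (fun a => lform (mob2 a)) Phi * C2) (Ca := ncsubst (fun a => lform (mob0 a)) Phi * C0)
    (F := fun e => ncsubst (fun a => lform (mob0 a)) (Psi1 (1 - e / (1 + e))))
    (G := fun e => ncsubst (fun a => lform (mob2 a)) (Psi1 (1 - e)))
    (qa := fun e => KZsol s (- e^-1)%:C) (qb := fun e => KZsol s (e^-1)%:C) (d := 1)) => //.
- exact: (asym_mobius as01).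
- exact: half_circle_oo.
move=> e he; have pe : 0 < e by case/andP: he.
have e0' : e != 0 by rewrite gt_eqF.
split; first exact: KZsol_unit.
  rewrite mulrA -ncsubstM // -ePhi ?onem01 ?te // -hC0 ?onem01 ?te //.
  congr (KZsol s _%:C); field; rewrite n1 // e0' andbT /=.
  have E : 1 + e - e + -1 * (1 + e) = - e by ring.
  by rewrite E oppr_eq0.
rewrite mulrA -ncsubstM // -ePhi ?onem01 // -hC2 ?onem01 //.
by congr (KZsol s _%:C); field; rewrite opprB addrC subrK.
Qed.

End Sign.
(** [c] and [c'] are the constants of the two half-planes and [A] is the solution on a neighbouring
    interval; only the factors [E], [E'] of the half circles survive. *)
Lemma conj_cancel (P A E E' c c' : S) : P \is a GRing.unit -> A \is a GRing.unit ->
  E \is a GRing.unit -> c \is a GRing.unit -> c' \is a GRing.unit ->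
  (P * c) * (A * (E * c))^-1 * (A * (E' * c')) * (P * c')^-1 = P * (E^-1 * E') * P^-1.
Proof.
move=> Pu Au Eu cu c'u; have Ecu : E * c \is a GRing.unit by rewrite unitrMl.
rewrite !invrM //; rewrite -!mulrA; congr (P * _).
by rewrite (mulKr Au) (mulVKr cu) (mulVKr c'u).
Qed.

(** The exponents 1/2 and -1/2 of the two half-planes combine to a full exponential. The loop around
    1 is naturally expressed through [Psi1], hence the conjugation by [Phi]; the base change
    [Psi0 p] is common to both loops. *)
Lemma KZ_monodromy (p : R) : 0 < p < 1 -> exists2 G : S, G \is a GRing.unit &
  KZsol (-1) p%:C * (KZsol (-1) (- p)%:C)^-1 * KZsol 1 (- p)%:C * (KZsol 1 p%:C)^-1 =
    G * ncexp (varx R) * G^-1 /\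
  KZsol 1 p%:C * (KZsol 1 (2 - p)%:C)^-1 * KZsol (-1) (2 - p)%:C * (KZsol (-1) p%:C)^-1 =
    G * (Phi^-1 * ncexp (vary R) * Phi) * G^-1.
Proof.
move=> hp; exists (Psi0 p); first exact: unit0.
have [C0 [C1 [C2 [hC e01 e12 _]]]] := @KZ_connection 1 (or_introl erefl).
have [D0 [D1 [D2 [hD d01 d12 _]]]] := @KZ_connection (-1) (or_intror erefl).
have [p1 _ _] := hC p hp; have [q1 _ _] := hD p hp.
have C1u : C1 \is a GRing.unit.
  by rewrite -(unitrMr _ (unit0 hp)) -p1 KZsol_unit.
have D1u : D1 \is a GRing.unit.
  by rewrite -(unitrMr _ (unit0 hp)) -q1 KZsol_unit.
have p0 : 0 < p by case/andP: hp.
have lu (u : bool -> R[i]) : lexp u \is a GRing.unit by apply: ncunit1; rewrite lexp_nil.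
have pc := pchar_complex R.
split.
  pose t := p / (1 + p).
  have ht : 0 < t < 1.
    by rewrite /t divr_gt0 ?addr_gt0 //= ltr_pdivrMr ?addr_gt0 // mul1r ltrDr.
  have tE : t / (t - 1) = - p.
    have n1 : 1 + p != 0 by rewrite gt_eqF // addr_gt0.
    rewrite /t; field; rewrite n1 /=; have -> : p + -1 * (1 + p) = -1 by ring.
    by rewrite oppr_eq0 oner_eq0.
  have [_ p2 _] := hC t ht; have [_ q2 _] := hD t ht; rewrite tE e01 in p2; rewrite tE d01 in q2.
  rewrite p1 q1 p2 q2 conj_cancel ?lu ?unit0 //; last by apply: subst_unit; exact: unit0.
  congr (_ * _ * _); apply: (canLR (mulKr (lu _))).
  rewrite lform_var ncexp_lform.
  rewrite [X in _ = _ * X](eq_lexp (v := fun a => 1 * ux a)); last by move=> a; rewrite mul1r.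
  rewrite lexpD //; apply: eq_lexp => a; congr (_ * _).
  by apply/eqP; rewrite eq_complex /= ?addr0 eqxx andbT; apply/eqP; field.
pose t := (1 - p) / (2 - p).
have p2p : 0 < 2 - p by lra.
have ht : 0 < t < 1.
  by rewrite /t divr_gt0 //=; [rewrite ltr_pdivrMr //; lra|lra].
have tE : (1 - t)^-1 = 2 - p.
  have -> : 1 - t = (2 - p)^-1 by rewrite /t; field; rewrite gt_eqF.
  by rewrite invrK.
have [_ _ p2] := hC t ht; have [_ _ q2] := hD t ht; rewrite tE e12 mulrA in p2; rewrite tE d12 mulrA in q2.
rewrite -[ncsubst _ _ * lexp _ * _]mulrA [lexp _ * (Phi * C1)]mulrA in p2.
rewrite -[ncsubst _ _ * lexp _ * _]mulrA [lexp _ * (Phi * D1)]mulrA in q2.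
rewrite p1 q1 p2 q2 conj_cancel ?unit0 //; last 2 first.
  by apply: subst_unit; exact: unit0.
  by rewrite unitrMl ?lu // Phi_unit.
congr (_ * _ * _); apply: (canLR (mulKr _)); first by rewrite unitrMl ?lu // Phi_unit.
rewrite -!mulrA (mulVKr Phi_unit) mulrA; congr (_ * _).
rewrite lform_var ncexp_lform.
rewrite [X in _ = _ * X](eq_lexp (v := fun a => 1 * uy a)); last by move=> a; rewrite mul1r.
rewrite lexpD //; apply: eq_lexp => a; congr (_ * _).
by apply/eqP; rewrite eq_complex /= ?addr0 eqxx andbT; apply/eqP; field.
Qed.

Lemma subst2E (F : S) (b : bool) :
  subst2 F (if b then vary R else varx R) (- varx R - vary R) =
  ncsubst (fun a => lform (if b then mob2 a else mob0 a)) F.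
Proof.
rewrite /subst2; congr (ncsubst _ F); apply/funext => a.
rewrite !lform_var !lformN lformD.
by case: a; case: b; rewrite /mob0 /mob2 ?lform_var; congr lform; apply/funext => -[];
  rewrite /= ?oppr0 ?addr0 ?add0r.
Qed.

(* The hexagon relation for the lower half-plane. *)
Lemma KV_conj : exists2 h : S, h \is a GRing.unit &
  ncexp (KV_x Phi) = h * ncexp (varx R) * h^-1 /\
  ncexp (KV_y Phi) = h * (Phi^-1 * ncexp (vary R) * Phi) * h^-1.
Proof.
have [D0 [D1 [D2 [hD d01 d12 hex]]]] := @KZ_connection (-1) (or_intror erefl).
have lu (u : bool -> R[i]) : lexp u \is a GRing.unit by apply: ncunit1; rewrite lexp_nil.
have pc := pchar_complex R.
have h12 : 0 < (2^-1 : R) < 1 by apply/andP; split; lra.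
have D1u : D1 \is a GRing.unit.
  by have [q1 _ _] := hD _ h12; rewrite -(unitrMr _ (unit0 h12)) -q1 KZsol_unit.
pose A := ncsubst (fun a => lform (mob0 a)) Phi.
pose B := ncsubst (fun a => lform (mob2 a)) Phi.
have Au : A \is a GRing.unit by apply: subst_unit; exact: Phi_unit.
have Bu : B \is a GRing.unit by apply: subst_unit; exact: Phi_unit.
pose X := lexp (fun a => (-1 / 2)%:C * ux a).
pose Y := lexp (fun a => (- -1 / 2)%:C * uy a).
pose Z := lexp (fun a => (-1 / 2)%:C * uz a).
have {}hex : B * Y * Phi = Z * A * X.
  by apply: (mulIr D1u); rewrite -!mulrA -d01 -d12; exact: hex.
have xE : ncexp (varx R) = lexp ux by rewrite lform_var ncexp_lform.
have yE : ncexp (vary R) = lexp uy by rewrite lform_var ncexp_lform.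
have comm (c : R[i]) (u : bool -> R[i]) :
    lexp (fun a => c * u a) * lexp u = lexp u * lexp (fun a => c * u a).
  have -> : lexp u = lexp (fun a => 1 * u a) by apply: eq_lexp => a; rewrite mul1r.
  by rewrite !lexpD // [c + 1]addrC.
have zE : ncexp (2^-1 *: (varx R + vary R)) = Z.
  rewrite !lform_var lformD lformZ ncexp_lform; apply: eq_lexp => a.
  rewrite /uz mulrN1 -rmorphN /=.
  have -> : (- (-1 / 2))%:C = 2^-1 :> R[i].
    by rewrite mulNr opprK div1r fmorphV /= rmorph_nat.
  by case: a; rewrite /= ?addr0 ?add0r mulr1.
have Zu : Z \is a GRing.unit by exact: lu.
have Xu : X \is a GRing.unit by exact: lu.
have Yu : Y \is a GRing.unit by exact: lu.
have zNE : ncexp (- (2^-1 *: (varx R + vary R))) = Z^-1.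
  apply: (mulrI Zu); rewrite (mulrV Zu).
  rewrite -zE !lform_var lformD lformZ lformN !ncexp_lform.
  exact: lexpVr.
have x0 : varx R [::] = 0 by [].
have y0 : vary R [::] = 0 by [].
have AXu : A * X \is a GRing.unit by rewrite (unitrMl _ Xu).
have ZBu : Z^-1 * B \is a GRing.unit by rewrite (unitrMl _ Bu) unitrV.
have BYu : B * Y \is a GRing.unit by rewrite (unitrMl _ Yu).
(* [X] commutes with e^x, so on it conjugation by A X is conjugation by [A]. The hexagon relation
   gives A X = Z^-1 B Y Phi, and [Y] commutes with e^y: the same element serves the second
   generator, with Z^-1 as the factor e^{-(x+y)/2} of [KV_y]. *)
exists (A * X); [exact: AXu|split].
  rewrite /KV_x (subst2E Phi false) -/A (ncexp_conj x0 Au) xE (invrM Au Xu) -!mulrA.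
  congr (A * _); rewrite [RHS]mulrA comm -[RHS]mulrA (mulVKr Xu); reflexivity.
have hE : A * X = Z^-1 * B * Y * Phi by rewrite -!mulrA [B * (Y * _)]mulrA hex -!mulrA (mulKr Zu).
rewrite /KV_y (subst2E Phi true) -/B zNE zE.
have -> : Z^-1 * B * vary R * B^-1 * Z = (Z^-1 * B) * vary R * (Z^-1 * B)^-1.
  by rewrite [(Z^-1 * B)^-1]invrM ?unitrV // invrK !mulrA.
rewrite (ncexp_conj y0 ZBu) yE hE.
have Lu : Z^-1 * B * Y \is a GRing.unit by rewrite (unitrMl _ Yu).
rewrite (invrM Lu Phi_unit) (invrM ZBu Yu) -!mulrA; do 2 congr (_ * _).
by rewrite (mulVKr Phi_unit) (mulVKr Phi_unit) [RHS]mulrA comm -[RHS]mulrA (mulVKr Yu).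
Qed.

End Pieces.
End KZSolutions.

(** * Holonomy of the two circles *)

Lemma conj_conj (U : unitRingType) (g h x : U) :
  g \is a GRing.unit -> h \is a GRing.unit ->
  g * x * g^-1 = (h * g^-1)^-1 * (h * x * h^-1) * (h * g^-1).
Proof.
move=> gu hu; rewrite invrM ?unitrV // invrK -!mulrA; congr (_ * _).
by rewrite (mulKr hu) (mulKr hu).
Qed.

Section Circles.
Variable R : realType.
Local Notation S := (TH1 R).

Lemma KZ_associator_conj (Phi : S) (p : R) : KZ_associator Phi -> 0 < p < 1 ->
  exists2 g : S, g \is a GRing.unit &
  KZsol (-1) p%:C * (KZsol (-1) (- p)%:C)^-1 * KZsol 1 (- p)%:C * (KZsol 1 p%:C)^-1 =
    g^-1 * ncexp (KV_x Phi) * g /\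
  KZsol 1 p%:C * (KZsol 1 (2 - p)%:C)^-1 * KZsol (-1) (2 - p)%:C * (KZsol (-1) p%:C)^-1 =
    g^-1 * ncexp (KV_y Phi) * g.
Proof.
move=> [Psi0 [Psi1 [k0 k1 [H0 a0 e0] [H1 a1 e1] eP]]] hp.
have [G Gu [-> ->]] := KZ_monodromy k0 k1 a0 a1 e0 e1 eP hp.
have [h hu [-> ->]] := KV_conj k0 k1 a0 a1 e0 e1 eP.
have Giu : G^-1 \is a GRing.unit by rewrite unitrV.
exists (h * G^-1); first by rewrite (unitrMl _ Giu).
by split; apply: conj_conj.
Qed.

Lemma C1_circle a (p : R) : C1 (circle a p).
Proof.
pose k : R := p - puncture R a.
have lin (t : R) : is_derive t 1 (fun t : R => 2 * pi * t) (2 * pi : R).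
  by apply: is_derive_eq; rewrite /GRing.scale /= mulr1.
have dr (t : R) : is_derive t 1 (fun t : R => puncture R a + k * cos (2 * pi * t))
    (k * (- sin (2 * pi * t) * (2 * pi))).
  have h := @is_derive1_comp R cos (fun t => 2 * pi * t) t _ _ (is_derive_cos _) (lin t).
  apply: is_derive_eq (is_deriveD (is_derive_cst _ _ _) (is_deriveZ k h)) _.
  by rewrite add0r.
have di (t : R) : is_derive t 1 (fun t : R => k * sin (2 * pi * t))
    (k * (cos (2 * pi * t) * (2 * pi))).
  have h := @is_derive1_comp R sin (fun t => 2 * pi * t) t _ _ (is_derive_sin _) (lin t).
  exact: (is_deriveZ k h).
have Er : (fun t => complex.Re (circle a p t)) = fun t => puncture R a + k * cos (2 * pi * t).
  by apply/funext => t; rewrite circleE.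
have Ei : (fun t => complex.Im (circle a p t)) = fun t => k * sin (2 * pi * t).
  by apply/funext => t; rewrite circleE.
have cl : continuous (fun t : R => 2 * pi * t).
  by move=> t; apply: cvgM; [exact: cvg_cst|exact: cvg_id].
split; rewrite ?Er ?Ei.
- by move=> t; have [] := dr t.
- by move=> t; have [] := di t.
- have -> : derive1 (fun t => puncture R a + k * cos (2 * pi * t)) =
      fun t => k * (- sin (2 * pi * t) * (2 * pi)).
    by apply/funext => t; rewrite derive1E; have [_ ->] := dr t.
  move=> t; apply: cvgM; first exact: cvg_cst.
  apply: cvgM; last exact: cvg_cst.
  by apply: cvgN; exact: (continuous_comp (cl t) (@continuous_sin R _)).
have -> : derive1 (fun t => k * sin (2 * pi * t)) = fun t => k * (cos (2 * pi * t) * (2 * pi)).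
  by apply/funext => t; rewrite derive1E; have [_ ->] := di t.
move=> t; apply: cvgM; first exact: cvg_cst.
apply: cvgM; last exact: cvg_cst.
exact: (continuous_comp (cl t) (@continuous_cos R _)).
Qed.

Lemma piecewise_C1_circle a (p : R) : piecewise_C1 (circle a p).
Proof.
exists [:: 1]; split=> //=; first by rewrite ltr01.
by case=> // _; exists (circle a p) => //; exact: C1_circle.
Qed.

Lemma sin_first_half (t : R) : 0 <= t <= 2^-1 -> 0 <= sin (2 * pi * t).
Proof.
move=> /andP[t0 t1]; apply: sin_ge0_pi; have := pi_ge0 R; move=> pi0.
by apply/andP; split; nra.
Qed.

Lemma sin_second_half (t : R) : 2^-1 <= t <= 1 -> sin (2 * pi * t) <= 0.
Proof.
move=> ht; have -> : 2 * pi * t = 2 * pi * (t - 2^-1) + pi :> R by field.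
by rewrite sinDpi oppr_le0; apply: sin_first_half; lra.
Qed.

Lemma circle_half a (p : R) : circle a p 2^-1 = (2 * puncture R a - p)%:C.
Proof.
rewrite circleE; have -> : 2 * pi * 2^-1 = pi :> R by field.
by rewrite cospi sinpi mulr0; congr (_ +i* _); ring.
Qed.

Lemma circle_ends a (p : R) : circle a p 0 = p%:C /\ circle a p 1 = p%:C.
Proof.
rewrite !circleE mulr0 mulr1 cos0 sin0 mulr_natl cos2pi sin2pi !mulr0 !mulr1.
by rewrite addrC subrK.
Qed.

Lemma Hol_circle0 (p : R) : 0 < p < 1 -> Hol (circle false p) =
  KZsol (-1) p%:C * (KZsol (-1) (- p)%:C)^-1 * KZsol 1 (- p)%:C * (KZsol 1 p%:C)^-1.
Proof.
move=> hp; have p0 : 0 < p by case/andP: hp.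
have zS t : 0 <= t <= 1 -> Sigma (circle false p t) by move=> _; exact: circle_Sigma.
have zC := piecewise_C1_circle false p.
have h2 : (0 : R) <= 2^-1 by rewrite invr_ge0.
have h21 : (2^-1 : R) <= 1 by lra.
have [c0 c1] := circle_ends false p; have ch := circle_half false p.
rewrite /puncture mulr0 sub0r in ch.
have T1 := iterint_transport zS zC (c := 1) (lexx 0) h2 h21 _.
have T2 := iterint_transport zS zC (c := -1) h2 h21 (lexx 1) _.
rewrite /Hol T2; last first.
  move=> t ht; apply: slit_dom_half; rewrite ?oppr_eq0 ?oner_eq0 //; first exact: circle_Sigma.
  rewrite circleE /= /puncture /= subr0 mulN1r oppr_ge0.
  by apply: mulr_ge0_le0; [exact: ltW|exact: sin_second_half].
rewrite T1; last first.
  move=> t ht; apply: slit_dom_half; rewrite ?oner_eq0 //; first exact: circle_Sigma.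
  rewrite circleE /= /puncture /= subr0 mul1r.
  by apply: mulr_ge0; [exact: ltW|exact: sin_first_half].
by rewrite (iterint0 (circle false p)) mulr1 c0 c1 ch !mulrA.
Qed.

(** As p < 1 the circle starts at its leftmost point, so its first half lies below the real axis,
    contrary to the circle around 0. *)
Lemma Hol_circle1 (p : R) : 0 < p < 1 -> Hol (circle true p) =
  KZsol 1 p%:C * (KZsol 1 (2 - p)%:C)^-1 * KZsol (-1) (2 - p)%:C * (KZsol (-1) p%:C)^-1.
Proof.
move=> hp; have p1 : p - 1 <= 0 by case/andP: hp => _ h; rewrite subr_le0 ltW.
have zS t : 0 <= t <= 1 -> Sigma (circle true p t) by move=> _; exact: circle_Sigma.
have zC := piecewise_C1_circle true p.
have h2 : (0 : R) <= 2^-1 by rewrite invr_ge0.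
have h21 : (2^-1 : R) <= 1 by lra.
have [c0 c1] := circle_ends true p; have ch := circle_half true p.
rewrite /puncture mulr1 in ch.
have T1 := iterint_transport zS zC (c := -1) (lexx 0) h2 h21 _.
have T2 := iterint_transport zS zC (c := 1) h2 h21 (lexx 1) _.
rewrite /Hol T2; last first.
  move=> t ht; apply: slit_dom_half; rewrite ?oner_eq0 //; first exact: circle_Sigma.
  rewrite circleE /= /puncture /= mul1r.
  by apply: mulr_le0; [exact: p1|exact: sin_second_half].
rewrite T1; last first.
  move=> t ht; apply: slit_dom_half; rewrite ?oppr_eq0 ?oner_eq0 //; first exact: circle_Sigma.
  rewrite circleE /= /puncture /= mulN1r oppr_ge0.
  by apply: mulr_le0_ge0; [exact: p1|exact: sin_first_half].
by rewrite (iterint0 (circle true p)) mulr1 c0 c1 ch !mulrA.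
Qed.

End Circles.

(** * Parallel transport along subdivided paths *)

(* Five convex open sets covering the twice punctured plane. *)
Variant patch := Upper | Lower | Middle | Leftmost | Rightmost.

Section Patches.
Variable R : realType.
Local Notation S := (TH1 R).
Implicit Types (D : patch) (z q : R[i]).

Definition patch_set D : set R[i] := [set z |
  match D with
  | Upper => 0 < complex.Im z
  | Lower => complex.Im z < 0
  | Middle => 0 < complex.Re z < 1
  | Leftmost => 2 * complex.Re z + `|complex.Im z| < 0
  | Rightmost => `|complex.Im z| < 2 * (complex.Re z - 1)
  end].

(** The sign of a slit domain that contains the patch; the strip and the two sectors lie in both
    domains, and -1 is a convention for them. *)
Definition patch_sign D : R := if D is Upper then 1 else -1.

Lemma patch_Sigma D z : patch_set D z -> Sigma z.
Proof.
by case: z => a b; case: D => /= h; split; apply/eqP => -[ha hb]; move: h;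
  rewrite ?ha ?hb ?normr0 => h; lra.
Qed.

Lemma patch_slit D z : patch_set D z -> slit_dom (patch_sign D) z.
Proof.
move=> Dz; have Sz := patch_Sigma Dz; case: D Dz => /= h.
- by apply: slit_dom_half; rewrite ?oner_eq0 // mul1r ltW.
- by apply: slit_dom_half; rewrite ?oppr_eq0 ?oner_eq0 // mulN1r oppr_ge0 ltW.
- exact: slit_dom_strip.
- by apply: slit_dom_left => //; right.
by apply: slit_dom_right => //; right.
Qed.

Lemma patch_cover z : Sigma z -> exists D, patch_set D z.
Proof.
case: z => a b [/eqP h0 /eqP h1].
have [b0|b0|b0] := ltgtP b 0; [by exists Lower|by exists Upper|].
have [a0|a0|a0] := ltgtP a 0; first by exists Leftmost => /=; rewrite b0 normr0; lra.
  have [a1|a1|a1] := ltgtP a 1; first by exists Middle => /=; rewrite a0.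
    by exists Rightmost => /=; rewrite b0 normr0; lra.
  by case: h1; rewrite a1 b0.
by case: h0; rewrite a0 b0.
Qed.

Lemma patch_convex D z w (r : R) : patch_set D z -> patch_set D w -> 0 <= r <= 1 ->
  patch_set D (z + r%:C * (w - z)).
Proof.
have conv (x y : R) : 0 < x -> 0 < y -> 0 <= r <= 1 -> 0 < x + r * (y - x).
  move=> x0 y0 /andP[r0 r1]; have [->|rn] := eqVneq r 0; first by rewrite mul0r addr0.
  have {rn}r0' : 0 < r by rewrite lt_neqAle eq_sym rn.
  by have := mulr_gt0 r0' y0; nra.
have nrm (x y : R) : 0 <= r <= 1 -> `|x + r * (y - x)| <= (1 - r) * `|x| + r * `|y|.
  move=> /andP[r0 r1]; have := ler_normD ((1 - r) * x) (r * y).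
  rewrite !normrM (ger0_norm r0) ger0_norm ?subr_ge0 //.
  by have -> : (1 - r) * x + r * y = x + r * (y - x) by ring.
case: z => a b; case: w => c d; case: D => /= hz hw hr; rewrite ?mul0r ?subr0 ?addr0.
- exact: conv.
- have := conv (- b) (- d); rewrite !oppr_gt0 => /(_ hz hw hr); lra.
- move: hz hw => /andP[h1 h2] /andP[h3 h4]; apply/andP; split; first exact: conv.
  by have := conv (1 - a) (1 - c); rewrite !subr_gt0 => /(_ h2 h4 hr); lra.
- have := conv (- (2 * a + `|b|)) (- (2 * c + `|d|)); rewrite !oppr_gt0 => /(_ hz hw hr).
  by have := nrm b d hr; lra.
have := conv (2 * (a - 1) - `|b|) (2 * (c - 1) - `|d|); rewrite !subr_gt0 => /(_ hz hw hr).
by have := nrm b d hr; lra.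
Qed.

Lemma patch_open D z : patch_set D z -> exists2 d, 0 < d &
  forall w, l1norm (w - z) < d -> patch_set D w.
Proof.
have tri (x y : R) : `|x| <= `|y| + `|x - y|.
  by have := ler_normD y (x - y); rewrite addrC subrK.
case: z => a b; case: D => /= h.
- exists b => // -[c d]; rewrite /l1norm /= => hw.
  by have := ler_norm (- (d - b)); have := normr_ge0 (c - a); rewrite normrN; lra.
- exists (- b); first by rewrite oppr_gt0.
  move=> [c d]; rewrite /l1norm /= => hw.
  by have := ler_norm (d - b); have := normr_ge0 (c - a); lra.
- move: h => /andP[h1 h2]; exists (Num.min a (1 - a)); first by rewrite lt_min h1 subr_gt0.
  move=> [c d]; rewrite /l1norm /= lt_min => /andP[k1 k2].
  have := ler_norm (c - a); have := ler_norm (- (c - a)); have := normr_ge0 (d - b).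
  by rewrite normrN => *; apply/andP; split; lra.
- exists (- (2 * a + `|b|) / 2); first by rewrite divr_gt0 // oppr_gt0.
  move=> [c d]; rewrite /l1norm /= => hw; have := tri d b.
  by have := ler_norm (c - a); have := normr_ge0 (d - b); lra.
exists ((2 * (a - 1) - `|b|) / 2); first by rewrite divr_gt0 // subr_gt0.
move=> [c d]; rewrite /l1norm /= => hw; have := tri d b.
by have := ler_norm (- (c - a)); have := normr_ge0 (d - b); rewrite normrN; lra.
Qed.

Definition transport D q q' : S :=
  KZsol (patch_sign D) q' * (KZsol (patch_sign D) q)^-1.

Lemma transport_refl D q : transport D q q = 1.
Proof. by rewrite /transport mulrV ?KZsol_unit. Qed.

Lemma transport_comp D q q' q'' :
  transport D q' q'' * transport D q q' = transport D q q''.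
Proof.
by rewrite /transport -mulrA (mulKr (KZsol_unit _ _)).
Qed.

(** The segment from [q] to [q'] lies in both convex patches, and either transport is given by the
    equation along this segment. *)
Lemma transport_agree D D' q q' : patch_set D q -> patch_set D q' ->
  patch_set D' q -> patch_set D' q' -> transport D q q' = transport D' q q'.
Proof.
move=> Dq Dq' D'q D'q'; pose y (t : R) := q + t%:C * (q' - q).
have dy t : has_cderiv y t (q' - q).
  apply: has_cderiv_eq (has_cderivD (has_cderiv_cst q t)
    (has_cderivMr (q' - q) (has_cderiv_id t))) _.
  by rewrite add0r mul1r.
have y0 : y 0 = q by rewrite /y mul0r addr0.
have y1 : y 1 = q' by rewrite /y mul1r addrC subrK.
have cy : ccont_within 0 1 y by apply: ccont_withinW => t _; exact: has_cderiv_cont (dy t).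
have U E : patch_set E q -> patch_set E q' -> forall t, 0 <= t <= 1 ->
    slit_dom (patch_sign E) (y t).
  by move=> Eq Eq' t ht; apply: patch_slit; exact: patch_convex.
have sol E : patch_set E q -> patch_set E q' -> forall t, 0 < t < 1 -> t \notin [::] ->
    ncderiv (fun t => KZsol (patch_sign E) (y t)) t
      (lform (KZform (y t) (q' - q)) * KZsol (patch_sign E) (y t)).
  move=> Eq Eq' t /andP[t0 t1] _; apply: KZsol_deriv (dy t).
  by apply: U => //; rewrite !ltW.
have := ode_transport (X := [::]) (al := fun t => KZform (y t) (q' - q))
  (V := fun t => KZsol (patch_sign D') (y t)) (Y := fun t => KZsol (patch_sign D) (y t))
  ler01 (KZsol_cont (U D' D'q D'q') cy) (KZsol_cont (U D Dq Dq') cy)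
  (sol D' D'q D'q') (sol D Dq Dq') (KZsol_unit _ _).
by rewrite y0 y1 /transport => ->; rewrite mulrK ?KZsol_unit.
Qed.

(** Only the values of [f] at the nodes k / N enter, so this makes sense along merely continuous
    paths such as the rows of a homotopy. *)
Fixpoint path_transport (f : R -> R[i]) (N : nat) (D : nat -> patch) (k : nat) : S :=
  if k is k'.+1 then
    transport (D k') (f (k'%:R / N%:R)) (f (k%:R / N%:R)) * path_transport f N D k'
  else 1.

Lemma path_transport0 f N (D : nat -> patch) : path_transport f N D 0 = 1.
Proof. by []. Qed.

Lemma path_transportS f N (D : nat -> patch) k : path_transport f N D k.+1 =
  transport (D k) (f (k%:R / N%:R)) (f (k.+1%:R / N%:R)) * path_transport f N D k.
Proof. by []. Qed.

Definition subdivided (f : R -> R[i]) N (D : nat -> patch) :=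
  forall i, (i < N)%N -> forall t, i%:R / N%:R <= t <= i.+1%:R / N%:R -> patch_set (D i) (f t).

Let grid_le N i : (0 < N)%N -> (i%:R / N%:R : R) <= i.+1%:R / N%:R.
Proof. by move=> N0; rewrite ler_pM2r ?invr_gt0 ?ltr0n // ler_nat. Qed.

Let grid01 N i : (0 < N)%N -> (i <= N)%N -> 0 <= (i%:R / N%:R : R) <= 1.
Proof.
move=> N0 iN; rewrite divr_ge0 ?ler0n //= ler_pdivrMr ?ltr0n // mul1r ler_nat //.
Qed.

Lemma path_transport_iterint (z : R -> R[i]) N (D : nat -> patch) k : (0 < N)%N ->
  (forall t, 0 <= t <= 1 -> Sigma (z t)) -> piecewise_C1 z -> subdivided z N D -> (k <= N)%N ->
  ((fun w => iterint z w (k%:R / N%:R)) : S) = path_transport z N D k.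
Proof.
move=> N0 zS zC zD; elim: k => [|k IH] kN.
  by rewrite mul0r; exact: iterint0.
have /andP[k0 _] := grid01 N0 (ltnW kN); have /andP[_ k1] := grid01 N0 kN.
rewrite path_transportS -(IH (ltnW kN)).
apply: (iterint_transport zS zC k0 (grid_le k N0) k1) => t ht.
by apply: patch_slit; exact: zD.
Qed.

Lemma Hol_path_transport (z : R -> R[i]) N (D : nat -> patch) : (0 < N)%N ->
  (forall t, 0 <= t <= 1 -> Sigma (z t)) -> piecewise_C1 z -> subdivided z N D ->
  Hol z = path_transport z N D N.
Proof.
move=> N0 zS zC zD; rewrite -(path_transport_iterint N0 zS zC zD (leqnn N)).
by rewrite divff // pnatr_eq0 -lt0n.
Qed.

Let subdivided_ends f N (D : nat -> patch) i : (0 < N)%N -> subdivided f N D -> (i < N)%N ->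
  patch_set (D i) (f (i%:R / N%:R)) /\ patch_set (D i) (f (i.+1%:R / N%:R)).
Proof. by move=> N0 fD iN; split; apply: fD => //; rewrite ?lexx ?grid_le. Qed.

Lemma path_transport_word f N (D D' : nat -> patch) k : (0 < N)%N -> subdivided f N D -> subdivided f N D' ->
  (k <= N)%N -> path_transport f N D k = path_transport f N D' k.
Proof.
move=> N0 fD fD'; elim: k => [//|k IH] kN; rewrite !path_transportS (IH (ltnW kN)).
have [h1 h2] := subdivided_ends N0 fD kN; have [h3 h4] := subdivided_ends N0 fD' kN.
by rewrite (transport_agree h1 h2 h3 h4).
Qed.

(** A ladder: the rung between [f] and [g] at a node lies in the patches before and after it, so
    [transport_agree] carries it from one square to the next. At both ends the rung is trivial. *)
Lemma path_transport_square f g N (D : nat -> patch) : (0 < N)%N -> subdivided f N D -> subdivided g N D ->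
  f 0 = g 0 -> f 1 = g 1 -> path_transport f N D N = path_transport g N D N.
Proof.
move=> N0 fD gD fg0 fg1.
suff H k : (k < N)%N -> path_transport g N D k.+1 =
    transport (D k) (f (k.+1%:R / N%:R)) (g (k.+1%:R / N%:R)) * path_transport f N D k.+1.
  case: N N0 fD gD H => // N _ _ _ /(_ N (ltnSn N)) ->.
  by rewrite divff ?pnatr_eq0 // fg1 transport_refl mul1r.
elim: k => [|k IH] kN.
  by rewrite !path_transportS !path_transport0 !mulr1 mul0r fg0 transport_comp.
rewrite [LHS]path_transportS [in RHS]path_transportS (IH (ltnW kN)).
have [_ a2] := subdivided_ends N0 fD (ltnW kN); have [_ b2] := subdivided_ends N0 gD (ltnW kN).
have [a3 _] := subdivided_ends N0 fD kN; have [b3 _] := subdivided_ends N0 gD kN.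
rewrite (transport_agree a2 b2 a3 b3) [LHS]mulrA [RHS]mulrA.
by rewrite !transport_comp.
Qed.

End Patches.

(** * Homotopy invariance and multiplicativity of the holonomy *)

Section PiecewiseC1.
Variable R : realType.
Implicit Types (z g : R -> R[i]).

(** The recursive form of [piecewise_C1], suited to concatenation and affine changes of time. *)
Fixpoint pieces z (a : R) (s : seq R) : Prop :=
  if s is b :: s' then
    [/\ a < b, exists2 g, C1 g & forall t, a <= t <= b -> z t = g t & pieces z b s']
  else True.

Lemma piecesP z : piecewise_C1 z <-> exists2 s, last 0 s = 1 & pieces z 0 s.
Proof.
have H (a : R) s : (path <%R a s /\ forall i, (i < size s)%N -> exists2 g, C1 g &
      forall t, nth 0 (a :: s) i <= t <= nth 0 s i -> z t = g t) <-> pieces z a s.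
  elim: s a => [|b s IH] a /=; first by split=> // _; split.
  split=> [[/andP[ab bs] h]|[ab [g gC zg] /IH[bs h]]].
    split=> //; first by have [g gC zg] := h 0%N isT; exists g.
    by apply/IH; split=> // i hi; exact: (h i.+1).
  split; first by rewrite ab.
  by case=> [_|i hi]; [exists g|exact: h].
split=> [[s [h1 h2 h3]]|[s h2 /H[h1 h3]]]; exists s => //.
by apply/H.
Qed.

Lemma pieces_cat z a s s' : pieces z a s -> pieces z (last a s) s' -> pieces z a (s ++ s').
Proof. by elim: s a => //= b s IH a [ab hg bs] h; split=> //; exact: IH. Qed.

Lemma C1_affine g (c d : R) : C1 g -> C1 (fun t => g (c * t + d)).
Proof.
move=> [d1 d2 c1 c2].
have lin (t : R) : is_derive t 1 (fun t : R => c * t + d) c.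
  by apply: is_derive_eq; rewrite /GRing.scale /= mulr1 addr0.
have cl : continuous (fun t : R => c * t + d).
  by move=> t; apply: cvgD; [apply: cvgM; [exact: cvg_cst|exact: cvg_id]|exact: cvg_cst].
have aux (f : R -> R) : (forall t, derivable f t 1) -> continuous (derive1 f) ->
    (forall t, derivable (fun t => f (c * t + d)) t 1) /\
    continuous (derive1 (fun t => f (c * t + d))).
  move=> df cf.
  have h (t : R) : is_derive t 1 (fun t => f (c * t + d)) (derive1 f (c * t + d) * c).
    apply: (@is_derive1_comp R f (fun t => c * t + d) t _ _ _ (lin t)).
    by apply: (DeriveDef (df _)); rewrite derive1E.
  split; first by move=> t; have [] := h t.
  have -> : derive1 (fun t => f (c * t + d)) = fun t => derive1 f (c * t + d) * c.
    by apply/funext => t; rewrite derive1E; have [_ ->] := h t.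
  move=> t; apply: cvgM; last exact: cvg_cst.
  exact: (continuous_comp (cl t) (cf _)).
have [a1 a2] := aux _ d1 c1; have [b1 b2] := aux _ d2 c2.
by split.
Qed.

Lemma pieces_affine z z' (c d a : R) s : 0 < c ->
  (forall t, a <= c * t + d <= last a s -> z' t = z (c * t + d)) -> pieces z a s ->
  pieces z' ((a - d) / c) [seq (x - d) / c | x <- s].
Proof.
move=> c0; elim: s a => //= b s IH a zz' [ab [g gC zg] bs].
have bl : b <= last b s.
  elim: s b bs {IH zz' zg ab} => //= e s IHs b [be _ es].
  by rewrite (le_trans (ltW be)) // IHs.
split.
- by rewrite ltr_pM2r ?invr_gt0 // ltrD2r.
- exists (fun t => g (c * t + d)); first exact: C1_affine.
  move=> t; rewrite ler_pdivrMr // ler_pdivlMr // => /andP[h1 h2].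
  have ht : a <= c * t + d <= b by apply/andP; split; lra.
  by rewrite zz' ?zg // (andP ht).1 /= (le_trans (andP ht).2).
apply: IH => // t /andP[h1 h2]; apply: zz'.
by rewrite (le_trans (ltW ab) h1).
Qed.

End PiecewiseC1.

Section Homotopy.
Variables (R : realType) (x : Sigma (R := R)).
Local Notation S := (TH1 R).
Local Notation I := (`[0%R, 1%R]%classic : set R).
Implicit Types f g : loop R x.

Lemma nbhs_l1norm (z : R[i]) (d : R) : 0 < d -> nbhs z [set w | l1norm (w - z) < d].
Proof.
move=> d0; apply/nbhs_ballP; exists (d / 2)%:C; first by rewrite /= ltcR divr_gt0.
move=> w; rewrite /ball /= => /complex_norm_l1norm; rewrite l1normB.
by rewrite mulrCA divff ?pnatr_eq0 // mulr1.
Qed.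

Lemma near_within_l1norm (T : topologicalType) (A : set T) (f : T -> Sigma (R := R)) u e :
  {within A, continuous f} -> A u -> 0 < e ->
  \forall v \near u, A v -> l1norm (\val (f v) - \val (f u)) < e.
Proof.
move=> /subspace_continuousP cf Au e0.
have vc : continuous (fun y : Sigma (R := R) => \val y) by exact: initial_continuous.
have := vc (f u) _ (nbhs_l1norm (\val (f u)) e0).
by move=> /(cf u Au).
Qed.

Lemma lebesgue_number (H : R * R -> Sigma (R := R)) : {within I `*` I, continuous H} ->
  exists2 d, 0 < d & forall u, (I `*` I) u -> exists D, forall v, (I `*` I) v ->
    `|v.1 - u.1| <= d -> `|v.2 - u.2| <= d -> patch_set D (\val (H v)).
Proof.
move=> cH.
have /compact_near_coveringP K : compact (I `*` I).
  by apply: compact_setX; exact: segment_compact.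
have : \forall d \near (0 : R)^'+, I `*` I `<=` [set u | exists D, forall v, (I `*` I) v ->
    `|v.1 - u.1| <= d -> `|v.2 - u.2| <= d -> patch_set D (\val (H v))].
  apply: K => u Iu; have [D HD] := patch_cover (set_mem (valP (H u))).
  have [d d0 Hd] := patch_open HD.
  have /nbhs_ballP[e /= e0 He] := near_within_l1norm cH Iu d0.
  exists (ball u (e / 2), [set d' : R | 0 < d' < e / 2]); last first.
    move=> [u' d'] [/= [h1 h2] /andP[d'0 d'e]]; exists D => v Iv k1 k2.
    apply: Hd; apply: He => //; split.
      apply: (@ball_splitl _ _ u'.1); first exact: h1.
      by rewrite /ball /= (le_lt_trans k1).
    apply: (@ball_splitl _ _ u'.2); first exact: h2.
    by rewrite /ball /= (le_lt_trans k2).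
  split; first by apply: nbhsx_ballx; rewrite divr_gt0.
  near=> y; apply/andP; split; near: y; first exact: nbhs_right_gt.
  by apply: nbhs_right_lt; rewrite divr_gt0.
move=> [e /= e0 He]; exists (e / 2); first by rewrite divr_gt0.
move=> u Iu; apply: He => //=; rewrite ?divr_gt0 //.
by rewrite /ball /= sub0r normrN gtr0_norm ?divr_gt0 // ltr_pdivrMr // ltr_pMr // ltr1n.
Unshelve. all: by end_near.
Qed.

Let grid_unit N i (t : R) : (i < N)%N -> i%:R / N%:R <= t <= i.+1%:R / N%:R -> I t.
Proof.
move=> iN /andP[h1 h2]; have N0 : 0 < N%:R :> R by rewrite ltr0n (leq_ltn_trans _ iN).
rewrite /= in_itv /= (le_trans _ h1) ?divr_ge0 ?ler0n //= (le_trans h2) //.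
by rewrite ler_pdivrMr // mul1r ler_nat.
Qed.

Let grid_mem N i : (i < N)%N -> let node k : R := k%:R / N%:R in
  (node i <= node i <= node i.+1) /\ (node i <= node i.+1 <= node i.+1).
Proof.
move=> iN node; have N0 : 0 < N%:R :> R by rewrite ltr0n (leq_ltn_trans _ iN).
by rewrite !lexx /node ler_pM2r ?invr_gt0 // ler_nat leqnSn.
Qed.

Lemma grid_patches (H : R * R -> Sigma (R := R)) : {within I `*` I, continuous H} ->
  exists2 N, (0 < N)%N & exists D : nat -> nat -> patch,
    forall i, (i < N)%N -> forall s, i%:R / N%:R <= s <= i.+1%:R / N%:R ->
    subdivided (fun t => \val (H (s, t))) N (D i).
Proof.
(* 1 / N <= d, and each cell is compared with its corner (i / N, j / N), from which it extends by 1
   / N in either direction. *)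
move=> /lebesgue_number[d d0 Hd]; pose N := (Num.truncn d^-1).+1.
have N0 : (0 < N)%N by []; exists N => //.
have Nd : N%:R^-1 <= d.
  by rewrite -[d]invrK lef_pV2 ?posrE ?invr_gt0 ?ltr0n // ltW // truncnS_gt.
have /choice[D HD] : forall ij : nat * nat, exists D, (ij.1 < N)%N -> (ij.2 < N)%N -> forall s t : R,
    ij.1%:R / N%:R <= s <= ij.1.+1%:R / N%:R -> ij.2%:R / N%:R <= t <= ij.2.+1%:R / N%:R ->
    patch_set D (\val (H (s, t))).
  move=> [i j] /=; have [iN|_] := boolP (i < N)%N; last by exists Upper.
  have [jN|_] := boolP (j < N)%N; last by exists Upper.
  have Iu : (I `*` I) (i%:R / N%:R, j%:R / N%:R).
    by split; [apply: (grid_unit iN (grid_mem iN).1)|apply: (grid_unit jN (grid_mem jN).1)].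
  have [D HD] := Hd _ Iu; exists D => _ _ s t hs ht; apply: HD => /=.
  - by split; [exact: (grid_unit iN hs)|exact: (grid_unit jN ht)].
  - move: hs; rewrite -addn1 natrD mulrDl mul1r => hs.
    by rewrite ler_norml; apply/andP; split; lra.
  move: ht; rewrite -addn1 natrD mulrDl mul1r => ht.
  by rewrite ler_norml; apply/andP; split; lra.
by exists (fun i j => D (i, j)) => i iN s hs j jN t ht; exact: (HD (i, j)).
Qed.

Lemma loop_subdivided f : exists2 N, (0 < N)%N & exists D, subdivided (fun t => \val (f t)) N D.
Proof.
have c : {within I `*` I, continuous (fun u : R * R => f u.2)}.
  apply: within_comp_cont (@loop_cont _ _ _ f); first by move=> u; exact: cvg_snd.
  by move=> u [].
have [N N0 [D HD]] := grid_patches c; exists N => //; exists (D 0%N).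
by apply: (HD 0%N N0 0); rewrite mul0r lexx divr_ge0 ?ler0n.
Qed.

Let subdivided_eq (y z : R -> R[i]) N D : (forall t, I t -> y t = z t) ->
  subdivided y N D -> subdivided z N D.
Proof. by move=> yz h i iN t ht; rewrite -yz; [exact: h|exact: (grid_unit iN ht)]. Qed.

Let loop_Sigma f t : Sigma (\val (f t)). Proof. exact: (set_mem (valP (f t))). Qed.

(** Rows i and i + 1 of the grid follow the same word [D i], and row i + 1 also follows [D i.+1], so
    the transport passes from row to row. On the first and last rows, which are piecewise C^1, it is
    the holonomy. *)
Lemma Hol_homotopic f g : homotopic f g ->
  piecewise_C1 (fun t => \val (f t)) -> piecewise_C1 (fun t => \val (g t)) ->
  Hol (fun t => \val (f t)) = Hol (fun t => \val (g t)).
Proof.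
move=> [H [cH Hf Hg He]] fC gC; have [N N0 [D HD]] := grid_patches cH.
pose row i t := \val (H (i%:R / N%:R, t)).
have I0 : I 0 by rewrite /= in_itv /= lexx ler01.
have I1 : I 1 by rewrite /= in_itv /= lexx ler01.
have low i : (i < N)%N -> subdivided (row i) N (D i).
  by move=> iN; apply: (HD i iN); exact: (grid_mem iN).1.
have high i : (i < N)%N -> subdivided (row i.+1) N (D i).
  by move=> iN; apply: (HD i iN); exact: (grid_mem iN).2.
have ends i : (i <= N)%N -> row i 0 = \val x /\ row i 1 = \val x.
  move=> iN; rewrite /row; suff /He[-> ->] : I (i%:R / N%:R) by [].
  by rewrite /= in_itv /= divr_ge0 ?ler0n //= ler_pdivrMr ?ltr0n // mul1r ler_nat.
have step i : (i < N)%N -> path_transport (row i) N (D i) N = path_transport (row i.+1) N (D i) N.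
  move=> iN; have [a0 a1] := ends _ (ltnW iN); have [b0 b1] := ends _ iN.
  by apply: path_transport_square => //; rewrite ?a0 ?a1 ?b0 ?b1 //; [exact: low|exact: high].
have all i : (i < N)%N -> path_transport (row 0%N) N (D 0%N) N = path_transport (row i.+1) N (D i) N.
  elim: i => [|i IH] iN; first exact: step.
  rewrite (IH (ltnW iN)) -(step i.+1 iN).
  by apply: path_transport_word => //; [exact: high (ltnW iN)|exact: low].
have f0 t : I t -> row 0%N t = \val (f t) by move=> It; rewrite /row mul0r Hf.
have gN t : I t -> row N t = \val (g t).
  by move=> It; rewrite /row divff ?pnatr_eq0 -?lt0n // Hg.
have fD := subdivided_eq f0 (low 0%N N0).
case: N N0 => // N _ in row low high ends step all f0 gN fD HD *.
have gD := subdivided_eq gN (high N (ltnSn N)).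
rewrite (Hol_path_transport (ltn0Sn N) (fun t _ => loop_Sigma f t) fC fD).
rewrite (Hol_path_transport (ltn0Sn N) (fun t _ => loop_Sigma g t) gC gD).
have -> : path_transport (fun t => \val (f t)) N.+1 (D 0%N) N.+1 =
    path_transport (row 0%N) N.+1 (D 0%N) N.+1.
  by apply: path_transport_square => //; [exact: low|rewrite f0|rewrite f0].
rewrite (all N (ltnSn N)).
by apply: path_transport_square => //; [exact: high|rewrite gN|rewrite gN].
Qed.

Lemma subdivided_stretch (z : R -> R[i]) N (D : nat -> patch) k : (0 < k)%N ->
  subdivided z N D -> subdivided z (N * k) (fun i => D (i %/ k)%N).
Proof.
move=> k0 zD i iN t /andP[h1 h2].
have iN' : (i %/ k < N)%N by rewrite ltn_divLR.
have N0 : (0 < N)%N by exact: leq_ltn_trans iN'.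
have r0 (n : nat) : (0 < n)%N -> 0 < n%:R :> R by rewrite ltr0n.
apply: zD => //; rewrite natrM in h1 h2; apply/andP; split.
  apply: le_trans h1; rewrite ler_pdivrMr ?r0 // mulrAC ler_pdivlMr ?mulr_gt0 ?r0 //.
  by rewrite mulrCA [leRHS]mulrC ler_pM2l ?r0 // -natrM ler_nat leq_trunc_div.
apply: le_trans h2 _; rewrite ler_pdivrMr ?mulr_gt0 ?r0 // mulrA divfK ?gt_eqF ?r0 //.
by rewrite -natrM ler_nat ltn_ceil.
Qed.

Lemma cat_loopl f g (t : R) : t <= 2^-1 -> cat_loop f g t = f (2 * t).
Proof. by move=> h; rewrite /= /cat_fun h. Qed.

Lemma cat_loopr f g (t : R) : 2^-1 <= t -> cat_loop f g t = g (2 * t - 1).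
Proof.
move=> h; rewrite /= /cat_fun; case: leP => // h'.
have -> : t = 2^-1 by apply/eqP; rewrite eq_le h h'.
by rewrite divff ?pnatr_eq0 // subrr loop_end loop_start.
Qed.

Lemma piecewise_C1_cat f g : piecewise_C1 (fun t => \val (f t)) ->
  piecewise_C1 (fun t => \val (g t)) -> piecewise_C1 (fun t => \val (cat_loop f g t)).
Proof.
move=> /piecesP[s s1 fs] /piecesP[s' s1' gs]; apply/piecesP.
have last_map (c d a : R) (u : seq R) :
    last ((a - d) / c) [seq (y - d) / c | y <- u] = (last a u - d) / c.
  by rewrite (last_map (fun y => (y - d) / c)).
have two0 : 0 < 2 :> R by rewrite ltr0n.
exists ([seq (y - 0) / 2 | y <- s] ++ [seq (y + 1) / 2 | y <- s']).
  have := last_map 2 0 0 s; rewrite last_cat subr0 mul0r s1 subr0 => ->.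
  have := last_map 2 (-1) 0 s'; rewrite opprK add0r s1' => ->.
  by rewrite -mulr2n divff // pnatr_eq0.
have F := @pieces_affine R (fun t => \val (f t)) (fun t => \val (cat_loop f g t)) 2 0 0 s two0.
have G := @pieces_affine R (fun t => \val (g t)) (fun t => \val (cat_loop f g t)) 2 (-1) 0 s' two0.
apply: pieces_cat.
  have := F _ fs; rewrite subr0 mul0r; apply.
  by move=> t; rewrite s1 addr0 => ht; rewrite cat_loopl //; lra.
have := last_map 2 0 0 s; rewrite subr0 mul0r s1 subr0 => ->.
have := G _ gs; rewrite opprK add0r; apply.
by move=> t; rewrite s1' => ht; rewrite cat_loopr //; lra.
Qed.

Lemma Hol_cat f g : piecewise_C1 (fun t => \val (f t)) -> piecewise_C1 (fun t => \val (g t)) ->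
  Hol (fun t => \val (cat_loop f g t)) = Hol (fun t => \val (g t)) * Hol (fun t => \val (f t)).
Proof.
move=> fC gC; have [N1 N10 [D1 fD]] := loop_subdivided f.
have [N2 N20 [D2 gD]] := loop_subdivided g.
(* Both words are brought to the common length N1 N2, since [cat_loop] gives each loop half of the
   time. *)
have {fD} := subdivided_stretch N20 fD; have {gD} := subdivided_stretch N10 gD.
rewrite (mulnC N2); move: (fun i => D2 _) (fun i => D1 _); clear D1 D2.
have N0 : (0 < N1 * N2)%N by rewrite muln_gt0 N10.
move: (N1 * N2)%N N0 => N N0 D' D gD fD {N1 N2 N10 N20}.
have Nr : 0 < N%:R :> R by rewrite ltr0n.
pose E i := if (i < N)%N then D i else D' (i - N)%N.
have half k : 2 * (k%:R / (N + N)%:R) = k%:R / N%:R :> R.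
  by rewrite natrD; field; rewrite ?(gt_eqF Nr) ?gt_eqF ?addr_gt0.
have dbl k (t : R) : (k%:R / (N + N)%:R <= t) = (k%:R / N%:R <= 2 * t).
  by rewrite -half ler_pM2l ?ltr0n.
have dbl' k (t : R) : (t <= k%:R / (N + N)%:R) = (2 * t <= k%:R / N%:R).
  by rewrite -half ler_pM2l ?ltr0n.
have one : N%:R / N%:R = 1 :> R by rewrite divff ?gt_eqF.
have cD : subdivided (fun t => \val (cat_loop f g t)) (N + N) E.
  move=> i iN t; rewrite dbl dbl' /E => /andP[h1 h2]; case: ltnP => iN'.
    rewrite cat_loopl; first by apply: fD; rewrite ?h1.
    have : i.+1%:R / N%:R <= 1 :> R by rewrite ler_pdivrMr // mul1r ler_nat.
    by lra.
  have e (k : nat) : (N <= k)%N -> (k - N)%:R / N%:R = k%:R / N%:R - 1 :> R.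
    by move=> h; rewrite natrB // mulrBl one.
  have : 1 <= i%:R / N%:R :> R by rewrite ler_pdivlMr // mul1r ler_nat.
  move=> h3; rewrite cat_loopr; last by lra.
  apply: gD; first by lia.
  by rewrite -subSn // !e //; [lra|exact: leqW].
have cl k : (k <= N)%N -> \val (cat_loop f g (k%:R / (N + N)%:R)) = \val (f (k%:R / N%:R)).
  move=> kN; rewrite cat_loopl ?half //.
  have : k%:R / N%:R <= 1 :> R by rewrite ler_pdivrMr // mul1r ler_nat.
  by rewrite -half; lra.
have cr k : \val (cat_loop f g ((N + k)%:R / (N + N)%:R)) = \val (g (k%:R / N%:R)).
  have h : (N + k)%:R / N%:R = 1 + k%:R / N%:R :> R by rewrite natrD mulrDl one.
  have h0 : 0 <= k%:R / N%:R :> R by rewrite divr_ge0 ?ler0n.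
  rewrite cat_loopr; first by rewrite half h addrAC subrr add0r.
  by have := half (N + k)%N; rewrite h; lra.
have pl k : (k <= N)%N -> path_transport (fun t => \val (cat_loop f g t)) (N + N) E k =
    path_transport (fun t => \val (f t)) N D k.
  elim: k => [_|k IH kN]; first by rewrite !path_transport0.
  have kN' := ltnW kN; rewrite path_transportS [in RHS]path_transportS (IH kN') (cl _ kN) (cl _ kN').
  by rewrite /E kN.
have pr k : path_transport (fun t => \val (cat_loop f g t)) (N + N) E (N + k) =
    path_transport (fun t => \val (g t)) N D' k * path_transport (fun t => \val (f t)) N D N.
  elim: k => [|k IH]; first by rewrite addn0 path_transport0 mul1r; exact: pl (leqnn N).
  rewrite [in LHS]addnS path_transportS [in RHS]path_transportS IH [LHS]mulrA -addnS !cr.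
  by rewrite /E ltnNge leq_addr addKn.
have cC := piecewise_C1_cat fC gC.
rewrite (Hol_path_transport _ (fun t _ => loop_Sigma (cat_loop f g) t) cC cD); last by rewrite addn_gt0 N0.
rewrite pr (Hol_path_transport N0 (fun t _ => loop_Sigma f t) fC fD).
by rewrite (Hol_path_transport N0 (fun t _ => loop_Sigma g t) gC gD).
Qed.

End Homotopy.

(** * Polygonal loops and their words *)

Section Polylines.
Variable R : realType.
Implicit Types (q : R[i]) (s : seq R[i]) (w : seq patch) (D E : patch) (t : R).

(* The vertices q, s`_0, s`_1, ... are reached at the times 0, 1, 2, ... *)
Fixpoint polyline q s t : R[i] :=
  if s is q' :: s' then
    polyline q' s' (t - 1) + (Num.min (Num.max t 0) 1 - 1)%:C * (q' - q)
  else q.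

Lemma polyline_start q s t : t <= 0 -> polyline q s t = q.
Proof.
elim: s q t => //= q' s IH q t t0.
rewrite IH; last by lra.
by rewrite (max_r t0) (min_l ler01) sub0r rmorphN mulN1r opprB addrC subrK.
Qed.

Lemma polyline_edge q q' s t : 0 <= t <= 1 -> polyline q (q' :: s) t = q + t%:C * (q' - q).
Proof.
move=> /andP[t0 t1]; rewrite /= polyline_start; last by lra.
rewrite (max_l t0) (min_l t1) rmorphB rmorph1; ring.
Qed.

Lemma polyline_tail q q' s t : 1 <= t -> polyline q (q' :: s) t = polyline q' s (t - 1).
Proof.
move=> t1; rewrite /= max_l; last by lra.
by rewrite (min_r t1) subrr mul0r addr0.
Qed.

Lemma polyline_end q s t : (size s)%:R <= t -> polyline q s t = last q s.
Proof.
elim: s q t => //= q' s IH q t; rewrite -natr1 => h.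
have s0 : 0 <= (size s)%:R :> R by rewrite ler0n.
by rewrite -[LHS]/(polyline q (q' :: s) t) polyline_tail ?IH //; lra.
Qed.

Lemma polyline_catl q s s' t : t <= (size s)%:R ->
  polyline q (s ++ s') t = polyline q s t.
Proof.
elim: s q t => [|q' s IH] q t /=; first exact: polyline_start.
by rewrite -natr1 => h; rewrite IH //; lra.
Qed.

Lemma polyline_catr q s s' t : (size s)%:R <= t ->
  polyline q (s ++ s') t = polyline (last q s) s' (t - (size s)%:R).
Proof.
elim: s q t => [|q' s IH] q t; first by rewrite subr0.
have s0 : 0 <= (size s)%:R :> R by rewrite ler0n.
rewrite [size _]/= -natr1 => h; rewrite cat_cons polyline_tail; last by lra.
by rewrite IH; [congr (polyline _ _ _); lra|lra].
Qed.

Lemma polyline_lipschitz q s : exists2 L, 0 < L &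
  forall t u, l1norm (polyline q s t - polyline q s u) <= L * `|t - u|.
Proof.
have clamp t u : `|Num.min (Num.max t 0) 1 - 1 - (Num.min (Num.max u 0) 1 - 1)| <= `|t - u|.
  have := ler_norm (t - u); have := ler_norm (- (t - u)); rewrite normrN => h1 h2.
  rewrite ler_norml; case: (lerP t 0) => ?; case: (lerP u 0) => ?;
    rewrite ?(min_l ler01); try case: (lerP t 1) => ?; try case: (lerP u 1) => ?;
    by apply/andP; split; lra.
elim: s q => [|q' s IH] q.
  by exists 1 => // t u; rewrite subrr l1norm_0 mul1r.
have [L L0 HL] := IH q'; exists (L + l1norm (q' - q)).
  by rewrite ltr_wpDr ?l1norm_ge0.
move=> t u; rewrite /= opprD addrACA -mulrBl -rmorphB mulrDl.
apply: le_trans (l1normD _ _) _; apply: lerD.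
  by apply: le_trans (HL _ _) _; rewrite opprB addrA subrK.
by rewrite l1norm_Ml mulrC; apply: ler_wpM2l (clamp t u); exact: l1norm_ge0.
Qed.

(** One letter for each edge: by convexity it suffices to have both end points of the edge in its
    patch. *)
Fixpoint route q s w : Prop :=
  match s, w with
  | q' :: s', D :: w' => [/\ patch_set D q, patch_set D q' & route q' s' w']
  | [::], [::] => True
  | _, _ => False
  end.

Lemma route_size q s w : route q s w -> size s = size w.
Proof. by elim: s q w => [|q' s IH] q [|D w] //= [_ _ /IH ->]. Qed.

Lemma polyline_patch q s w i t : route q s w -> (i < size w)%N ->
  i%:R <= t <= i.+1%:R -> patch_set (nth Middle w i) (polyline q s t).
Proof.
elim: s q w i t => [|q' s IH] q [|D w] //= [|i] t [Dq Dq' r] iw ht.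
  by rewrite -/(polyline q (q' :: s) t) polyline_edge //; exact: patch_convex.
have i0 : 0 <= i%:R :> R by rewrite ler0n.
move: ht; rewrite -!natr1 => ht.
rewrite -/(polyline q (q' :: s) t) polyline_tail; last by lra.
by apply: (IH _ _ _ _ r iw); rewrite -natr1; lra.
Qed.

Lemma polyline_Sigma q s w t : Sigma q -> route q s w -> Sigma (polyline q s t).
Proof.
elim: s q w t => [|q' s IH] q [|D w] //= t Sq [Dq Dq' r].
rewrite -/(polyline q (q' :: s) t); have [t0|t0] := lerP t 0.
  by rewrite polyline_start.
have [t1|t1] := lerP t 1.
  by rewrite polyline_edge ?(ltW t0) //; apply: patch_Sigma (patch_convex Dq Dq' _); rewrite ltW.
by rewrite polyline_tail ?(ltW t1) //; apply: IH r; exact: patch_Sigma Dq'.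
Qed.

(** Every letter takes the time 1 / size w, so words have to be brought to the same length before
    they can be compared. *)
Definition follows (z : R -> R[i]) w := subdivided z (size w) (nth Middle w).

Lemma polyline_follows q s w : route q s w ->
  follows (fun t => polyline q s ((size w)%:R * t)) w.
Proof.
move=> r i iw t /andP[h1 h2]; have w0 : 0 < (size w)%:R :> R by rewrite ltr0n (leq_ltn_trans _ iw).
by apply: (polyline_patch r iw); rewrite mulrC -ler_pdivrMr // h1 -ler_pdivlMr.
Qed.

End Polylines.

(** * Loops that follow a word of convex sets *)

Section FollowingLoops.
Variables (R : realType) (x : Sigma (R := R)).
Local Notation I := (`[0%R, 1%R]%classic : set R).
Implicit Types (f g h : loop R x) (w : seq patch).

Lemma within_of_l1norm (T : topologicalType) (A : set T) (f : T -> Sigma (R := R)) :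
  (forall u, A u -> forall e, 0 < e ->
    \forall v \near u, A v -> l1norm (\val (f v) - \val (f u)) < e) ->
  {within A, continuous f}.
Proof.
move=> H; apply: (@continuous_comp_initial _ (subspace A)).
apply/subspace_continuousP => u Au; apply/cvgrPdist_lt => -[e e'].
rewrite ltcE /= => /andP[/eqP-> e0]; apply: filterS (H u Au e e0) => v Hv Av.
rewrite distrC; set y := _ - _; apply: le_lt_trans (_ : _ <= (l1norm y)%:C) _; last first.
  by rewrite ltcR; exact: Hv.
rewrite normc_def lecR /l1norm; set a := complex.Re y; set b := complex.Im y.
rewrite -[leRHS]ger0_norm ?addr_ge0 // -sqrtr_sqr; apply: ler_wsqrtr.
rewrite sqrrD !real_normK ?num_real // -addrA lerD2l lerDr mulrn_wge0 //.
Qed.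

Lemma path_loop (z : R -> R[i]) (L : R) : (forall t, Sigma (z t)) -> 0 < L ->
  (forall t u, l1norm (z t - z u) <= L * `|t - u|) -> z 0 = \val x -> z 1 = \val x ->
  exists f, forall t, \val (f t) = z t.
Proof.
move=> zS L0 zL z0 z1; pose F t : Sigma (R := R) := SigSub (mem_set (zS t)).
have cF : {within I, continuous F}.
  apply: within_of_l1norm => t _ e e0; apply/nbhs_ballP; exists (e / L) => /=.
    by rewrite divr_gt0.
  move=> u; rewrite /ball /= distrC ltr_pdivlMr // mulrC => h _.
  exact: le_lt_trans (zL _ _) h.
have F0 : F 0 = x by exact: val_inj.
have F1 : F 1 = x by exact: val_inj.
by exists (Loop cF F0 F1).
Qed.

Lemma unit_grid N (t : R) : (0 < N)%N -> I t ->
  exists2 i, (i < N)%N & i%:R / N%:R <= t <= i.+1%:R / N%:R.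
Proof.
rewrite /= in_itv /= => N0 /andP[t0 t1]; have Nr : 0 < N%:R :> R by rewrite ltr0n.
have [t1'|t1'] := ltrP t 1; last first.
  exists N.-1; first by rewrite prednK.
  have -> : t = 1 by apply/eqP; rewrite eq_le t1.
  by rewrite prednK // divff ?gt_eqF // lexx ler_pdivrMr // mul1r ler_nat leq_pred.
have h0 : 0 <= t * N%:R by rewrite mulr_ge0 // ltW.
have /andP[h1 h2] := truncn_itv h0.
exists (Num.truncn (t * N%:R)); last by rewrite ler_pdivrMr // ler_pdivlMr // h1 ltW.
by rewrite -(ltr_nat R) (le_lt_trans h1) // -[ltRHS]mul1r ltr_pM2r.
Qed.

(** The straight-line homotopy stays in [Sigma], because at each time both points lie in one convex
    patch. *)
Lemma subdivided_homotopic f g N (D : nat -> patch) : (0 < N)%N ->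
  subdivided (fun t => \val (f t)) N D -> subdivided (fun t => \val (g t)) N D ->
  homotopic f g.
Proof.
move=> N0 fD gD.
pose h (u : R * R) := \val (f u.2) + u.1%:C * (\val (g u.2) - \val (f u.2)).
have hS u : (I `*` I) u -> Sigma (h u).
  move=> [Is It]; have [i iN ht] := unit_grid N0 It; apply: (@patch_Sigma _ (D i)).
  apply: patch_convex; [exact: fD|exact: gD|].
  by move: Is; rewrite /= in_itv.
(* Outside the unit square [h] may leave [Sigma]; the base point is the default value there. *)
have {hS} hS u : exists z : Sigma (R := R), (I `*` I) u -> \val z = h u.
  have [Iu|nI] := pselect ((I `*` I) u); last by exists x.
  by exists (SigSub (mem_set (hS u Iu))).
have [H HE] := choice hS.
have I0 : I 0 by rewrite /= in_itv /= lexx ler01.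
have I1 : I 1 by rewrite /= in_itv /= lexx ler01.
exists H; split.
- apply: within_of_l1norm => u Iu e e0.
  set m := l1norm (\val (g u.2) - \val (f u.2)).
  have m0 : 0 <= m by exact: l1norm_ge0.
  pose d := e / (3 + m).
  have d0 : 0 < d by rewrite divr_gt0 // ltr_wpDr.
  have de : (3 + m) * d = e by rewrite mulrC divfK // gt_eqF // ltr_wpDr.
  have nf := near_within_l1norm (@loop_cont _ _ _ f) Iu.2 d0.
  have ng := near_within_l1norm (@loop_cont _ _ _ g) Iu.2 d0.
  have c2 := @cvg_snd _ _ (nbhs u.1) (nbhs u.2) _.
  have c1 := @cvg_fst _ _ (nbhs u.1) (nbhs u.2) _.
  have ns : \forall s \near u.1, `|s - u.1| < d.
    by apply/nbhs_ballP; exists d => // s; rewrite /ball /= distrC.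
  have {}nf : \forall v \near u, I v.2 -> l1norm (\val (f v.2) - \val (f u.2)) < d by apply: c2 nf.
  have {}ng : \forall v \near u, I v.2 -> l1norm (\val (g v.2) - \val (g u.2)) < d by apply: c2 ng.
  have {}ns : \forall v \near u, `|v.1 - u.1| < d by apply: c1 ns.
  apply: filterS3 nf ng ns => v nf ng ns Iv; rewrite (HE _ Iu) (HE _ Iv) /h.
  have [I1v I2v] := Iv; have {}nf := nf I2v; have {}ng := ng I2v; move: nf ng.
  move: I1v; rewrite /= in_itv /= => /andP[v0 v1].
  set a := \val (f v.2); set b := \val (g v.2) => nf ng.
  have -> : a + v.1%:C * (b - a) - (\val (f u.2) + u.1%:C * (\val (g u.2) - \val (f u.2))) =
      (1 - v.1)%:C * (a - \val (f u.2)) + v.1%:C * (b - \val (g u.2)) +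
      (v.1 - u.1)%:C * (\val (g u.2) - \val (f u.2)).
    by rewrite !rmorphB rmorph1; ring.
  apply: le_lt_trans (l1normD _ _) _; apply: le_lt_trans (lerD (l1normD _ _) (lexx _)) _.
  rewrite !l1norm_Ml (ger0_norm v0) ger0_norm ?subr_ge0 // -/m.
  have h1 := ler_wpM2r m0 (ltW ns).
  have h2 : (1 - v.1) * l1norm (a - \val (f u.2)) <= (1 - v.1) * d.
    by rewrite ler_wpM2l ?subr_ge0 // ltW.
  have h3 : v.1 * l1norm (b - \val (g u.2)) <= v.1 * d by rewrite ler_wpM2l // ltW.
  by rewrite -de; lra.
- by move=> t It; apply: val_inj; rewrite /= HE // /h mul0r addr0.
- by move=> t It; apply: val_inj; rewrite /= HE // /h mul1r addrC subrK.
move=> s Is; split; apply: val_inj; rewrite HE // /h /= ?loop_start ?loop_end;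
  by rewrite subrr mulr0 addr0.
Qed.

Lemma path_route (z : nat -> R[i]) w :
  (forall i, (i < size w)%N -> patch_set (nth Middle w i) (z i) /\ patch_set (nth Middle w i) (z i.+1)) ->
  exists2 s, route (z 0%N) s w & last (z 0%N) s = z (size w).
Proof.
elim: w z => [|D w IH] z H; first by exists [::].
have [s r e] := IH (fun i => z i.+1) (fun i => H i.+1); exists (z 1%N :: s) => //=.
by have [] := H 0%N isT.
Qed.

Lemma route_cat (q : R[i]) s w s' w' : route q s w -> route (last q s) s' w' ->
  route q (s ++ s') (w ++ w' : seq patch).
Proof. by elim: s q w => [|q' s IH] q [|D w] //= [? ? r] ?; split=> //; exact: IH. Qed.

Lemma follows_route f w : (0 < size w)%N -> follows (fun t => \val (f t)) w ->
  exists2 s, route (\val x) s w & last (\val x) s = \val x.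
Proof.
move=> w0 fw; pose z i := \val (f (i%:R / (size w)%:R)).
have [i iw|s] := @path_route z w.
  by split; apply: fw => //; rewrite lexx ?ler_pM2r ?invr_gt0 ?ltr0n // ler_nat leqnSn.
rewrite /z mul0r loop_start divff ?pnatr_eq0 -?lt0n // loop_end => h1 h2.
by exists s.
Qed.

Definition is_polyline f s := forall t, \val (f t) = polyline (\val x) s ((size s)%:R * t).

Lemma polyline_loop s w : route (\val x) s w -> last (\val x) s = \val x -> exists f, is_polyline f s.
Proof.
move=> r e; have [L L0 HL] := polyline_lipschitz (\val x) s.
have n0 : 0 <= (size s)%:R :> R by rewrite ler0n.
apply: (@path_loop _ (L * ((size s)%:R + 1))).
- by move=> t; apply: polyline_Sigma r; exact: (set_mem (valP x)).
- by rewrite mulr_gt0 // ltr_wpDl.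
- move=> t u; apply: le_trans (HL _ _) _; rewrite -mulrBr normrM (ger0_norm n0) -mulrA.
  by rewrite ler_pM2l // ler_wpM2r // lerDl.
- by rewrite mulr0 polyline_start.
by rewrite mulr1 polyline_end.
Qed.

Lemma is_polyline_follows f s w : is_polyline f s -> route (\val x) s w ->
  follows (fun t => \val (f t)) w.
Proof.
move=> fs r i iw t ht; rewrite fs (route_size r).
exact: (polyline_follows r iw ht).
Qed.

Lemma is_polyline_cat f g h s s' : (0 < size s)%N -> is_polyline f s -> is_polyline g s' ->
  is_polyline h (s ++ s') -> last (\val x) s = \val x -> homotopic h (cat_loop f g).
Proof.
move=> s0 fs gs hs e; pose n : R := (size s)%:R; pose m : R := (size s')%:R.
have n0 : 0 < n by rewrite ltr0n.
have m0 : 0 <= m by rewrite ler0n.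
have nm0 : n + m != 0 by rewrite gt_eqF // ltr_wpDr.
(* The polyline of s ++ s' runs through s during the time n / (n + m), while [cat_loop] spends 1/2
   on it; [phi] is the piecewise linear change of time. *)
pose phi (t : R) := (2 * n * Num.min t 2^-1 + 2 * m * Num.max (t - 2^-1) 0) / (n + m).
have phil t : t <= 2^-1 -> (n + m) * phi t = n * (2 * t).
  move=> ht; rewrite /phi min_l // max_r; last by lra.
  by field.
have phir t : 2^-1 <= t -> (n + m) * phi t = n + m * (2 * t - 1).
  move=> ht; rewrite /phi min_r // max_l; last by lra.
  by field.
have cphi : continuous phi.
  move=> t; apply: cvgM; last exact: cvg_cst.
  apply: cvgD; apply: cvgM; try exact: cvg_cst.
    apply: (@continuous_min R R id (cst 2^-1)); [exact: cvg_id|exact: cvg_cst].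
  apply: (@continuous_max R R (fun t => t - 2^-1) (cst 0)); last exact: cvg_cst.
  by apply: cvgB; [exact: cvg_id|exact: cvg_cst].
have phi0 : phi 0 = 0.
  apply: (mulfI nm0); rewrite phil ?invr_ge0 ?ler0n //; by rewrite !mulr0.
have phi1 : phi 1 = 1.
  apply: (mulfI nm0); rewrite phir; last by lra.
  by ring.
have hE t : I t -> cat_loop f g t = h (phi t).
  move=> It; have /andP[t0 t1] : 0 <= t <= 1 by move: It; rewrite /= in_itv.
  apply: val_inj; rewrite hs size_cat natrD -/n -/m.
  have [ht|/ltW ht] := lerP t 2^-1.
    rewrite phil // cat_loopl // polyline_catl ?fs // -/n.
    by rewrite ger_pMr //; lra.
  rewrite phir // cat_loopr // polyline_catr ?gs -/n; last first.
    by rewrite lerDl mulr_ge0 //; lra.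
  by rewrite e addrAC subrr add0r.
apply: (@homotopic_reparam _ _ _ h _ _ id phi) => //.
  by move=> t; exact: cvg_id.
move=> t; rewrite /= !in_itv /= => /andP[t0 t1].
have nm : 0 < n + m by rewrite ltr_wpDr.
have [ht|/ltW ht] := lerP t 2^-1.
  have h1 : 0 <= (n + m) * phi t by rewrite phil // mulr_ge0 ?mulr_ge0 // ltW.
  have h2 : (n + m) * phi t <= n + m.
    by rewrite phil //; apply: (@le_trans _ _ n); [rewrite ger_pMr //; lra|rewrite lerDl].
  by rewrite -(ler_pM2l nm) mulr0 h1 -(ler_pM2l nm) mulr1.
have h3 : 0 <= m * (2 * t - 1) by rewrite mulr_ge0 //; lra.
have h4 : m * (2 * t - 1) <= m by apply: ler_piMr => //; lra.
by rewrite -(ler_pM2l nm) mulr0 -[in X in _ && X](ler_pM2l nm) mulr1 phir //; apply/andP; split; lra.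
Qed.

Lemma follows_homotopic f g w : (0 < size w)%N -> follows (fun t => \val (f t)) w ->
  follows (fun t => \val (g t)) w -> homotopic f g.
Proof. by move=> w0; exact: subdivided_homotopic. Qed.

(** A loop that follows w ++ w' need not pass through the base point between the two words, but it
    is homotopic to a polyline that does. *)
Lemma follows_cat f g h w w' : (0 < size w)%N -> (0 < size w')%N ->
  follows (fun t => \val (f t)) w -> follows (fun t => \val (g t)) w' ->
  follows (fun t => \val (h t)) (w ++ w') -> homotopic h (cat_loop f g).
Proof.
move=> w0 w0' fw gw hw; have [s r e] := follows_route w0 fw.
have [s' r' e'] := follows_route w0' gw.
have [f1 fs] := polyline_loop r e; have [g1 gs] := polyline_loop r' e'.
have rr : route (\val x) (s ++ s') (w ++ w') by apply: route_cat; rewrite ?e.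
have [|h1 hs] := polyline_loop rr; first by rewrite last_cat e.
apply: (homotopic_trans (g := h1)).
  apply: (follows_homotopic _ hw (is_polyline_follows hs rr)).
  by rewrite size_cat addn_gt0 w0.
apply: (homotopic_trans (g := cat_loop f1 g1)).
  by apply: is_polyline_cat => //; rewrite (route_size r).
apply: homotopic_cat; first exact: follows_homotopic w0 (is_polyline_follows fs r) fw.
exact: follows_homotopic w0' (is_polyline_follows gs r') gw.
Qed.

Lemma follows_rev f w : follows (fun t => \val (f t)) w ->
  follows (fun t => \val (rev_loop f t)) (rev w).
Proof.
move=> fw i; rewrite size_rev => iw t /andP[h1 h2].
have w0 : 0 < (size w)%:R :> R by rewrite ltr0n (leq_ltn_trans _ iw).
rewrite nth_rev //; apply: fw; first by lia.
have E (k : nat) : (k <= size w)%N -> (size w - k)%:R / (size w)%:R = 1 - k%:R / (size w)%:R :> R.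
  by move=> h; rewrite natrB // mulrBl divff // gt_eqF.
by rewrite -subSn // subSS !E ?(ltnW iw) //; apply/andP; split; lra.
Qed.

End FollowingLoops.

(** * Generation of the fundamental group *)

Section Generation.
Variables (R : realType) (p : R) (hp : 0 < p < 1).
Local Notation x := (basept hp).
Implicit Types (w v : seq patch) (D E : patch) (f g : loop R x).

Let p0 : 0 < p. Proof. by case/andP: hp. Qed.
Let p1 : p < 1. Proof. by case/andP: hp. Qed.

(** At pi / 3 the relation cos (2 t) = - cos t becomes 2 c^2 + c - 1 = 0, whose positive root is
    1/2. *)
Let cos_pi3 : cos (pi / 3) = 2^-1 :> R.
Proof.
have pi0 := pi_gt0 R.
have c0 : 0 < cos (pi / 3 : R) by apply: cos_gt0_pihalf; apply/andP; split; lra.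
have h : cos (pi / 3 + pi / 3 : R) = - cos (pi / 3).
  by rewrite -[in RHS]cosN -cosDpi; congr cos; lra.
have := h; rewrite cosD => h'; have := cos2Dsin2 (pi / 3 : R).
by nra.
Qed.

Let cos_lower (t : R) : - (pi / 3) <= t <= pi / 3 -> 2^-1 <= cos t.
Proof.
have pi0 := pi_gt0 R; rewrite -cos_pi3 -ler_norml => ht.
rewrite -(cos_norm t) leNgt ltr_cos ?in_itv /= ?normr_ge0 //=.
- by rewrite -leNgt.
- by apply/andP; split; lra.
by rewrite (le_trans ht); lra.
Qed.

Let sin_lt1 (t : R) : 2^-1 <= `|cos t| -> `|sin t| < 1.
Proof.
have := cos2Dsin2 t; rewrite -(real_normK (num_real (cos t))) -(real_normK (num_real (sin t))).
have := normr_ge0 (sin t); set s := `|sin t|; set c := `|cos t| => s0 e h.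
by rewrite ltNge; apply/negP => s1; nra.
Qed.

Let angle_right (t : R) : 0 <= t <= 1 / 6 \/ 5 / 6 <= t <= 1 -> 2^-1 <= cos (2 * pi * t).
Proof.
have pi0 := pi_gt0 R; case=> /andP[h1 h2].
  by apply: cos_lower; apply/andP; split; nra.
have -> : 2 * pi * t = 2 * pi * (t - 1) + pi *+ 2 :> R by ring.
by rewrite cosD2pi; apply: cos_lower; apply/andP; split; nra.
Qed.

Let angle_left (t : R) : 2 / 6 <= t <= 4 / 6 -> cos (2 * pi * t) <= - 2^-1.
Proof.
have pi0 := pi_gt0 R; move=> /andP[h1 h2].
have -> : 2 * pi * t = 2 * pi * (t - 2^-1) + pi :> R by field.
by rewrite cosDpi lerN2; apply: cos_lower; apply/andP; split; nra.
Qed.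

Let angle_up (t : R) : 1 / 6 <= t <= 2 / 6 -> 0 < sin (2 * pi * t).
Proof.
have pi0 := pi_gt0 R; move=> /andP[h1 h2].
by apply: sin_gt0_pi; apply/andP; split; nra.
Qed.

Let angle_down (t : R) : 4 / 6 <= t <= 5 / 6 -> sin (2 * pi * t) < 0.
Proof.
have pi0 := pi_gt0 R; move=> /andP[h1 h2].
have -> : 2 * pi * t = 2 * pi * (t - 2^-1) + pi :> R by field.
by rewrite sinDpi oppr_lt0; apply: sin_gt0_pi; apply/andP; split; nra.
Qed.

(** Sixths of the circle: within pi / 3 of the base point the cosine keeps the circle in the strip;
    on the opposite third cos <= - 1/2 and |sin| < 1 put it in the sector; the two remaining arcs
    lie in the half-planes. *)
Lemma gamma_follows a : follows (fun t => \val (gamma a hp t))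
  (if a then [:: Middle; Lower; Rightmost; Rightmost; Upper; Middle]
   else [:: Middle; Upper; Leftmost; Leftmost; Lower; Middle]).
Proof.
have left (k t : R) : 0 < k -> 2 / 6 <= t <= 4 / 6 ->
    2 * (k * cos (2 * pi * t)) + `|k * sin (2 * pi * t)| < 0.
  move=> k0 ht; have h := angle_left ht; rewrite normrM (gtr0_norm k0).
  have : `|sin (2 * pi * t)| < 1 by apply: sin_lt1; rewrite ler0_norm; lra.
  by move=> h'; nra.
have mid (k t : R) : 0 < k < 1 -> 0 <= t <= 1 / 6 \/ 5 / 6 <= t <= 1 ->
    0 < k * cos (2 * pi * t) < 1.
  move=> /andP[k0 k1] /angle_right h; have := cos_le1 (2 * pi * t) => h'.
  by apply/andP; split; nra.
have q0 : 0 < 1 - p by rewrite subr_gt0.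
have hq : 0 < 1 - p < 1 by rewrite q0 /= gtrBl.
have E b u : \val (gamma b hp u) = circle b p u by [].
case: a => -[|[|[|[|[|[|i]]]]]] // _ t ht; rewrite E circleE /puncture /=;
  rewrite /= ?mulr0n in ht.
- have /andP[h1 h2] : 0 < (1 - p) * cos (2 * pi * t) < 1 by apply: mid => //; left; lra.
  by apply/andP; split; lra.
- have := angle_up ht; nra.
- by have := left _ t q0; rewrite -[1 - p]opprB !mulNr normrN; lra.
- by have := left _ t q0; rewrite -[1 - p]opprB !mulNr normrN; lra.
- have := angle_down ht; nra.
- have /andP[h1 h2] : 0 < (1 - p) * cos (2 * pi * t) < 1 by apply: mid => //; right; lra.
  by apply/andP; split; lra.
- by rewrite add0r subr0; apply: mid => //; left; lra.
- by rewrite subr0 mulr_gt0 // angle_up.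
- by rewrite add0r subr0; apply: left => //; lra.
- by rewrite add0r subr0; apply: left => //; lra.
- by rewrite subr0 pmulr_rlt0 // angle_down.
by rewrite add0r subr0; apply: mid => //; right; lra.
Qed.

Variable P : pi1 R x -> Prop.
Hypothesis P1 : P 1%g.
Hypothesis PM : forall c d, P c -> P d -> P (c * d)%g.
Hypothesis Pgamma : forall a, P (pi1_class (gamma a hp)).
Hypothesis Pgamma_rev : forall a, P (pi1_class (rev_loop (gamma a hp))).

(** By [follows_homotopic] the class of a loop depends only on its word, so [Q w] holds as soon as
    one loop with word [w] has its class in [P]. *)
Let Q w := forall f, follows (fun t => \val (f t)) w -> P (pi1_class f).

Let word_loop f w : follows (fun t => \val (f t)) w -> (0 < size w)%N ->
  P (pi1_class f) -> Q w.
Proof.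
by move=> fw w0 Pf g gw; rewrite (pi1_classP g f).2 //; exact: follows_homotopic w0 gw fw.
Qed.

(** A polyline that admits both words transfers [Q] from one to the other; all exchanges of letters
    below are made in this way. *)
Let word_chain s w w' : (0 < size w)%N -> route p%:C s w -> route p%:C s w' ->
  last p%:C s = p%:C -> Q w' -> Q w.
Proof.
move=> w0 r r' e Qw'; have [f fs] := @polyline_loop _ x _ _ r e.
apply: (@word_loop f _ (is_polyline_follows fs r) w0).
by apply: Qw'; exact: is_polyline_follows fs r'.
Qed.

Let word_cat s w s' w' : (0 < size w)%N -> (0 < size w')%N ->
  route p%:C s w -> last p%:C s = p%:C -> route p%:C s' w' -> last p%:C s' = p%:C ->
  Q w -> Q w' -> Q (w ++ w').
Proof.
move=> w0 w0' r e r' e' Qw Qw' h hw.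
have [f fs] := @polyline_loop _ x _ _ r e; have [g gs] := @polyline_loop _ x _ _ r' e'.
have fw := is_polyline_follows fs r; have gw := is_polyline_follows gs r'.
have -> : pi1_class h = pi1_class (cat_loop f g).
  by apply/pi1_classP; exact: follows_cat w0 w0' fw gw hw.
by rewrite -pi1_mulE; apply: PM; [exact: Qw'|exact: Qw].
Qed.

Let Mid_p : patch_set Middle p%:C. Proof. by []. Qed.

Let word_cst n : Q (nseq n.+1 Middle).
Proof.
apply: (@word_loop (cst_loop R x) (nseq n.+1 Middle) _ isT P1).
by move=> i; rewrite size_nseq => iN t _; rewrite nth_nseq iN.
Qed.

(* The base point is joined to a centre of the patch D inside Middle, then inside
   connector D; the vertices are p, waypoint D and centre D. *)
Let connector D := if D is Middle then Middle else if D is Lower then Lower else Upper.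
Let waypoint D : R[i] :=
  if D is Middle then p%:C else if D is Lower then p -i* 1 else p +i* 1.
Let centre D : R[i] :=
  match D with
  | Leftmost => -1 +i* 1
  | Rightmost => 2 +i* 1
  | _ => waypoint D
  end.

Let waypointM D : patch_set Middle (waypoint D). Proof. by case: D. Qed.
Let waypoint_in D : patch_set (connector D) (waypoint D).
Proof. by case: D => //=; rewrite ?oppr_lt0 ltr01. Qed.
Let centre_in D : patch_set D (centre D).
Proof. by case: D => //=; rewrite ?normr1 ?oppr_lt0 ?ltr01 //; lra. Qed.
Let centre_connector D : patch_set (connector D) (centre D).
Proof. by case: D => //=; rewrite ?oppr_lt0 ltr01. Qed.

Let m : R[i] := p +i* 1.
Let m' : R[i] := p -i* 1.
Let l : R[i] := -1 +i* 1.
Let l' : R[i] := -1 -i* 1.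
Let r : R[i] := 2 +i* 1.
Let r' : R[i] := 2 -i* 1.

(** The common point [q] excludes disjoint patches. As the centres of [Leftmost] and [Rightmost] are
    reached through [Upper], only their crossings with [Lower] give a generator or its inverse; all
    other words reduce to the constant one. *)
Let word_step D E (q : R[i]) : patch_set D q -> patch_set E q ->
  Q [:: Middle; connector D; D; E; connector E; Middle].
Proof.
have QM : Q [:: Middle; Middle; Middle; Middle; Middle; Middle] := @word_cst 5.
have mU : patch_set Upper m by rewrite /= ltr01.
have mM : patch_set Middle m by [].
have mL : patch_set Lower m' by rewrite /= oppr_lt0 ltr01.
have mM' : patch_set Middle m' by [].
have lU : patch_set Upper l by rewrite /= ltr01.
have lL : patch_set Leftmost l by rewrite /= normr1; lra.
have lL' : patch_set Leftmost l' by rewrite /= normrN normr1; lra.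
have lD : patch_set Lower l' by rewrite /= oppr_lt0 ltr01.
have rU : patch_set Upper r by rewrite /= ltr01.
have rR : patch_set Rightmost r by rewrite /= normr1; lra.
have rR' : patch_set Rightmost r' by rewrite /= normrN normr1; lra.
have rD : patch_set Lower r' by rewrite /= oppr_lt0 ltr01.
have QU : Q [:: Middle; Upper; Upper; Upper; Upper; Middle].
  by apply: (@word_chain [:: m; m; m; m; m; p%:C] _ _ _ _ _ _ QM).
have QL : Q [:: Middle; Lower; Lower; Lower; Lower; Middle].
  by apply: (@word_chain [:: m'; m'; m'; m'; m'; p%:C] _ _ _ _ _ _ QM).
have G0 : Q [:: Middle; Upper; Leftmost; Leftmost; Lower; Middle] :=
  @word_loop _ _ (@gamma_follows false) isT (Pgamma false).
have G1 : Q [:: Middle; Lower; Rightmost; Rightmost; Upper; Middle] :=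
  @word_loop _ _ (@gamma_follows true) isT (Pgamma true).
have G0' : Q [:: Middle; Lower; Leftmost; Leftmost; Upper; Middle] :=
  @word_loop _ _ (follows_rev (@gamma_follows false)) isT (Pgamma_rev false).
have G1' : Q [:: Middle; Upper; Rightmost; Rightmost; Lower; Middle] :=
  @word_loop _ _ (follows_rev (@gamma_follows true)) isT (Pgamma_rev true).
move=> Dq Eq; move: D E Dq Eq => [] [] Dq Eq //.
all: try by [exfalso; move: Dq Eq; rewrite /=; have := normr_ge0 (complex.Im q);
  have := ler_norm (complex.Im q); have := ler_norm (- complex.Im q);
  rewrite ?normrN; lra].
- by apply: (@word_chain [:: m; m; m; p%:C; p%:C; p%:C] _ _ _ _ _ _ QM).
- by apply: (@word_chain [:: m; m; l; l; m; p%:C] _ _ _ _ _ _ QU).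
- by apply: (@word_chain [:: m; m; r; r; m; p%:C] _ _ _ _ _ _ QU).
- by apply: (@word_chain [:: m'; m'; m'; p%:C; p%:C; p%:C] _ _ _ _ _ _ QM).
- by apply: (@word_chain [:: m'; l'; l'; l; m; p%:C] _ _ _ _ _ _ G0').
- by apply: (@word_chain [:: m'; r'; r'; r; m; p%:C] _ _ _ _ _ _ G1).
- by apply: (@word_chain [:: p%:C; p%:C; m; m; m; p%:C] _ _ _ _ _ _ QM).
- by apply: (@word_chain [:: p%:C; p%:C; m'; m'; m'; p%:C] _ _ _ _ _ _ QM).
- by apply: (@word_chain [:: m; l; l; m; m; p%:C] _ _ _ _ _ _ QU).
- by apply: (@word_chain [:: m; l; l'; l'; m'; p%:C] _ _ _ _ _ _ G0).
- by apply: (@word_chain [:: m; l; l; l; m; p%:C] _ _ _ _ _ _ QU).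
- by apply: (@word_chain [:: m; r; r; m; m; p%:C] _ _ _ _ _ _ QU).
- by apply: (@word_chain [:: m; r; r'; r'; m'; p%:C] _ _ _ _ _ _ G1').
by apply: (@word_chain [:: m; r; r; r; m; p%:C] _ _ _ _ _ _ QU).
Qed.

(* Every letter is repeated six times, so that inserting a detour to the base point
   does not change the length of the word. *)
Fixpoint stretch w : seq patch := if w is D :: w' then nseq 6 D ++ stretch w' else [::].

Let follows_stretch (z : R -> R[i]) w : follows z w -> follows z (stretch w).
Proof.
have -> : stretch w = mkseq (fun i => nth Middle w (i %/ 6)%N) (size w * 6).
  elim: w => // D w IH; rewrite [LHS]/(nseq 6 D ++ stretch w) IH mulSn /mkseq iotaD map_cat.
  rewrite -[(0 + 6)%N]/(6 + 0)%N iotaDl -map_comp; apply: (congr1 (cat (nseq 6 D))).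
  by apply: eq_map => i; rewrite /= divnDl.
move=> /subdivided_stretch => /(_ 6 isT) H i; rewrite size_mkseq => iw t ht.
by rewrite nth_mkseq //; exact: H.
Qed.

Let route_cons D w (q q' : R[i]) s : patch_set D q -> patch_set D q' -> route q' s w ->
  route q (q' :: s) (D :: w).
Proof. by []. Qed.

Local Ltac solve_route :=
  repeat (apply: route_cons; [by auto|by auto|]); by [].

(** Induction on the word: the first crossing, from D to E, is closed up through the base point by
    [word_step], and what remains starts in E. The detour inserted for this is then removed by two
    exchanges of letters. *)
Let word_prefix w D (q : R[i]) s : patch_set D q -> route q s w -> last q s = p%:C ->
  Q ([:: Middle; connector D; D] ++ stretch w).
Proof.
elim: w D q s => [|E w IH] D q s Dq.
  case: s => //= _ qp; suff -> : D = Middle by exact: (@word_cst 2).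
  move: Dq; rewrite qp {q qp}; case: D => //=; rewrite ?ltxx // normr0.
    by rewrite addr0 pmulr_rlt0 ?ltr0n // ltNge ltW.
  by rewrite pmulr_rgt0 ?ltr0n // subr_gt0 ltNge ltW.
case: s => //= q' s [Eq Eq' qs] sp.
have stretch_route v (y : R[i]) u : route y u v -> exists2 u', route y u' (stretch v) & last y u' = last y u.
  elim: v y u => [|F v IHv] y [|y' u] //=; first by exists [::].
  move=> [Fy Fy' /IHv[u' h1 h2]].
  by exists [:: y, y, y, y, y, y' & u'].
have [u uw ulast] := stretch_route _ _ _ qs.
have {IH} IH := IH E q' s Eq' qs sp.
rewrite sp in ulast.
have pair := word_step Dq Eq.
have W0 : Q ([:: Middle; connector D; D; E; connector E; Middle] ++
    ([:: Middle; connector E; E] ++ stretch w)).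
  apply: (@word_cat [:: waypoint D; centre D; q; centre E; waypoint E; p%:C] _ [:: waypoint E, centre E, q' & u]);
    first [done|exact: pair|exact: IH|solve_route].
(* The two visits to [Middle] are replaced by rests at the waypoint of E, so the whole detour lies
   in [connector E]. *)
have W1 : Q [:: Middle, connector D, D, E, connector E, connector E, connector E,
    connector E, E & stretch w].
  apply: (@word_chain [:: waypoint D, centre D, q, centre E, waypoint E, waypoint E, waypoint E, centre E, q' & u] _ _ _ _ _ _ W0);
    first [done|solve_route].
(* The detour shrinks to the centre of E. Its four letters and the E on either side are the six
   copies made by [stretch]. *)
apply: (@word_chain [:: waypoint D, centre D, q, centre E, centre E, centre E, centre E, centre E, q' & u] _ _ _ _ _ _ W1);
  first [done|solve_route].
Qed.

Lemma pi1_generated c : P c.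
Proof.
rewrite -[c]reprK; set f := repr c.
have [N N0 [D fD]] := loop_subdivided f; pose w := mkseq D N.
have fw : follows (fun t => \val (f t)) w.
  by move=> i; rewrite size_mkseq => iN t ht; rewrite nth_mkseq //; exact: fD.
have w0 : (0 < size w)%N by rewrite size_mkseq.
have [s r1 e1] := follows_route w0 fw.
have Qw := word_prefix (D := Middle) Mid_p r1 e1.
have fs := follows_stretch fw; have [|u r2 e2] := follows_route _ fs.
  by case: (w) w0.
(* Three letters [Middle] at the base point form a constant loop and supply the prefix that
   [word_prefix] expects. *)
have r3 : route p%:C ([:: p%:C; p%:C; p%:C] ++ u) ([:: Middle; Middle; Middle] ++ stretch w).
  by apply: route_cat.
have [h hs] := @polyline_loop _ x _ _ r3 e2.
have hw := is_polyline_follows hs r3.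
have c3 : follows (fun t => \val (cst_loop R x t)) [:: Middle; Middle; Middle].
  by move=> i iN t _; case: i iN => [|[|[|]]].
have := Qw h hw.
suff -> : pi1_class h = pi1_class f by [].
rewrite -[RHS](mulg1 (pi1_class f)) [RHS](pi1_mulE f (cst_loop R x)).
apply/pi1_classP; apply: follows_cat c3 fs hw => //.
by case: (w) w0.
Qed.

End Generation.

(** * Conjugacy of the holonomy and the representation *)

Section Representation.
Variables (R : realType) (p : R) (hp : 0 < p < 1).
Local Notation S := (TH1 R).
Local Notation x := (basept hp).
Local Notation val_loop f := (fun t => \val (loop_fun f t)).
Variables (rho : {lrmorphism galg (complex R) (pi1 R x) -> S}) (g : S).
Hypothesis gu : g \is a GRing.unit.

Definition rho_conj (c : pi1 R x) : S := g^-1 * rho (gbase 1 c) * g.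

Hypothesis Hol_gamma : forall a, Hol (circle a p) = rho_conj (pi1_class (gamma a hp)).

Let conjM (u v : S) : g^-1 * (u * v) * g = g^-1 * u * g * (g^-1 * v * g).
Proof. by rewrite !mulrA (mulrK gu). Qed.

Lemma rho_conj1 : rho_conj 1%g = 1.
Proof.
rewrite /rho_conj -[gbase 1 1%g]/(1 : galg R[i] (pi1 R x)) rmorph1 mulr1.
exact: mulVr.
Qed.

Lemma rho_conjM c d : rho_conj (c * d)%g = rho_conj c * rho_conj d.
Proof.
have e : gbase 1 (c * d)%g = gbase 1 c * gbase 1 d :> galg R[i] (pi1 R x).
  by rewrite -[RHS]/(gmul _ _) gmulUU mulr1.
rewrite /rho_conj e rmorphM; exact: conjM.
Qed.

Let represented c := exists f : loop R x, [/\ pi1_class f = c,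
  piecewise_C1 (val_loop f) & Hol (val_loop f) = rho_conj c].

Let cst_piecewise_C1 : piecewise_C1 (val_loop (cst_loop R x)).
Proof.
exists [:: 1]; split=> //=; first by rewrite ltr01.
case=> // _; exists (fun=> p%:C) => //.
have e (k : R) : derive1 (fun _ : R => k) = cst 0.
  by apply/funext => t; rewrite derive1_cst.
by split=> [t|t||] //=; rewrite ?e => t; exact: cvg_cst.
Qed.

Let Hol_cst : Hol (val_loop (cst_loop R x)) = 1 :> S.
Proof.
have D : subdivided (val_loop (cst_loop R x)) 1 (fun=> Middle) by [].
have h := Hol_path_transport (ltn0Sn 0) (fun t _ => real_Sigma hp) cst_piecewise_C1 D.
by rewrite h path_transportS path_transport0 mulr1; exact: transport_refl.
Qed.

Let rev_piecewise_C1 a : piecewise_C1 (val_loop (rev_loop (gamma a hp))).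
Proof.
exists [:: 1]; split=> //=; first by rewrite ltr01.
case=> // _.
exists (fun t => circle a p (-1 * t + 1)); first exact: C1_affine (C1_circle a p).
by move=> t _; rewrite mulN1r addrC.
Qed.

(** The existence of a piecewise C^1 representative and the value of its holonomy are proved
    together, by one induction over the generators. *)
Lemma all_represented c : represented c.
Proof.
apply: pi1_generated => {c} [|c d [f [<- fC fH]] [h [<- hC hH]]|a|a].
- by exists (cst_loop R x); split; rewrite ?rho_conj1.
- exists (cat_loop h f); split; [|exact: piecewise_C1_cat|].
    by rewrite -pi1_mulE.
  by rewrite Hol_cat // fH hH rho_conjM.
- by exists (gamma a hp); split=> //; [exact: piecewise_C1_circle|exact: Hol_gamma].
exists (rev_loop (gamma a hp)); split=> //.
have gC : piecewise_C1 (val_loop (gamma a hp)) by exact: piecewise_C1_circle.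
have rC := rev_piecewise_C1 a.
(* The holonomy of the reversed loop is forced to be the inverse, since its concatenation with the
   original loop is null-homotopic. *)
have := Hol_homotopic (cat_loop_rev (gamma a hp)) (piecewise_C1_cat gC rC) cst_piecewise_C1.
rewrite Hol_cst Hol_cat // [Hol (val_loop (gamma a hp))]Hol_gamma.
move: (Hol _) => X XH.
have := rho_conjM (pi1_class (gamma a hp)) (pi1_class (gamma a hp))^-1%g.
rewrite mulgV rho_conj1 => h; rewrite -[LHS]mulr1 h mulrA XH mul1r.
by congr rho_conj; exact: pi1_invE.
Qed.

(** [W_group] picks some representative; homotopy invariance gives it the holonomy of the one from
    [all_represented]. *)
Lemma W_groupE c : W_group c = rho_conj c.
Proof.
have [f [fc fC fH]] := all_represented c.
have ex : exists h : S, exists f : loop R x, [/\ pi1_class f = c, piecewise_C1 (val_loop f) &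
    h = Hol (val_loop f)] by exists (rho_conj c), f; split.
rewrite /W_group; have [h [hc hC ->]] := xgetPex 0 ex.
by rewrite -fH; apply: Hol_homotopic hC fC; apply/pi1_classP; rewrite hc.
Qed.

Lemma W_conj (u : galg R[i] (pi1 R x)) : W u = g^-1 * rho u * g.
Proof.
rewrite [u in RHS]galgE raddf_sum mulr_sumr mulr_suml; apply: eq_bigr => c _.
have e : rho (gbase (u c) c) = u c *: rho (gbase 1 c) by rewrite -linearZ /= -gbaseZ mulr1.
rewrite W_groupE /rho_conj [in RHS]/= e.
by rewrite -scalerAr -scalerAl.
Qed.

Lemma trace_map_W : trace_map (@W R p hp) = trace_map rho.
Proof.
apply/funext => c; apply/eqmodP; rewrite /= /equiv W_conj.
set u := rho (repr c); apply/asboolP => n; exists (g^-1 * u * g - u) => //.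
apply/asboolP; exists [:: (1, (g^-1 * u, g))].
rewrite big_seq1 scale1r /=; congr (_ - _).
by rewrite (mulVKr gu).
Qed.

End Representation.

Theorem proposition4p3 (R : realType) (p : R) (hp : 0 < p < 1)
    (Phi : TH1 R) (hPhi : KZ_associator Phi)
    (rho : {lrmorphism galg (complex R) (pi1 R (basept hp)) -> TH1 R}) :
  rho (gbase 1 (pi1_class (gamma false hp))) = ncexp (KV_aut Phi (varx R)) ->
  rho (gbase 1 (pi1_class (gamma true hp))) = ncexp (KV_aut Phi (vary R)) ->
  trace_map (@W R p hp) = trace_map rho.
Proof.
rewrite KV_autx KV_auty => rx ry.
have [g gu [e0 e1]] := KZ_associator_conj hPhi hp.
apply: (trace_map_W (g := g) gu) => -[].
  by rewrite (Hol_circle1 hp) /rho_conj ry -e1.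
by rewrite (Hol_circle0 hp) /rho_conj rx -e0.
Qed.
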